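(* Let $M$ be a symmetric $G$-martingale satisfying: $M_t\in L_G^2(\Omega_t)$ for each $t\ge 0$, and there is a constant $\Lambda>0$ with $\hat{\mathbb{E}}_t[|M_{t+s}-M_t|^2]\le \Lambda s$ for all $t,s\ge 0$. Let $L_t(a)$, $t\in[0,T]$, $a\in\mathbb{R}$, be the local time of $M$. Let $f:\mathbb{R}\to\mathbb{R}$ be a convex function whose left derivative $f'_-$ satisfies the linear growth condition $|f'_-(x)|\le C(1+|x|)$ for some constant $C$. Then for each $t\in[0,T]$, $$f(M_t)-f(M_0)=\int_0^t f'_-(M_s)\,dM_s+\frac12\int_{\mathbb{R}}L_t(a)\,df'_-(a),\quad\text{q.s.},$$ where $df'_-$ is the Lebesgue–Stieltjes measure of $f'_-$. Moreover, $\int_{\mathbb{R}}L_t(a)\,df'_-(a)\in L_G^1(\Omega_t)$.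
   Context: $G$-expectation. Let $\Omega_T=C_0([0,T];\mathbb{R}^d)$ be the space of continuous paths starting from $0$, with the supremum norm, Borel $\sigma$-algebra $\mathcal{B}(\Omega_T)$ and canonical process $B_t(\omega)=\omega_t$. Here $T>0$ is arbitrary, and the constructions for different $T$ are consistent. For $t\in[0,T]$, $L_{ip}(\Omega_t)=\{\varphi(B_{t_1},\dots,B_{t_k}):k\in\mathbb{N},\,t_1,\dots,t_k\in[0,t],\,\varphi\in C_{b.Lip}(\mathbb{R}^{k\times d})\}$, where $C_{b.Lip}$ denotes bounded Lipschitz functions. Let $G$ be a given monotone sublinear function on the symmetric $d\times d$ matrices. Peng's sublinear $G$-expectation $\hat{\mathbb{E}}$ on $L_{ip}(\Omega_T)$ is the one making $B$ a $G$-Brownian motion: $\hat{\mathbb{E}}[\varphi(B_{t+s}-B_t)]=u(s,0)$, with $u$ the viscosity solution of $\partial_t u=G(D^2u)$, $u(0,\cdot)=\varphi$. For $X=\varphi(B_{t_1},B_{t_2}-B_{t_1},\dots,B_{t_n}-B_{t_{n-1}})$, the conditional expectation is $\hat{\mathbb{E}}_{t_j}[X]=\phi(B_{t_1},\dots,B_{t_j}-B_{t_{j-1}})$ with $\phi(x_1,\dots,x_j)=\hat{\mathbb{E}}[\varphi(x_1,\dots,x_j,B_{t_{j+1}}-B_{t_j},\dots,B_{t_n}-B_{t_{n-1}})]$, and $\hat{\mathbb{E}}[\hat{\mathbb{E}}_{t_j}[X]]=\hat{\mathbb{E}}[X]$. For $p\ge1$, $L_G^p(\Omega_t)$ is the completion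 of $L_{ip}(\Omega_t)$ under $(\hat{\mathbb{E}}[|X|^p])^{1/p}$; $\hat{\mathbb{E}}$ and $\hat{\mathbb{E}}_t$ extend continuously to $L_G^1(\Omega_T)$. $\mathcal{P}$ denotes a weakly compact family of probability measures on $(\Omega_T,\mathcal{B}(\Omega_T))$ with $\hat{\mathbb{E}}[X]=\sup_{P\in\mathcal{P}}E_P[X]$ for $X\in L_G^1(\Omega_T)$; this formula also defines $\hat{\mathbb{E}}[X]$ for every Borel $X$ for which $E_P[X]$ exists for all $P\in\mathcal{P}$. The capacity is $c(A)=\sup_{P\in\mathcal{P}}P(A)$; a property holds q.s. (quasi-surely) if it holds outside a set $A$ with $c(A)=0$. Random variables equal q.s. are identified. $G$-martingales. A process $M$ is a $G$-martingale if $M_t\in L_G^1(\Omega_t)$ and $\hat{\mathbb{E}}_s[M_t]=M_s$ for $s\le t$; it is symmetric if $M$ and $-M$ are both $G$-martingales (then it is a classical martingale under each $P\in\mathcal{P}$). $M$ is taken with continuous paths. Its quadratic variation $\langle M\rangle$ is the limit, as the mesh of the partition of $[0,t]$ tends to $0$, of $\sum_j (M_{t_{j+1}}-M_{t_j})^2$; it is defined q.s. and is the classical quadratic variation of $M$ under each $P\in\mathcal{P}$. Integrand spaces. $M_G^{p,0}(0,T)$ is the set of $\eta_t=\sum_{j=0}^{N-1}\xi_j I_{[t_j,t_{j+1})}(t)$ with $N\in\mathbb N$, $0\le t_0\le\dots\le t_N\le T$, $\xi_j\in L_G^p(\Omega_{t_j})$. Put $\|\eta\|_{\bar M_G^p}=(\hat{\mathbb{E}}[\int_0^T|\eta_t|^p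 d\langle M\rangle_t])^{1/p}$ (the same formula is used for measurable processes), and let $\bar M_G^p(0,T)$ be the completion of $M_G^{p,0}(0,T)$ under this norm; a measurable process belongs to $\bar M_G^p(0,T)$ if it is a limit of elements of $M_G^{p,0}(0,T)$ in this norm, and processes at distance $0$ are identified. For every Borel $\varphi$ of linear growth, $(\varphi(M_t))_{t\le T}\in\bar M_G^2(0,T)$. Stochastic integral. For $\eta\in M_G^{2,0}(0,T)$, $\int_0^T\eta_t\,dM_t=\sum_j\xi_j(M_{t_{j+1}}-M_{t_j})$; since $\hat{\mathbb{E}}[(\int_0^T\eta_t dM_t)^2]\le\hat{\mathbb{E}}[\int_0^T|\eta_t|^2d\langle M\rangle_t]$, the integral extends continuously to a map $\bar M_G^2(0,T)\to L_G^2(\Omega_T)$. The process $t\mapsto\int_0^t\eta_s dM_s$ is taken in a continuous modification. Local time. $L_t(a):=|M_t-a|-|M_0-a|-\int_0^t\mathrm{sgn}(M_s-a)\,dM_s\in L_G^2(\Omega_t)$, with $\mathrm{sgn}(x)=1$ for $x>0$ and $-1$ for $x\le0$. It is taken in its modification that is jointly continuous in $(a,t)$; under each $P\in\mathcal{P}$ it coincides with the classical local time of $M$. *)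

(* Defs.v *)
From HB Require Import structures.
From mathcomp Require Import all_boot all_order all_algebra.
From mathcomp Require Import all_classical all_reals all_analysis.

Set Implicit Arguments.
Unset Strict Implicit.
Unset Printing Implicit Defensive.

Import Order.TTheory GRing.Theory Num.Theory.
Import numFieldNormedType.Exports.

Local Open Scope classical_set_scope.
Local Open Scope ring_scope.

(* A path is stored as a function on all of R. It is forced to be 0 outside
   [0,T], so that equality of paths is equality on [0,T]. *)
Definition path_set (R : realType) (d : nat) (T : R) :
    set {uniform` `[0, T] -> 'rV[R]_d} :=
  [set w : R -> 'rV[R]_d |
    [/\ {within `[0, T], continuous w}, w 0 = 0 &
        forall t, t \notin `[0, T] -> w t = 0]].

Definition path_space (R : realType) (d : nat) (T : R) : Type :=
  set_type (@path_set R d T).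

Lemma zero_path_in (R : realType) (d : nat) (T : R) :
  (fun=> 0) \in @path_set R d T.
Proof. by rewrite inE; split => // x; exact: cst_continuous. Qed.

(* The topology is that of uniform convergence on [0,T]; the sigma-algebra is
   generated by the open sets. *)
HB.instance Definition _ (R : realType) (d : nat) (T : R) :=
  Topological.copy (path_space d T) (set_type (@path_set R d T)).
HB.instance Definition _ (R : realType) (d : nat) (T : R) :=
  isPointed.Build (path_space d T) (SigSub (zero_path_in d T)).
HB.instance Definition _ (R : realType) (d : nat) (T : R) :=
  Measurable.copy (path_space d T)
    (g_sigma_algebraType (@open (path_space d T))).

Section g_expectation.
Context {R : realType} {d : nat} {T : R}.

Local Notation Omega := (path_space d T).
Local Notation vec := 'rV[R]_d.

Definition Bproc (t : R) (w : Omega) : vec := (val w : R -> vec) t.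

Definition upE (PP : set (probability Omega R)) (X : Omega -> \bar R) : \bar R :=
  ereal_sup [set (\int[P]_w X w)%E | P in PP].

Definition capacity (PP : set (probability Omega R)) (A : set Omega) : \bar R :=
  ereal_sup [set P A | P in PP].

Definition quasi_surely (PP : set (probability Omega R)) (Q : set Omega) : Prop :=
  exists A : set Omega,
    [/\ measurable A, capacity PP A = 0%E & forall w, ~ A w -> Q w].

Definition bounded_continuous : Type :=
  {phi : Omega -> R | continuous phi /\ exists C, forall w, `|phi w| <= C}.

Definition weak_eval (P : probability Omega R) :
    {ptws bounded_continuous -> R} :=
  fun phi => (\int[P]_w (sval phi w))%R.

Definition weakly_compact (PP : set (probability Omega R)) : Prop :=
  @compact (initial_topology weak_eval) PP.

Definition psd (A : 'M[R]_d) : Prop :=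
  forall v : vec, 0 <= (v *m A *m v^T) 0 0.

Definition monotone_sublinear (G : 'M[R]_d -> R) : Prop :=
  [/\ forall A A', A^T = A -> A'^T = A' -> G (A + A') <= G A + G A',
      forall A (l : R), A^T = A -> 0 <= l -> G (l *: A) = l * G A
    & forall A A', A^T = A -> A'^T = A' -> psd (A - A') -> G A' <= G A].

Definition evec (i : 'I_d) : vec := delta_mx 0 i.

Definition dt (psi : R -> vec -> R) (t : R) (x : vec) : R :=
  'D_1 (fun s => psi s x) t.

Definition dx (psi : R -> vec -> R) (i : 'I_d) (t : R) (x : vec) : R :=
  'D_(evec i) (psi t) x.

Definition hess (psi : R -> vec -> R) (t : R) (x : vec) : 'M[R]_d :=
  \matrix_(i, j) dx (dx psi j) i t x.

Definition C12 (psi : R -> vec -> R) : Prop :=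
  forall (t : R) (x : vec), 0 < t ->
  [/\ derivable (fun s => psi s x) t 1,
      forall i, derivable (psi t) x (evec i),
      forall i j, derivable (dx psi j t) x (evec i) &
      [/\ {for (t, x), continuous (fun z : R * vec => psi z.1 z.2)},
          {for (t, x), continuous (fun z : R * vec => dt psi z.1 z.2)},
          forall i, {for (t, x), continuous (fun z : R * vec => dx psi i z.1 z.2)}
        & {for (t, x), continuous (fun z : R * vec => hess psi z.1 z.2)}]].

Definition viscosity_subsolution (G : 'M[R]_d -> R) (u : R -> vec -> R) : Prop :=
  forall psi : R -> vec -> R, C12 psi -> forall (t : R) (x : vec), 0 < t ->
    psi t x = u t x -> (forall s y, 0 < s -> u s y <= psi s y) ->
    dt psi t x <= G (hess psi t x).

Definition viscosity_supersolution (G : 'M[R]_d -> R) (u : R -> vec -> R) : Prop :=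
  forall psi : R -> vec -> R, C12 psi -> forall (t : R) (x : vec), 0 < t ->
    psi t x = u t x -> (forall s y, 0 < s -> psi s y <= u s y) ->
    G (hess psi t x) <= dt psi t x.

(* Boundedness selects the unique solution for a bounded initial datum. *)
Definition viscosity_solution (G : 'M[R]_d -> R) (phi : vec -> R)
    (u : R -> vec -> R) : Prop :=
  [/\ {within [set z : R * vec | 0 <= z.1],
        continuous (fun z : R * vec => u z.1 z.2)},
      exists C, forall (t : R) (x : vec), 0 <= t -> `|u t x| <= C,
      u 0 = phi, viscosity_subsolution G u & viscosity_supersolution G u].

Definition Cb_Lip k (phi : 'M[R]_(k, d) -> R) : Prop :=
  (exists C, forall x, `|phi x| <= C) /\
  (exists C, forall x y, `|phi x - phi y| <= C * `|x - y|).

Definition Lip (t : R) (X : Omega -> R) : Prop :=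
  exists (k : nat) (ts : 'I_k -> R) (phi : 'M[R]_(k, d) -> R),
    [/\ forall i, 0 <= ts i <= t, Cb_Lip phi
      & forall w, X w = phi (\matrix_(i, c) Bproc (ts i) w 0 c)].

(* Rows B_{tau (a+i+1)} - B_{tau (a+i)} for i < k. *)
Definition increments (tau : nat -> R) (a k : nat) (w : Omega) : 'M[R]_(k, d) :=
  \matrix_(i, c) (Bproc (tau (a + i).+1) w - Bproc (tau (a + i)%N) w) 0 c.

(* Y = \hat E_t[X] for a cylinder function X of the increments of B along
   0 = tau 0 <= .. <= tau (j + m) <= T, where t = tau j. *)
Definition cond_exp_Lip (PP : set (probability Omega R)) (t : R)
    (X Y : Omega -> R) : Prop :=
  exists (j m : nat) (tau : nat -> R) (phi : 'M[R]_(j + m, d) -> R),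
    [/\ [/\ tau 0%N = 0, forall i, (i < j + m)%N -> tau i <= tau i.+1,
            tau (j + m)%N <= T & tau j = t],
        Cb_Lip phi,
        forall w, X w = phi (col_mx (increments tau 0%N j w) (increments tau j m w))
      & forall w, (Y w)%:E = upE PP (fun w' =>
          (phi (col_mx (increments tau 0%N j w) (increments tau j m w')))%:E)].

(* upE PP, restricted to the cylinder functions, is the G-expectation. *)
Definition represents_G_expectation (G : 'M[R]_d -> R)
    (PP : set (probability Omega R)) : Prop :=
  (forall phi : vec -> R, Cb_Lip phi ->
     exists2 u : R -> vec -> R, viscosity_solution G phi u &
       forall t s : R, 0 <= t -> 0 <= s -> t + s <= T ->
         upE PP (fun w => (phi (Bproc (t + s) w - Bproc t w))%:E) = (u s 0)%:E) /\
  (forall t X Y, cond_exp_Lip PP t X Y ->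
     upE PP (EFin \o Y) = upE PP (EFin \o X)).

Definition Lp_cvg (PP : set (probability Omega R)) (p : nat)
    (Xn : nat -> Omega -> R) (X : Omega -> R) : Prop :=
  upE PP (fun w => (`|Xn n w - X w| ^+ p)%:E) @[n --> \oo] --> 0%E.

(* The completion of Lip t, realized by Borel functions up to q.s. equality. *)
Definition LG (PP : set (probability Omega R)) (p : nat) (t : R)
    (X : Omega -> R) : Prop :=
  measurable_fun setT X /\
  exists2 Xn : nat -> Omega -> R, (forall n, Lip t (Xn n)) & Lp_cvg PP p Xn X.

(* Y = \hat E_t[X], the continuous extension to L_G^1(Omega_T). *)
Definition cond_exp (PP : set (probability Omega R)) (t : R)
    (X Y : Omega -> R) : Prop :=
  [/\ LG PP 1 T X, LG PP 1 t Y &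
      exists Xn Yn : nat -> Omega -> R,
        [/\ forall n, cond_exp_Lip PP t (Xn n) (Yn n),
            Lp_cvg PP 1 Xn X & Lp_cvg PP 1 Yn Y]].

Definition G_martingale (PP : set (probability Omega R))
    (M : R -> Omega -> R) : Prop :=
  (forall t : R, 0 <= t <= T -> LG PP 1 t (M t)) /\
  (forall s t : R, 0 <= s -> s <= t -> t <= T -> cond_exp PP s (M t) (M s)).

Definition continuous_paths (X : R -> Omega -> R) : Prop :=
  forall w, {within `[0, T], continuous (fun t => X t w)}.

Definition symmetric_G_martingale (PP : set (probability Omega R))
    (M : R -> Omega -> R) : Prop :=
  [/\ G_martingale PP M, G_martingale PP (fun t w => - M t w)
    & continuous_paths M].

Definition cond_variance_bound (PP : set (probability Omega R))
    (M : R -> Omega -> R) (Lambda : R) : Prop :=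
  forall t s : R, 0 <= t -> 0 <= s -> t + s <= T ->
    exists2 Y, cond_exp PP t (fun w => `|M (t + s) w - M t w| ^+ 2) Y
             & quasi_surely PP [set w | Y w <= Lambda * s].

(* The paths of Q are bundled as cumulative functions so that they induce
   Lebesgue-Stieltjes measures; only their restriction to [0,T] matters. *)
Definition quadratic_variation (PP : set (probability Omega R))
    (M : R -> Omega -> R) (Q : Omega -> cumulative R R) : Prop :=
  [/\ forall w, Q w 0 = 0,
      forall w, {within `[0, T], continuous (Q w : R -> R)},
      forall t : R, 0 <= t <= T -> measurable_fun setT (fun w => Q w t)
    & forall t : R, 0 <= t <= T -> forall e : R, 0 < e ->
        exists2 delta : R, 0 < delta &
        forall (N : nat) (tau : nat -> R),
          tau 0%N = 0 -> tau N = t ->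
          (forall j, (j < N)%N -> 0 <= tau j.+1 - tau j < delta) ->
          (upE PP (fun w =>
             (`|\sum_(j < N) (M (tau j.+1) w - M (tau j) w) ^+ 2 - Q w t|)%:E)
           < e%:E)%E].

Record step_integrand (PP : set (probability Omega R)) (p : nat) := StepIntegrand {
  step_size : nat ;
  step_time : nat -> R ;
  step_coef : nat -> Omega -> R ;
  step_time0 : 0 <= step_time 0%N ;
  step_time_le : forall j, (j < step_size)%N -> step_time j <= step_time j.+1 ;
  step_timeN : step_time step_size <= T ;
  step_coefP : forall j, (j < step_size)%N ->
    LG PP p (step_time j) (step_coef j) }.

Definition step_process PP p (eta : step_integrand PP p) (t : R) (w : Omega) : R :=
  \sum_(j < step_size eta)
    step_coef eta j w * \1_(`[step_time eta j, step_time eta j.+1[) t.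

Definition step_integral PP p (M : R -> Omega -> R)
    (eta : step_integrand PP p) (t : R) (w : Omega) : R :=
  \sum_(j < step_size eta) step_coef eta j w *
    (M (Num.min (step_time eta j.+1) t) w - M (Num.min (step_time eta j) t) w).

(* \hat E[\int_0^T |eta_t|^p d<M>_t], the p-th power of the norm; the paths of
   <M> are continuous, so excluding the endpoint 0 is immaterial. *)
Definition Mbar_norm_pow (PP : set (probability Omega R)) (p : nat)
    (Q : Omega -> cumulative R R) (eta : R -> Omega -> R) : \bar R :=
  upE PP (fun w =>
    (\int[lebesgue_stieltjes_measure (Q w)]_(t in (`]0%R, T] : set R))
        (`|eta t w| ^+ p)%:E)%E).

Definition measurable_process (eta : R -> Omega -> R) : Prop :=
  measurable_fun (`[0, T] `*` setT)
    (fun z : measurableTypeR R * Omega => eta z.1 z.2).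

Definition Mbar_cvg PP p (Q : Omega -> cumulative R R)
    (etan : nat -> step_integrand PP p) (eta : R -> Omega -> R) : Prop :=
  Mbar_norm_pow PP p Q (fun t w => step_process (etan n) t w - eta t w)
    @[n --> \oo] --> 0%E.

(* eta belongs to \bar M_G^2(0,T) and I is a continuous modification of
   t |-> \int_0^t eta dM. *)
Definition stochastic_integral (PP : set (probability Omega R))
    (M : R -> Omega -> R) (Q : Omega -> cumulative R R)
    (eta I : R -> Omega -> R) : Prop :=
  [/\ measurable_process eta,
      exists2 etan : nat -> step_integrand PP 2, Mbar_cvg Q etan eta &
        forall t : R, 0 <= t <= T ->
          Lp_cvg PP 2 (fun n => step_integral M (etan n) t) (I t),
      forall t : R, 0 <= t <= T -> measurable_fun setT (I t)
    & continuous_paths I].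

Definition sgn_left (x : R) : R := if 0 < x then 1 else -1.

Definition local_time (PP : set (probability Omega R))
    (M : R -> Omega -> R) (Q : Omega -> cumulative R R)
    (L : R -> R -> Omega -> R) : Prop :=
  [/\ forall w, {within `[0, T] `*` setT,
                  continuous (fun z : R * R => L z.1 z.2 w)},
      forall t a : R, 0 <= t <= T -> measurable_fun setT (L t a)
    & forall a, exists2 J : R -> Omega -> R,
        stochastic_integral PP M Q (fun s w => sgn_left (M s w - a)) J &
        forall t : R, 0 <= t <= T ->
          quasi_surely PP
            [set w | L t a w = `|M t w - a| - `|M 0 w - a| - J t w]].

End g_expectation.

Definition left_derivative (R : realType) (f : R -> R) (x : R) : R :=
  lim (h^-1 * (f (x + h) - f x) @[h --> 0^'-]).

(* Convention for a left-continuous g. *)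
Definition is_stieltjes_measure (R : realType) (g : R -> R)
    (mu : {measure set (measurableTypeR R) -> \bar R}) : Prop :=
  forall a b : R, a <= b -> mu `[a, b[%classic = (g b - g a)%:E.

(* Main.v *)
(* Under each P in PP the process M is a continuous martingale with
   E[xi (M_t - M_s)^2] = E[xi (Q_t - Q_s)] <= Lambda (t - s) E[xi] for xi >= 0
   known at time s. Hence the Ito isometry: integrals of elementary processes
   are controlled by the norm E int eta^2 dQ, for every P separately.

   Write g = f'_-. On [-N, N], g is a limit of the step functions
   alpha + 1/2 sum_i c_i sgn(x - a_i), where c_i are the increments of g and
   alpha = (g(N) + g(-N)) / 2. The definition of the local time gives the
   integral of each sgn(M - a_i), and the sums converge to
   alpha (M_t - M_0) + 1/2 int (|M_t - a| - |M_0 - a| - L_t(a)) dg(a). For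
   convex f this is f(M_t) - f(M_0) - 1/2 int L_t(a) dg(a): both
   f(y) - f(x) and alpha (y - x) + 1/2 int (|y - a| - |x - a|) dg(a) lie between
   g(x) (y - x) and g(y) (y - x), and both are additive.

   The error between g(M) and its approximations is bounded uniformly in P. The
   occupation of a window satisfies E int 1_{|M - c| <= r/2} dQ <= 4 r E|M_T - M_0|,
   the truncation error is governed by E (|M_T| - K)_+^2, which tends to 0
   uniformly because M_T is in L_G^2, and freezing a Lipschitz function of M on a
   grid costs O(mesh). Replacing the steps by ramps gives the approximating
   integrands with coefficients in L_G^2. Finally L_t(a) = 0 q.s. for |a| larger
   than sup |M|, because integrals of processes that vanish on a set of paths
   vanish there. *)

Require Import Defs.
From mathcomp Require Import all_boot all_order all_algebra.
From mathcomp Require Import all_classical all_reals all_analysis.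
From mathcomp Require Import measurable_realfun ring lra.

Set Implicit Arguments.
Unset Strict Implicit.
Unset Printing Implicit Defensive.

Import Order.TTheory GRing.Theory Num.Theory.
Import numFieldNormedType.Exports.

Local Open Scope classical_set_scope.
Local Open Scope ring_scope.

(** * Convex functions, truncations and step approximations *)

(** The probabilities in [PP] may be mutually singular, so a limit taken almost surely under one of
    them cannot serve as the integral. The candidate [tanaka_integral] is instead given path by path
    as f(M_t) - f(M_0) - 1/2 int L_t(a) dg(a), outside one exceptional set [bad_set] whose
    definition mentions no probability. Each P only has to certify that this candidate is an L2
    limit of elementary integrals ([is_int]); the error bounds being common to all P, one sequence
    of integrands works for the whole family. The obstacle is that g may jump while nothing bounds
    <M> from below: M_s may have no density, and g(M) cannot be approximated by freezing alone. The
    substitute for a density is that a window of width r carries expected d<M>-mass of order r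
    ([EQ_level_set]), whatever its position. Ramps are needed besides steps because Lipschitz
    functions preserve L_G^2, while indicators need not. *)

Section convex_real_function.
Context (R : realType) (f : R -> R).
Hypothesis hf : convex_function (E := R^o) setT f.

Lemma convex_ineq (x y t : R) : 0 <= t <= 1 ->
  f (t * x + (1 - t) * y) <= t * f x + (1 - t) * f y.
Proof.
move=> t01.
have [t0 t1] := andP t01.
have := @hf (Itv01 t0 t1) x y; rewrite !inE => /(_ I I).
exact.
Qed.

(** One inequality without denominators serves both uses below: monotonicity of the left quotients
    and their comparison with a right chord. *)
Lemma convex_slope (x y z : R) : x < y -> y < z ->
  (f y - f x) * (z - x) <= (f z - f x) * (y - x).
Proof.
move=> xy yz; have xz := lt_trans xy yz.
have zx : 0 < z - x by rewrite subr_gt0.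
pose t := (z - y) / (z - x).
have tE : t * (z - x) = z - y by rewrite /t divfK// gt_eqF.
have t01 : 0 <= t <= 1.
  apply/andP; split; first by rewrite /t divr_ge0// subr_ge0 ltW.
  by rewrite /t ler_pdivrMr// mul1r lerB// ltW.
have yE : y = t * x + (1 - t) * z.
  have : t * x + (1 - t) * z = z - t * (z - x) by ring.
  by rewrite tE => ->; ring.
have := convex_ineq x z t01; rewrite -yE => h.
have : (z - x) * f y <= (z - x) * (t * f x + (1 - t) * f z) by rewrite ler_pM2l.
have -> : (z - x) * (t * f x + (1 - t) * f z) =
    t * (z - x) * f x + (z - x) * f z - t * (z - x) * f z by ring.
rewrite tE; nra.
Qed.

Let q (x h : R) := h^-1 * (f (x + h) - f x).

Let q_nd x h h' : h < h' -> h' < 0 -> q x h <= q x h'.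
Proof.
move=> hh' h'0; have h0 := lt_trans hh' h'0.
have := @convex_slope (x + h) (x + h') x.
rewrite ltrD2l gtrDl => /(_ hh' h'0) => H.
rewrite /q -subr_ge0.
have -> : h'^-1 * (f (x + h') - f x) - h^-1 * (f (x + h) - f x) =
  (h * h')^-1 * (h * (f (x + h') - f x) - h' * (f (x + h) - f x)).
  field.
  by rewrite !lt_eqF.
rewrite mulr_ge0// ?invr_ge0.
  by rewrite mulr_le0 ?ltW.
move: H; nra.
Qed.

Let q_ub x h z : h < 0 -> 0 < z -> q x h <= (f (x + z) - f x) / z.
Proof.
move=> h0 z0.
have := @convex_slope (x + h) x (x + z).
rewrite gtrDl ltrDl => /(_ h0 z0) => H.
rewrite /q -subr_ge0.
have -> : (f (x + z) - f x) / z - h^-1 * (f (x + h) - f x) =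
  ((- h) * z)^-1 * ((- h) * (f (x + z) - f x) + z * (f (x + h) - f x)).
  field.
  by rewrite gt_eqF// lt_eqF.
rewrite mulr_ge0// ?invr_ge0.
  by rewrite mulr_ge0// ltW// oppr_gt0.
move: H; nra.
Qed.

(** The quotients are monotone in h and bounded by a right chord. Without convergence the [lim] in
    [left_derivative] could be a default value. *)
Let q_cvg x : cvg (q x h @[h --> 0^'-]).
Proof.
apply: (@nondecreasing_at_left_is_cvgr _ (q x) 0) => //.
- near=> a => h h'; rewrite !in_itv/= => /andP[_ h0] /andP[_ h'0].
  by rewrite le_eqVlt => /predU1P[->//|hh']; exact: q_nd.
- near=> a; exists ((f (x + 1) - f x) / 1) => y [h /=].
  by rewrite in_itv/= => /andP[_ h0] <-; apply: q_ub.
Unshelve. all: end_near. Qed.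

(** This inequality carries the convexity of f from here on: the later parts take any nondecreasing
    g of linear growth that satisfies it and has a Stieltjes measure. *)
Lemma left_derivative_subgradient x y :
  left_derivative f x * (y - x) <= f y - f x.
Proof.
have [xy|yx|<-] := ltgtP x y; last by rewrite !subrr mulr0.
- have : left_derivative f x <= (f (x + (y - x)) - f x) / (y - x).
    apply: limr_le; first exact: q_cvg.
    near=> h; apply: q_ub; last by rewrite subr_gt0.
    by near: h; exact: nbhs_left_lt.
  by rewrite ler_pdivlMr ?subr_gt0// [x + _]addrC subrK.
- have : q x (y - x) <= left_derivative f x.
    apply: limr_ge; first exact: q_cvg.
    near=> h; apply: q_nd.
      by near: h; apply: nbhs_left_gt; rewrite subr_lt0.
    by near: h; exact: nbhs_left_lt.
  rewrite /q [x + _]addrC subrK => h.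
  have := ler_wnM2r (_ : y - x <= 0) h; rewrite subr_le0 ltW// => /(_ isT).
  by rewrite mulrAC mulVf ?mul1r// subr_eq0 lt_eqF.
Unshelve. all: end_near. Qed.

Lemma left_derivative_nondecreasing x y : x <= y ->
  left_derivative f x <= left_derivative f y.
Proof.
rewrite le_eqVlt => /predU1P[->//|xy].
have := left_derivative_subgradient x y.
have := left_derivative_subgradient y x.
move: (left_derivative f x) (left_derivative f y) => a b; nra.
Qed.

End convex_real_function.

Section real_functions.
Context (R : realType).
Implicit Types (x y K r : R).

Definition clamp K x : R := Num.max (- K) (Num.min K x).

Lemma clamp_le K x : 0 <= K -> `|clamp K x| <= K.
Proof.
move=> K0; rewrite ler_norml /clamp le_max lexx/= ge_max ge_min lexx/= andbT.
by rewrite ge0_cp.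
Qed.

Lemma clamp_id K x : `|x| <= K -> clamp K x = x.
Proof.
by rewrite ler_norml /clamp => /andP[Kx xK]; rewrite (min_idPr xK) (max_idPr Kx).
Qed.

Lemma clamp_norm K x : 0 <= K -> `|clamp K x| <= `|x|.
Proof.
move=> K0; rewrite /clamp; case: (leP K x) => [h|h].
  rewrite max_r; last lra.
  by rewrite !ger0_norm//; lra.
by case: (leP (- K) x) => // h'; rewrite normrN (ger0_norm K0) ler0_norm; lra.
Qed.

Lemma max_lip (c x y : R) : `|Num.max c x - Num.max c y| <= `|x - y|.
Proof.
by case: (leP c x); case: (leP c y) => h1 h2 //; rewrite !ler_norml;
  have := ler_norm (x - y); have := ler_norm (y - x);
  rewrite (distrC y x) => *; apply/andP; split; lra.
Qed.

Lemma min_lip (c x y : R) : `|Num.min c x - Num.min c y| <= `|x - y|.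
Proof.
by case: (leP c x); case: (leP c y) => h1 h2 //; rewrite !ler_norml;
  have := ler_norm (x - y); have := ler_norm (y - x);
  rewrite (distrC y x) => *; apply/andP; split; lra.
Qed.

Lemma clamp_lip K x y : `|clamp K x - clamp K y| <= `|x - y|.
Proof. exact: le_trans (max_lip _ _ _) (min_lip _ _ _). Qed.

Lemma clamp_nd K x y : x <= y -> clamp K x <= clamp K y.
Proof.
move=> xy; rewrite /clamp le_max2 // le_min2 //.
Qed.

(** Soft thresholding: for K >= 0, the signed distance to [-K, K]. *)
Definition excess K x : R := x - clamp K x.

Lemma excess_lip K x y : `|excess K x - excess K y| <= 2 * `|x - y|.
Proof.
rewrite /excess (_ : _ - _ - _ = (x - y) - (clamp K x - clamp K y)); last ring.
rewrite (le_trans (ler_normB _ _))// mulr_natl mulr2n lerD2l.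
exact: clamp_lip.
Qed.

Lemma excess_dist K x y : `|y| <= K -> `|excess K x| <= `|x - y|.
Proof.
rewrite ler_norml => /andP[h1 h2]; rewrite /excess /clamp.
case: (leP K x) => [h|h].
  by rewrite max_r; last lra; rewrite !ger0_norm; lra.
case: (leP (- K) x) => h'; first by rewrite subrr normr0.
by rewrite !ler0_norm; lra.
Qed.

Lemma excess_convex K x y : 0 <= K ->
  excess K x ^+ 2 + 2 * excess K x * (y - x) <= excess K y ^+ 2.
Proof.
move=> K0; rewrite /excess /clamp.
case: (leP K x) => h; case: (leP K y) => h'.
- by rewrite !max_r; try lra; have := sqr_ge0 (y - x); nra.
- rewrite (@max_r _ _ _ K); last lra.
  by case: (leP (- K) y) => h''; nra.
- rewrite (@max_r _ _ _ K); last lra.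
  by case: (leP (- K) x) => h''; nra.
- have := sqr_ge0 (y - x).
  by case: (leP (- K) x) => ?; case: (leP (- K) y) => ?; nra.
Qed.

(** Variational inequality of the projection onto the convex set [-K, K]: the residue at y points
    away from every c of the interval. *)
Lemma clamp_excess_ge0 K c y : `|c| <= K -> 0 <= (clamp K y - c) * excess K y.
Proof.
rewrite ler_norml /excess /clamp => /andP[h1 h2].
case: (leP K y) => h; first by rewrite max_r; [nra|lra].
by case: (leP (- K) y) => h'; nra.
Qed.

(** The Huber function: x^2/2 on [-r, r], continued by its tangent lines, with derivative [clamp r].
    It is a convex C^1 substitute for r|x| whose second-order remainder detects the increments made
    near 0. *)
Definition huber r x : R := (x ^+ 2 - excess r x ^+ 2) / 2.

Lemma huber_tangent r x y : 0 <= r ->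
  huber r x + clamp r x * (y - x) <= huber r y.
Proof.
move=> r0; have := clamp_excess_ge0 y (clamp_le x r0).
rewrite /huber /excess; move: (clamp r x) (clamp r y) => a b; have := sqr_ge0 (b - a); nra.
Qed.

Lemma huber_lip r x y : 0 <= r -> huber r y - huber r x <= r * `|y - x|.
Proof.
move=> r0; have := huber_tangent y x r0; rewrite -opprB mulrN => h.
have : clamp r y * (y - x) <= `|clamp r y| * `|y - x| by rewrite -normrM ler_norm.
have : `|clamp r y| * `|y - x| <= r * `|y - x| by rewrite ler_wpM2r// clamp_le.
lra.
Qed.

(** The threshold 2r leaves room for a start within r of 0 and a step of size r: both endpoints lie
    in the quadratic zone. *)
Lemma huber_quadratic r x y : 0 <= r -> `|x| <= r -> `|y - x| <= r ->
  huber (2 * r) y - huber (2 * r) x - clamp (2 * r) x * (y - x) =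
  (y - x) ^+ 2 / 2.
Proof.
move=> r0 xr yxr.
have yr : `|y| <= 2 * r.
  rewrite -(subrK x y) (le_trans (ler_normD _ _))//; lra.
by rewrite /huber /excess !clamp_id//; [field|lra].
Qed.

End real_functions.

Section step_approximation.
Context (R : realType).
Implicit Types (x a b r : R).

Definition ramp a r x : R := Num.max 0 (Num.min 1 ((x - a) / r)).

Lemma ramp_itv a r x : 0 <= ramp a r x <= 1.
Proof.
by rewrite /ramp le_max lexx/= ge_max ler01 ge_min lexx.
Qed.

Lemma ramp0 a r x : 0 < r -> x <= a -> ramp a r x = 0.
Proof.
move=> r0 xa; rewrite /ramp max_l// ge_min; apply/orP; right.
by rewrite pmulr_lle0 ?invr_gt0// subr_le0.
Qed.

Lemma ramp1 a r x : 0 < r -> a + r <= x -> ramp a r x = 1.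
Proof.
move=> r0 xa; rewrite /ramp min_l ?max_r//.
by rewrite ler_pdivlMr// mul1r; lra.
Qed.

Lemma ramp_lip a r x y : 0 < r -> `|ramp a r x - ramp a r y| <= r^-1 * `|x - y|.
Proof.
move=> r0; rewrite (le_trans (max_lip _ _ _))// (le_trans (min_lip _ _ _))//.
rewrite -mulrBl (_ : x - a - _ = x - y); last ring.
by rewrite normrM mulrC gtr0_norm ?invr_gt0.
Qed.

Variables (g : R -> R) (N : R) (m : nat).
Hypothesis (g_nd : forall x y, x <= y -> g x <= g y) (N0 : 0 < N) (m0 : (0 < m)%N).

Definition mesh : R := 2 * N / m%:R.
Definition node (i : nat) : R := - N + i%:R * mesh.
Definition jump (i : nat) : R := g (node i.+1) - g (node i).

Lemma mesh_gt0 : 0 < mesh.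
Proof. by rewrite /mesh divr_gt0 ?ltr0n// mulr_gt0. Qed.

Lemma node0 : node 0 = - N. Proof. by rewrite /node mul0r addr0. Qed.

Lemma nodem : node m = N.
Proof.
rewrite /node /mesh; field.
by rewrite pnatr_eq0 -lt0n.
Qed.

Lemma nodeS i : node i.+1 = node i + mesh.
Proof. by rewrite /node -natr1; ring. Qed.

Lemma node_nd i j : (i <= j)%N -> node i <= node j.
Proof. by move=> ij; rewrite /node lerD2l ler_wpM2r ?ler_nat// ltW// mesh_gt0. Qed.

Lemma jump_ge0 i : 0 <= jump i.
Proof. by rewrite /jump subr_ge0 g_nd// node_nd. Qed.

Lemma sum_jump : \sum_(i < m) jump i = g N - g (- N).
Proof.
by rewrite -(big_mkord xpredT) /jump telescope_sumr// nodem node0.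
Qed.

(** A closed cell written as a ball around its midpoint, the form of window that [EQ_level_set]
    estimates with [r := mesh]. Neighbouring cells share a node. *)
Definition in_cell i x : R := (`|x - (node i + mesh / 2)| <= mesh / 2)%R%:R.

Lemma in_cellE i x : in_cell i x = (node i <= x <= node i.+1)%R%:R.
Proof.
rewrite /in_cell ler_distl nodeS; congr (_%:R); congr nat_of_bool.
by congr (_ && _); apply/idP/idP => h; lra.
Qed.

(** The strict inequality agrees with [sgn_left], whose value at 0 is -1. *)
Definition step_fun x : R :=
  g (- N) + \sum_(i < m) jump i * (node i < x)%R%:R.

Definition ramp_fun x : R :=
  g (- N) + \sum_(i < m) jump i * ramp (node i) mesh x.

(** One majorant for two replacements, of g by steps and of steps by ramps: the functions differ
    only in the cell of x, by at most the jump of g over that cell. *)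
Definition cell_weight x : R := \sum_(i < m) jump i * in_cell i x.

Lemma cell_weight_ge0 x : 0 <= cell_weight x.
Proof. by apply: sumr_ge0 => i _; rewrite mulr_ge0 ?jump_ge0// /in_cell ler0n. Qed.

Lemma cell_weight_le x : cell_weight x <= g N - g (- N).
Proof.
rewrite -sum_jump; apply: ler_sum => i _.
apply: ler_piMr; first exact: jump_ge0.
have : forall b : bool, (b%:R : R) <= 1 by case; rewrite /= ?ler01.
exact.
Qed.

Lemma step_fun_clamp x : `|step_fun x - g (clamp N x)| <= cell_weight x.
Proof.
(* g along the nodes cut off at x. The increments telescope to [g (clamp N x) - g (- N)]; the i-th
   one is the full jump once x has passed node i+1, is 0 as long as x is below node i, and is
   partial only in the cell of x. *)
pose u i := g (Num.max (- N) (Num.min (node i) x)).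
have -> : g (clamp N x) = g (- N) + \sum_(i < m) (u i.+1 - u i).
  rewrite -(big_mkord xpredT (fun i => u i.+1 - u i)) telescope_sumr//.
  rewrite /u nodem node0 (@max_l _ _ (- N) (Num.min (- N) x)); last by rewrite ge_min lexx.
  by rewrite addrC subrK.
rewrite /step_fun opprD addrACA subrr add0r -sumrB (le_trans (ler_norm_sum _ _ _))//.
apply: ler_sum => i _; rewrite in_cellE /u /jump.
have Ni : - N <= node i by rewrite -node0 node_nd.
have iS : node i <= node i.+1 by exact: node_nd.
have [xi|ix] := leP x (node i).
  rewrite (min_r (le_trans xi iS)) mulr0 subrr subr0 normr0.
  by rewrite mulr_ge0// ?ler0n// jump_ge0.
rewrite (max_r Ni) (ltW ix) mulr1.
have [iSx|xiS] := leP (node i.+1) x.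
  rewrite (max_r (le_trans Ni iS)) subrr normr0 mulr_ge0// ?ler0n//.
  exact: jump_ge0.
rewrite (max_r (le_trans Ni (ltW ix))).
have h1 := g_nd (ltW ix); have h2 := g_nd (ltW xiS).
rewrite (ltW xiS) mulr1 ger0_norm; lra.
Qed.

Lemma ramp_fun_step x : `|ramp_fun x - step_fun x| <= cell_weight x.
Proof.
rewrite /step_fun /ramp_fun opprD addrACA subrr add0r -sumrB.
rewrite (le_trans (ler_norm_sum _ _ _))//.
apply: ler_sum => i _; rewrite -mulrBr normrM ger0_norm ?jump_ge0//.
rewrite ler_wpM2l ?jump_ge0// in_cellE nodeS.
have /andP[r0 r1] := ramp_itv (node i) mesh x.
have [xi|ix] := leP x (node i).
  by rewrite ramp0 ?mesh_gt0// subr0 normr0 ler0n.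
rewrite (ltW ix) /=; have [iSx|xiS] := leP x (node i + mesh).
  by rewrite /= ler_norml; apply/andP; split; lra.
by rewrite (ramp1 mesh_gt0 (ltW xiS)) subrr normr0.
Qed.

Lemma ramp_fun_lip x y :
  `|ramp_fun x - ramp_fun y| <= (g N - g (- N)) * mesh^-1 * `|x - y|.
Proof.
rewrite /ramp_fun opprD addrACA subrr add0r -sumrB -sum_jump !mulr_suml.
rewrite (le_trans (ler_norm_sum _ _ _))//; apply: ler_sum => i _.
rewrite -mulrBr normrM ger0_norm ?jump_ge0// -mulrA ler_wpM2l ?jump_ge0//.
exact: ramp_lip mesh_gt0.
Qed.

End step_approximation.

Section linear_growth.
Context (R : realType) (g : R -> R) (C : R).
Hypothesis (g_growth : forall x, `|g x| <= C * (1 + `|x|)).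

Lemma growth_ge0 : 0 <= C.
Proof. by have := g_growth 0; rewrite normr0 addr0 mulr1; exact: le_trans. Qed.

(** Cutting at 2K and measuring the excess over K makes the two comparable: if |x| > 2K and K >= 1,
    then 1 + |x| <= 3 (|x| - K). This is used for each of the two values of g, whence the factor
    6. *)
Lemma clamp_growth K x : 1 <= K ->
  `|g (clamp (2 * K) x) - g x| <= 6 * C * `|excess K x|.
Proof.
move=> K1; have C0 := growth_ge0.
have [xK|Kx] := leP `|x| (2 * K).
  by rewrite clamp_id// subrr normr0 !mulr_ge0.
rewrite (le_trans (ler_normB _ _))//.
have h1 := g_growth (clamp (2 * K) x); have h2 := g_growth x.
have h3 : `|clamp (2 * K) x| <= `|x| by apply: clamp_norm; lra.
have h4 : `|x| - K <= `|excess K x|.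
  rewrite lerBlDr -{1}(subrK (clamp K x) x) (le_trans (ler_normD _ _))//.
  by rewrite lerD2l clamp_le//; lra.
have : C * `|clamp (2 * K) x| <= C * `|x| by rewrite ler_wpM2l.
have : C * (1 + `|x|) <= C * (3 * (`|x| - K)) by rewrite ler_wpM2l//; lra.
have : C * (`|x| - K) <= C * `|excess K x| by rewrite ler_wpM2l.
lra.
Qed.

End linear_growth.

(** * Integration *)

Section integration.
Context d (X : measurableType d) (R : realType).
Context (mu : {measure set X -> \bar R}).
Implicit Types (D : set X) (f g h : X -> R).

Lemma limn_einf_le (u : nat -> \bar R) (c : R) :
  (forall e, 0 < e -> exists n0, forall n, (n0 <= n)%N -> (u n <= (c + e)%:E)%E) ->
  (limn_einf u <= c%:E)%E.
Proof.
move=> H; apply/lee_addgt0Pr => e e0; rewrite -EFinD.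
have [n0 Hn0] := H _ e0.
rewrite limn_einf_lim; apply: lime_le; first exact: is_cvg_einfs.
near=> n; apply: le_trans (Hn0 (maxn n n0) (leq_maxr _ _)).
by apply: ereal_inf_lbound; exists (maxn n n0) => //=; rewrite leq_maxl.
Unshelve. all: end_near. Qed.

Lemma limn_einf_EFin (u : nat -> R) (l : R) : u n @[n --> \oo] --> l ->
  limn_einf (fun n => (u n)%:E) = l%:E.
Proof.
move=> ul; have h : (fun n => (u n)%:E) @ \oo --> l%:E.
  by apply/cvg_EFin; [near=> n|].
by rewrite is_cvg_limn_einfE; [exact/cvg_lim|apply/cvg_ex; exists l%:E].
Unshelve. all: end_near. Qed.

Lemma fatou_le D (f_ : nat -> X -> R) f (c : R) :
  measurable D -> (forall n, measurable_fun D (f_ n)) ->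
  (forall n x, D x -> 0 <= f_ n x) ->
  (forall x, D x -> f_ n x @[n --> \oo] --> f x) ->
  (forall e, 0 < e -> exists n0, forall n, (n0 <= n)%N ->
     (\int[mu]_(x in D) (f_ n x)%:E <= (c + e)%:E)%E) ->
  (\int[mu]_(x in D) (f x)%:E <= c%:E)%E.
Proof.
move=> mD mf f0 ff H.
have -> : (\int[mu]_(x in D) (f x)%:E = \int[mu]_(x in D) limn_einf (fun n => (f_ n x)%:E))%E.
  by apply: eq_integral => x; rewrite inE => Dx; rewrite (limn_einf_EFin (ff x Dx)).
apply: (@le_trans _ _ (limn_einf (fun n => \int[mu]_(x in D) (f_ n x)%:E))%E).
  by apply: fatou => // n; exact/measurable_EFinP.
exact: limn_einf_le.
Qed.

Lemma ge0_le_int D f g : measurable D -> measurable_fun D f -> measurable_fun D g ->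
  (forall x, D x -> 0 <= f x) -> (forall x, D x -> f x <= g x) ->
  (\int[mu]_(x in D) (f x)%:E <= \int[mu]_(x in D) (g x)%:E)%E.
Proof.
move=> mD mf mg f0 fg; apply: ge0_le_integral => //.
- exact/measurable_EFinP.
- exact/measurable_EFinP.
Qed.

End integration.

Section expectation.
Context d (X : measurableType d) (R : realType) (P : probability X R).
Implicit Types (f g h : X -> R).

Definition integ f : Prop := P.-integrable setT (EFin \o f).
Definition Ex f : R := (\int[P]_x f x)%R.

Lemma integ_measurable f : integ f -> measurable_fun setT f.
Proof. by move=> /measurable_int /measurable_EFinP. Qed.

Lemma integE f : integ f -> (\int[P]_x (f x)%:E)%E = (Ex f)%:E.
Proof. by move=> fi; rewrite /Ex /Rintegral fineK// integrable_fin_num. Qed.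

Lemma eq_integ f g : f =1 g -> integ f -> integ g.
Proof. by move=> /funext ->. Qed.

Lemma eq_Ex f g : f =1 g -> Ex f = Ex g.
Proof. by move=> /funext ->. Qed.

Lemma integD f g : integ f -> integ g -> integ (fun x => f x + g x).
Proof. by move=> fi gi; exact: (integrableD measurableT fi gi). Qed.

Lemma integB f g : integ f -> integ g -> integ (fun x => f x - g x).
Proof. by move=> fi gi; exact: (integrableB measurableT fi gi). Qed.

Lemma integZ (k : R) f : integ f -> integ (fun x => k * f x).
Proof. by move=> fi; exact: (integrableZl measurableT k fi). Qed.

Lemma integ_cst (k : R) : integ (fun=> k).
Proof. exact: finite_measure_integrable_cst. Qed.

Lemma integ_le f g : measurable_fun setT f -> (forall x, `|f x| <= `|g x|) ->
  integ g -> integ f.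
Proof.
move=> mf fg gi; apply: le_integrable gi => //; first exact/measurable_EFinP.
by move=> x _ /=; rewrite lee_fin.
Qed.

Lemma integ_norm f : integ f -> integ (fun x => `|f x|).
Proof. by move=> fi; apply: integrable_norm. Qed.

Lemma integ_bounded f (K : R) : measurable_fun setT f -> (forall x, `|f x| <= K) ->
  integ f.
Proof.
move=> mf fK; apply: (@integ_le _ (fun=> K)) => //; last exact: integ_cst.
by move=> x; rewrite (le_trans (fK x))// ler_norm.
Qed.

Lemma integ_boundedM f g (K : R) : measurable_fun setT f -> (forall x, `|f x| <= K) ->
  integ g -> integ (fun x => f x * g x).
Proof.
move=> mf fK gi; apply: (@integ_le _ (fun x => K * g x)); last exact: integZ.
  by apply: measurable_funM => //; exact: integ_measurable.
by move=> x; rewrite !normrM ler_wpM2r// (le_trans (fK x))// ler_norm.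
Qed.

Lemma integ_sum (I : Type) (s : seq I) (f : I -> X -> R) :
  (forall i, integ (f i)) -> integ (fun x => \sum_(i <- s) f i x).
Proof.
move=> fi; elim: s => [|i s IH].
  by apply: (@eq_integ (fun=> 0)); [move=> x; rewrite big_nil|exact: integ_cst].
apply: (@eq_integ (fun x => f i x + \sum_(j <- s) f j x)); last exact: integD.
by move=> x; rewrite big_cons.
Qed.

Lemma ExD f g : integ f -> integ g -> Ex (fun x => f x + g x) = Ex f + Ex g.
Proof. by move=> *; exact: RintegralD. Qed.

Lemma ExB f g : integ f -> integ g -> Ex (fun x => f x - g x) = Ex f - Ex g.
Proof. by move=> *; exact: RintegralB. Qed.

Lemma ExZ (k : R) f : integ f -> Ex (fun x => k * f x) = k * Ex f.
Proof. by move=> *; exact: RintegralZl. Qed.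

Lemma Ex_cst (k : R) : Ex (fun=> k) = k.
Proof.
by rewrite /Ex Rintegral_cst//= probability_setT mulr1.
Qed.

Lemma Ex_le f g : integ f -> integ g -> (forall x, f x <= g x) -> Ex f <= Ex g.
Proof. by move=> fi gi fg; apply: le_Rintegral. Qed.

Lemma Ex_ge0 f : (forall x, 0 <= f x) -> 0 <= Ex f.
Proof. by move=> f0; apply: Rintegral_ge0. Qed.

Lemma Ex_sum (I : Type) (s : seq I) (f : I -> X -> R) :
  (forall i, integ (f i)) -> Ex (fun x => \sum_(i <- s) f i x) = \sum_(i <- s) Ex (f i).
Proof.
move=> fi; elim: s => [|i s IH].
  by rewrite big_nil -[RHS](Ex_cst 0); apply: eq_Ex => x; rewrite big_nil.
rewrite big_cons -IH -ExD//; last exact: integ_sum.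
by apply: eq_Ex => x; rewrite big_cons.
Qed.

Lemma Ex_norm_le f : integ f -> `|Ex f| <= Ex (fun x => `|f x|).
Proof. by move=> fi; apply: le_normr_Rintegral. Qed.

Lemma integ_fin f (c : R) : measurable_fun setT f -> (forall x, 0 <= f x) ->
  (\int[P]_x (f x)%:E <= c%:E)%E -> integ f /\ Ex f <= c.
Proof.
move=> mf f0 fc.
have fi : integ f.
  apply/integrableP; split; first exact/measurable_EFinP.
  apply: le_lt_trans (ltry c); rewrite (le_trans _ fc)//.
  by under eq_integral do rewrite /= ger0_norm//.
by split => //; rewrite -lee_fin -integE.
Qed.

Lemma integ_sqrM f g : measurable_fun setT f -> measurable_fun setT g ->
  integ (fun x => f x ^+ 2) -> integ (fun x => g x ^+ 2) -> integ (fun x => f x * g x).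
Proof.
move=> mf mg fi gi; apply: (@integ_le _ (fun x => f x ^+ 2 + g x ^+ 2)).
- exact: measurable_funM.
- move=> x; rewrite [leRHS]ger0_norm ?addr_ge0 ?sqr_ge0// ler_norml.
  have := sqr_ge0 (f x + g x); have := sqr_ge0 (f x - g x).
  have := sqr_ge0 (f x); have := sqr_ge0 (g x).
  by move=> *; apply/andP; split; nra.
- exact: integD.
Qed.

Lemma integ_sqr f : measurable_fun setT f -> integ (fun x => f x ^+ 2) -> integ f.
Proof.
move=> mf fi; apply: (@eq_integ (fun x => 1 * f x)); first by move=> x; rewrite mul1r.
by apply: integ_sqrM => //; apply: (@eq_integ (fun=> 1)); [move=> x; rewrite expr1n|exact: integ_cst].
Qed.

Lemma dominated_Ex (f_ : nat -> X -> R) f g :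
  (forall n, measurable_fun setT (f_ n)) -> measurable_fun setT f ->
  {ae P, forall x, f_ n x @[n --> \oo] --> f x} ->
  (forall n x, `|f_ n x| <= g x) -> integ g ->
  integ f /\ Ex (f_ n) @[n --> \oo] --> Ex f.
Proof.
move=> mf_ mf ff fg gi.
have [] := @dominated_convergence _ _ _ P setT measurableT (fun n x => (f_ n x)%:E)
  (EFin \o f) (EFin \o g).
- by move=> n; exact/measurable_EFinP.
- exact/measurable_EFinP.
- by apply: filterS ff => x h _; apply/cvg_EFin => //; near=> n.
- exact: gi.
- by apply: aeW => x n _ /=; rewrite lee_fin.
move=> fi _ h; split => //.
by move: h; rewrite (_ : (\int[P]_x (EFin \o f) x)%E = (Ex f)%:E) ?integE// => /fine_cvg.
Unshelve. all: end_near. Qed.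

Lemma L1_ae_subseq (f_ : nat -> X -> R) f :
  (forall n, measurable_fun setT (f_ n)) -> measurable_fun setT f ->
  (forall e, 0 < e -> exists n, (\int[P]_x (`|f_ n x - f x|)%:E <= e%:E)%E) ->
  exists phi : nat -> nat, {ae P, forall x, f_ (phi n) x @[n --> \oo] --> f x}.
Proof.
move=> mf_ mf H.
have /choice[phi Hphi] : forall n, exists k,
    (\int[P]_x (`|f_ k x - f x|)%:E <= (1 / (2 ^ (n + 1))%:R : R)%:E)%E.
  by move=> n; apply: H; rewrite divr_gt0// ltr0n expn_gt0.
exists phi.
pose u n (x : X) : \bar R := (`|f_ (phi n) x - f x|)%:E.
have mu n : measurable_fun setT (u n).
  by apply/measurable_EFinP/measurableT_comp => //; exact: measurable_funB.
have u0 n x : (0 <= u n x)%E by rewrite lee_fin.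
have Hs : (\int[P]_x \sum_(n <oo) u n x < +oo)%E.
  rewrite integral_nneseries//.
  apply: (@le_lt_trans _ _ (\sum_(n <oo) (1 / (2 ^ (n + 1))%:R : R)%:E)%E).
    by apply: lee_nneseries => n *; [apply: integral_ge0|apply: Hphi].
  have /cvg_lim -> // := @cvg_geometric_eseries_half R 1 0.
  by rewrite ltry.
have /integrable_ae : P.-integrable setT (fun x => \sum_(n <oo) u n x)%E.
  apply/integrableP; split; first exact: ge0_emeasurable_sum.
  by under eq_integral do rewrite gee0_abs ?nneseries_ge0//.
move=> /(_ measurableT); apply: filterS => x /(_ I) xfin.
have /nneseries_tail_cvg h : (\sum_(n <oo) u n x < +oo)%E.
  by move: xfin; rewrite fin_numE => /andP[_ ?]; rewrite ltey.
have : u n x @[n --> \oo] --> 0%E.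
  apply: (squeeze_cvge _ (cvg_cst 0%E) (h _)) => //.
  near=> n; rewrite u0/=.
  have -> : u n x = (\sum_(n <= k < n.+1) u k x)%E by rewrite big_nat1.
  exact: nneseries_lim_ge.
move=> /fine_cvg /= h0.
apply/subr_cvg0/norm_cvg0P.
exact: h0.
Unshelve. all: end_near. Qed.

Lemma null_ae (A : set X) (Pr : X -> Prop) : measurable A -> P A = 0%E ->
  (forall x, ~ A x -> Pr x) -> {ae P, forall x, Pr x}.
Proof.
move=> mA A0 H; exists A; split => // x /=; apply: contra_notP; exact: H.
Qed.

Lemma Ex_ae_eq f g : measurable_fun setT f -> measurable_fun setT g ->
  {ae P, forall x, f x = g x} -> Ex f = Ex g.
Proof.
move=> mf mg fg; rewrite /Ex /Rintegral; congr fine.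
apply: ae_eq_integral => //; [exact/measurable_EFinP|exact/measurable_EFinP|].
by apply: filterS fg => x ->.
Qed.

Lemma integ_ae_eq f g : measurable_fun setT f -> measurable_fun setT g ->
  {ae P, forall x, f x = g x} -> integ f -> integ g.
Proof.
move=> mf mg fg /integrableP[_ fi]; apply/integrableP; split; first exact/measurable_EFinP.
rewrite (_ : (\int[P]_x `|(EFin \o g) x| = \int[P]_x `|(EFin \o f) x|)%E)//.
apply: ae_eq_integral => //.
- by apply: measurableT_comp => //; exact/measurable_EFinP.
- by apply: measurableT_comp => //; exact/measurable_EFinP.
- by apply: filterS fg => x /= ->.
Qed.

Lemma Ex_le_ae f g : integ f -> integ g -> {ae P, forall x, f x <= g x} -> Ex f <= Ex g.
Proof.
move=> fi gi fg; have mf := integ_measurable fi; have mg := integ_measurable gi.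
have mm : measurable_fun setT (fun x => Num.max (f x) (g x)) by exact: measurable_maxr.
have gE : {ae P, forall x, g x = Num.max (f x) (g x)}.
  by apply: filterS fg => x h; rewrite max_r.
rewrite (Ex_ae_eq mg mm gE); apply: Ex_le => //; first exact: integ_ae_eq gE gi.
by move=> x; rewrite le_max lexx.
Qed.

End expectation.

Section family_of_finite_measures.
Context d1 d2 (X : measurableType d1) (Y : measurableType d2) (R : realType).
Context (l : X -> {measure set Y -> \bar R}).
Hypothesis ml : forall B, measurable B -> measurable_fun setT (l ^~ B).
Hypothesis l_fin : forall x, (l x setT < +oo)%E.

(** Monotone class argument from rectangles; the finite masses allow subtraction in the difference
    step. It lets the measures dQ, which depend on the path, be used as a kernel. *)
Lemma measurable_fun_family_xsection (A : set (X * Y)) : measurable A ->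
  measurable_fun setT (fun x => l x (xsection A x)).
Proof.
pose XY := [set A : set (X * Y) |
  measurable A /\ measurable_fun setT (fun x => l x (xsection A x))].
move: A; suff : measurable `<=` XY by move=> h A /h[].
rewrite measurable_prod_measurableType.
set C := [set A `*` B | A in measurable & B in measurable].
have CI : setI_closed C.
  move=> _ _ [X1 mX1 [X2 mX2 <-]] [Y1 mY1 [Y2 mY2 <-]].
  exists (X1 `&` Y1); first exact: measurableI.
  by exists (X2 `&` Y2); [exact: measurableI|rewrite setXI].
have CT : C setT by exists setT => //; exists setT => //; rewrite setXTT.
have CXY : C `<=` XY.
  move=> _ [A mA [B mB <-]]; split; first exact: measurableX.
  rewrite (_ : (fun _ => _) = (fun x => l x B * (\1_A x)%:E)%E); last first.
    apply/funext => x; rewrite indicE; have [xA|xA] := boolP (x \in A).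
      by rewrite mule1 in_xsectionX.
    by rewrite mule0 notin_xsectionX// measure0.
  apply: emeasurable_funM; first exact: ml.
  by apply/measurable_EFinP; rewrite (_ : \1_ _ = mindic R mA).
suff lsys : lambda_system setT XY by exact: lambda_system_subset.
split => //; [exact: CXY| |exact: xsection_ndseq_closed].
move=> A B BA [mA mphiA] [mB mphiB]; split; first exact: measurableD.
rewrite (_ : (fun _ => _) = (fun x => l x (xsection A x) - l x (xsection B x))%E).
  exact: emeasurable_funB.
apply/funext => x; rewrite xsectionD measureD.
- by rewrite setIidr//; exact: le_xsection.
- exact: measurable_xsection.
- exact: measurable_xsection.
- apply: le_lt_trans (l_fin x); apply: le_measure => //; rewrite ?inE//.
  exact: measurable_xsection.
Qed.

Import HBNNSimple.

Lemma measurable_fun_family_integral (k : X * Y -> \bar R) :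
  (forall z, (0 <= k z)%E) -> measurable_fun setT k ->
  measurable_fun setT (fun x => \int[l x]_y k (x, y))%E.
Proof.
move=> k0 mk; pose k_ := nnsfun_approx measurableT mk.
apply: (@measurable_fun_xsection_integral _ _ _ _ _ _ _ k_).
- by move=> a b ab; exact/nd_nnsfun_approx.
- by move=> z; exact/cvg_nnsfun_approx.
- by move=> n r; apply: measurable_fun_family_xsection.
Qed.

End family_of_finite_measures.

Section lebesgue_stieltjes.
Context (R : realType).
Implicit Types (F : cumulative R R).
Local Notation LS := lebesgue_stieltjes_measure.

Lemma LS_itv_oc F (a b : R) : a <= b -> LS F `]a, b]%classic = (F b - F a)%:E.
Proof.
move=> ab; rewrite /LS/= /measure_extension/= measurable_mu_extE/=; last exact: is_ocitv.
by rewrite wlength_itv_bnd.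
Qed.

Lemma LS_set1 F (a s : R) : a < s -> F x @[x --> s^'-] --> F s -> LS F [set s] = 0%E.
Proof.
move=> as_ Fs; apply/eqP; rewrite eq_le measure_ge0 andbT.
apply/lee_addgt0Pr => e e0; rewrite add0e.
have [x xs Fx] : exists2 x, x < s & F s - F x <= e.
  have /cvgrPdist_le /(_ e e0) H := Fs.
  near (s^'-) => x; exists x; first by near: x; exact: nbhs_left_lt.
  by apply: le_trans (ler_norm _) _; near: x.
rewrite (le_trans (_ : _ <= LS F `]x, s]%classic)%E)//; last first.
  by rewrite LS_itv_oc ?lee_fin// ltW.
apply: le_measure; rewrite ?inE//.
by move=> _ ->; rewrite /= in_itv/= xs lexx.
Unshelve. all: end_near. Qed.

End lebesgue_stieltjes.

(** * Cylinder functions *)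

Section matrix_norm.
Context (R : realType) (m n : nat).
Implicit Types A : 'M[R]_(m, n).

Lemma mx_entry_le A i j : `|A i j| <= `|A|.
Proof.
rewrite [leRHS]mx_normrE; apply: (le_trans _ (le_bigmax _ _ (i, j))).
exact: lexx.
Qed.

Lemma mx_norm_le A (e : R) : 0 <= e -> (forall i j, `|A i j| <= e) -> `|A| <= e.
Proof. by move=> e0 Ae; rewrite [leLHS]mx_normrE; apply/bigmax_leP. Qed.

End matrix_norm.

Section cylinder_functions.
Context {R : realType} {d : nat} {T : R}.
Local Notation Omega := (path_space (R := R) d T).
Implicit Types (w : Omega) (t s : R).

Lemma continuous_measurable_path (X : Omega -> R) :
  continuous X -> measurable_fun setT X.
Proof.
move=> /continuousP cX; apply: (measurability _ (RGenOpens.measurableE R)) => _ [_ [a [b ->]] <-].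
rewrite setTI; apply: sub_sigma_algebra; apply: cX; exact: interval_open.
Qed.

Lemma Bproc_out t w : t \notin `[0, T] -> Bproc t w = 0.
Proof. by move=> tT; rewrite /Bproc; case: w => /= w; rewrite inE => -[_ _]; exact. Qed.

Lemma Bproc0 w : Bproc 0 w = 0.
Proof. by rewrite /Bproc; case: w => /= w; rewrite inE => -[]. Qed.

Lemma Bproc_continuous t : continuous (Bproc (R := R) (d := d) (T := T) t).
Proof.
move=> w; have [tT|tT] := boolP (t \in `[0, T]); last first.
  rewrite (_ : Bproc t = fun=> 0); last by apply/funext => w'; rewrite Bproc_out.
  exact: cst_continuous.
have cval : val w' @[w' --> w] --> (val w : {uniform` `[0, T] -> 'rV[R]_d}).
  exact: initial_continuous.
move=> U /=; rewrite -nbhs_entourageE => -[E entE EU].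
have /cval : nbhs (val w : {uniform` `[0, T] -> 'rV[R]_d})
    [set h | E (val w t, (h : R -> 'rV[R]_d) t)].
  by apply/uniform_nbhs; exists E; split => // h /= hE; exact: hE.
move=> hc; have Fw := @nbhs_filter Omega w.
apply: (@filterS _ (nbhs w) Fw _ _ _ hc) => w' /= hw'; apply: EU.
exact/xsectionP.
Qed.

Definition cylinder k (ts : 'I_k -> R) w : 'M[R]_(k, d) :=
  \matrix_(i, c) Bproc (ts i) w 0 c.

Lemma cylinder_continuous k (ts : 'I_k -> R) (phi : 'M[R]_(k, d) -> R) :
  Cb_Lip phi -> continuous (fun w => phi (cylinder ts w)).
Proof.
move=> [_ [C HC]] w; have Fw := @nbhs_filter Omega w; apply/cvgrPdist_le => e e0.
pose C' := `|C| + 1; have C'0 : 0 < C' by rewrite ltr_pwDr.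
have H (i : 'I_k) : \forall w' \near w, `|Bproc (ts i) w - Bproc (ts i) w'| <= e / C'.
  by have /cvgrPdist_le := @Bproc_continuous (ts i) w; apply; rewrite divr_gt0.
apply: (@filterS _ (nbhs w) Fw _ _ _ (filter_forall _ H)) => w' Hw'.
rewrite (le_trans (HC _ _))//.
apply: (@le_trans _ _ (C' * (e / C'))); last by rewrite mulrC divfK// gt_eqF.
rewrite (le_trans (ler_norm _))// normrM normr_id ler_pM// /C' ?lerDl//.
apply: mx_norm_le => [|i c]; first by rewrite divr_ge0 ?ltW.
by rewrite !mxE (le_trans _ (Hw' i))// (le_trans _ (mx_entry_le _ 0 c))// !mxE.
Qed.

Lemma Lip_continuous t (X : Omega -> R) : Lip t X -> continuous X.
Proof.
move=> [k [ts [phi [_ cphi XE]]]].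
by rewrite (_ : X = fun w => phi (cylinder ts w)); [exact: cylinder_continuous|exact/funext].
Qed.

Lemma Lip_measurable t (X : Omega -> R) : Lip t X -> measurable_fun setT X.
Proof. by move=> /Lip_continuous/continuous_measurable_path. Qed.

Lemma Lip_bounded t (X : Omega -> R) : Lip t X -> exists K, forall w, `|X w| <= K.
Proof. by move=> [k [ts [phi [_ [[K HK] _] XE]]]]; exists K => w; rewrite XE. Qed.

Lemma Lip_cst t (a : R) : Lip t ((fun=> a) : Omega -> R).
Proof.
exists 0%N, (fun=> 0), (fun=> a); split => //; first by case.
split; first by exists `|a|.
by exists 0 => x y; rewrite subrr normr0 mul0r.
Qed.

Lemma Lip_le s t (X : Omega -> R) : s <= t -> Lip s X -> Lip t X.
Proof.
move=> st [k [ts [phi [tsP cphi XE]]]]; exists k, ts, phi; split => // i.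
by have /andP[-> h] := tsP i; rewrite (le_trans h).
Qed.

(** The two lists of times are concatenated. Cylinder functions are bounded, so bounds and Lipschitz
    constants of F on bounded sets suffice; this is what admits products. *)
Lemma Lip_comp2 t (F : R -> R -> R) (X Y : Omega -> R) :
  (forall A, exists K, forall a b, `|a| <= A -> `|b| <= A -> `|F a b| <= K) ->
  (forall A, exists K, forall a a' b b', `|a| <= A -> `|a'| <= A -> `|b| <= A -> `|b'| <= A ->
     `|F a b - F a' b'| <= K * (`|a - a'| + `|b - b'|)) ->
  Lip t X -> Lip t Y -> Lip t (fun w => F (X w) (Y w)).
Proof.
move=> Fb Fl [k [ts [phi [tsP [[K HK] [C HC]] XE]]]].
move=> [k' [ts' [phi' [tsP' [[K' HK'] [C' HC']] YE]]]].
pose A := Num.max K K'.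
have HA x : `|phi x| <= A by rewrite (le_trans (HK x))// le_max lexx.
have HA' x : `|phi' x| <= A by rewrite (le_trans (HK' x))// le_max lexx orbT.
exists (k + k')%N, (fun i : 'I_(k + k') => match fintype.split i with inl i => ts i | inr i => ts' i end),
  (fun z => F (phi (usubmx z)) (phi' (dsubmx z))); split.
- by move=> i; case: fintype.split.
- split; first by have [L HL] := Fb A; exists L => x; exact: HL.
  have [L HL] := Fl A; exists (`|L| * (`|C| + `|C'|)) => x y.
  rewrite (le_trans (HL _ _ _ _ _ _ _ _))//.
  rewrite (@le_trans _ _ (`|L| * (`|phi (usubmx x) - phi (usubmx y)| + `|phi' (dsubmx x) - phi' (dsubmx y)|)))//.
    by rewrite ler_wpM2r ?addr_ge0// ler_norm.
  rewrite -mulrA ler_wpM2l// mulrDl lerD//.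
    rewrite (le_trans (HC _ _))// (@le_trans _ _ (`|C| * `|usubmx x - usubmx y|))//.
      by rewrite ler_wpM2r// ler_norm.
    rewrite ler_wpM2l//; apply: mx_norm_le => // i j; rewrite !mxE.
    by rewrite (le_trans _ (mx_entry_le _ (lshift k' i) j))// !mxE.
  rewrite (le_trans (HC' _ _))// (@le_trans _ _ (`|C'| * `|dsubmx x - dsubmx y|))//.
    by rewrite ler_wpM2r// ler_norm.
  rewrite ler_wpM2l//; apply: mx_norm_le => // i j; rewrite !mxE.
  by rewrite (le_trans _ (mx_entry_le _ (rshift k i) j))// !mxE.
- move=> w; rewrite XE YE; congr (F (phi _) (phi' _)); apply/matrixP => i c; rewrite !mxE.
    by rewrite (unsplitK (inl i)).
  by rewrite (unsplitK (inr i)).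
Qed.

Lemma Lip_comp t (F : R -> R) (X : Omega -> R) :
  (forall A, exists K, forall a, `|a| <= A -> `|F a| <= K) ->
  (forall A, exists K, forall a a', `|a| <= A -> `|a'| <= A ->
     `|F a - F a'| <= K * `|a - a'|) ->
  Lip t X -> Lip t (fun w => F (X w)).
Proof.
move=> Fb Fl XL; apply: (@Lip_comp2 t (fun a _ => F a) X X) => // A.
  by have [K HK] := Fb A; exists K => a b aA _; exact: HK.
have [K HK] := Fl A; exists `|K| => a a' b b' h1 h2 _ _; rewrite (le_trans (HK _ _ _ _))//.
rewrite (@le_trans _ _ (`|K| * `|a - a'|)) ?ler_wpM2r ?ler_norm//.
by rewrite ler_wpM2l// lerDl.
Qed.

Lemma Lip_clamp t (K : R) (X : Omega -> R) : 0 <= K -> Lip t X -> Lip t (fun w => clamp K (X w)).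
Proof.
move=> K0; apply: Lip_comp => A; first by exists K => a _; exact: clamp_le.
by exists 1 => a a' _ _; rewrite mul1r clamp_lip.
Qed.

Lemma Lip_add t (X Y : Omega -> R) : Lip t X -> Lip t Y -> Lip t (fun w => X w + Y w).
Proof.
apply: Lip_comp2 => A.
  by exists (A + A) => a b aA bA; rewrite (le_trans (ler_normD _ _))// lerD.
exists 1 => a a' b b' _ _ _ _; rewrite mul1r (le_trans _ (ler_normD _ _))//.
by rewrite opprD addrACA.
Qed.

Lemma Lip_mul t (X Y : Omega -> R) : Lip t X -> Lip t Y -> Lip t (fun w => X w * Y w).
Proof.
apply: Lip_comp2 => A.
  by exists (A * A) => a b aA bA; rewrite normrM ler_pM.
exists A => a a' b b' aA a'A bA b'A.
rewrite (_ : _ - _ = (a - a') * b + a' * (b - b')); last ring.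
rewrite (le_trans (ler_normD _ _))// !normrM mulrDr lerD//.
  by rewrite mulrC ler_wpM2r.
by rewrite ler_wpM2r.
Qed.

End cylinder_functions.

(** * Upper expectations over a family of probabilities *)

Section upper_expectation.
Context {R : realType} {d : nat} {T : R}.
Local Notation Omega := (path_space (R := R) d T).
Context (PP : set (probability Omega R)).
Implicit Types (P : probability Omega R) (F : Omega -> R).

Lemma le_upE P X : PP P -> (\int[P]_w X w <= upE PP X)%E.
Proof. by move=> PPP; apply: ereal_sup_ubound; exists P. Qed.

Lemma upE_le X (c : \bar R) : (forall P, PP P -> (\int[P]_w X w <= c)%E) -> (upE PP X <= c)%E.
Proof. by move=> H; apply: ge_ereal_sup => _ [P PPP <-]; exact: H. Qed.

Hypothesis PP0 : PP !=set0.

Lemma upE_bounded F (K : R) : measurable_fun setT F -> (forall w, `|F w| <= K) ->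
  upE PP (EFin \o F) \is a fin_num.
Proof.
move=> mF FK; have [P PPP] := PP0.
have H P' : integ P' F by exact: integ_bounded FK.
rewrite fin_numE; apply/andP; split.
  rewrite -ltNye; apply: lt_le_trans (le_upE _ PPP).
  by rewrite (integE (H P)) ltNyr.
rewrite -ltey; apply: le_lt_trans (ltry K); apply: upE_le => P' _.
rewrite (integE (H P')) lee_fin -[leRHS](Ex_cst P'); apply: Ex_le => //.
  exact: integ_cst.
by move=> w; rewrite (le_trans (ler_norm _)).
Qed.

(** A supremum of functionals that are 1-Lipschitz for the uniform norm is again 1-Lipschitz;
    boundedness keeps the values finite, so [fine] loses nothing. *)
Lemma fine_upE_lip F F' (K e : R) : measurable_fun setT F -> (forall w, `|F w| <= K) ->
  measurable_fun setT F' -> (forall w, `|F' w| <= K) ->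
  (forall w, `|F w - F' w| <= e) ->
  `|fine (upE PP (EFin \o F)) - fine (upE PP (EFin \o F'))| <= e.
Proof.
move=> mF FK mF' FK' FF'.
have H P' : integ P' F by exact: integ_bounded FK.
have H' P' : integ P' F' by exact: integ_bounded FK'.
suff key (G G' : Omega -> R) : measurable_fun setT G -> (forall w, `|G w| <= K) ->
  measurable_fun setT G' -> (forall w, `|G' w| <= K) -> (forall w, G w - G' w <= e) ->
  fine (upE PP (EFin \o G)) - fine (upE PP (EFin \o G')) <= e.
  rewrite ler_norml -[- e <= _]lerN2 opprK opprB; apply/andP; split; apply: key => // w.
    by rewrite (le_trans (ler_norm _))// distrC.
  by rewrite (le_trans (ler_norm _)).
move=> mG GK mG' GK' GG'.
have iG P' : integ P' G by exact: integ_bounded GK.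
have iG' P' : integ P' G' by exact: integ_bounded GK'.
rewrite lerBlDr -lee_fin EFinD !fineK ?(upE_bounded _ GK)//; last exact: upE_bounded GK'.
apply: upE_le => P PPP.
apply: (@le_trans _ _ (e%:E + \int[P]_w (G' w)%:E)%E); last first.
  by rewrite leeD2l//; exact: le_upE.
rewrite !integE// -EFinD lee_fin -[X in X + _](Ex_cst P) -ExD//; last exact: integ_cst.
apply: Ex_le => // [|w]; first by apply: integD => //; exact: integ_cst.
by rewrite -lerBlDr.
Qed.

(** The upper bound holds under each P; the lower one takes a P that nearly attains the supremum.
    This is why the conditional expectation of xi (X - Y) is 0 for xi >= 0. *)
Lemma upE_center F (K a : R) : measurable_fun setT F -> (forall w, `|F w| <= K) -> 0 <= a ->
  upE PP (fun w => (a * (F w - fine (upE PP (EFin \o F))))%:E) = 0%E.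
Proof.
move=> mF FK a0; set y := fine _.
have yE : y%:E = upE PP (EFin \o F) by rewrite fineK//; exact: upE_bounded FK.
have iF P : integ P F by exact: integ_bounded FK.
have iFy P : integ P (fun w => F w - y) by apply: integB => //; exact: integ_cst.
have E P : (\int[P]_w (a * (F w - y))%:E = (a * (Ex P F - y))%:E)%E.
  by rewrite integE ?ExZ ?ExB ?Ex_cst//; [exact: integ_cst|exact: integZ].
apply/eqP; rewrite eq_le; apply/andP; split.
  apply: upE_le => P PPP; rewrite E lee_fin mulr_ge0_le0// subr_le0.
  by rewrite -lee_fin yE -(integE (iF P)); exact: le_upE.
apply/lee_addgt0Pr => e e0.
(* [a + 1] in place of [a] covers the case a = 0. *)
have a10 : 0 < a + 1 by rewrite ltr_pwDr.
have := @ub_ereal_sup_adherent R [set (\int[P]_w (EFin \o F) w)%E | P in PP] (e / (a + 1)).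
rewrite divr_gt0// -/(upE PP (EFin \o F)) -yE => /(_ isT isT)[_ [P PPP <-]].
rewrite integE//= -EFinB lte_fin => h.
apply: (@le_trans _ _ ((a * (Ex P F - y))%:E + e%:E)%E).
  rewrite -EFinD lee_fin.
  have : a * (- (e / (a + 1))) <= a * (Ex P F - y) by rewrite ler_wpM2l//; lra.
  have : a * (e / (a + 1)) <= e by rewrite mulrCA -[leRHS]mulr1 ler_pM2l// ler_pdivrMr//; lra.
  lra.
by rewrite leeD2r// -E; exact: le_upE.
Qed.

End upper_expectation.

Section lipschitz_maps.
Context (R : realType).
Implicit Types (m n p q : nat).

Definition mx_lipschitz m n p q (L : 'M[R]_(m, n) -> 'M[R]_(p, q)) : Prop :=
  exists C, forall x y, `|L x - L y| <= C * `|x - y|.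

Lemma Cb_Lip_comp d k l (L : 'M[R]_(k, d) -> 'M[R]_(l, d)) (phi : 'M[R]_(l, d) -> R) :
  mx_lipschitz L -> Cb_Lip phi -> Cb_Lip (phi \o L).
Proof.
move=> [C HC] [[K HK] [D HD]]; split; first by exists K => x; exact: HK.
exists (`|D| * C) => x y; rewrite (le_trans (HD _ _))//.
rewrite (@le_trans _ _ (`|D| * `|L x - L y|))//; first by rewrite ler_wpM2r// ler_norm.
by rewrite -mulrA ler_wpM2l.
Qed.

Lemma Cb_LipM d k (phi psi : 'M[R]_(k, d) -> R) :
  Cb_Lip phi -> Cb_Lip psi -> Cb_Lip (fun x => phi x * psi x).
Proof.
move=> [[K HK] [C HC]] [[K' HK'] [C' HC']]; split.
  by exists (K * K') => x; rewrite normrM ler_pM.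
exists (C * K' + K * C') => x y.
rewrite (_ : _ - _ = (phi x - phi y) * psi x + phi y * (psi x - psi y)); last ring.
rewrite (le_trans (ler_normD _ _))// !normrM mulrDl lerD//.
  by rewrite mulrAC ler_pM.
by rewrite -mulrA ler_pM.
Qed.

Lemma Cb_LipB d k (phi psi : 'M[R]_(k, d) -> R) :
  Cb_Lip phi -> Cb_Lip psi -> Cb_Lip (fun x => phi x - psi x).
Proof.
move=> [[K HK] [C HC]] [[K' HK'] [C' HC']]; split.
  by exists (K + K') => x; rewrite (le_trans (ler_normB _ _))// lerD.
exists (C + C') => x y; rewrite opprB addrCA -addrA addrA mulrDl.
rewrite (_ : _ + _ = (phi x - phi y) - (psi x - psi y)); last ring.
by rewrite (le_trans (ler_normB _ _))// lerD.
Qed.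

Lemma mx_lipschitz_col m1 m2 n p q (L1 : 'M[R]_(p, q) -> 'M[R]_(m1, n))
    (L2 : 'M[R]_(p, q) -> 'M[R]_(m2, n)) :
  mx_lipschitz L1 -> mx_lipschitz L2 -> mx_lipschitz (fun x => col_mx (L1 x) (L2 x)).
Proof.
move=> [C HC] [D HD]; exists (`|C| + `|D|) => x y.
apply: mx_norm_le => [|i j]; first by rewrite mulr_ge0// addr_ge0.
rewrite opp_col_mx add_col_mx mxE; case: fintype.split => k.
  rewrite (le_trans (mx_entry_le _ _ _))// (le_trans (HC _ _))// ler_wpM2r//.
  by rewrite (le_trans (ler_norm _))// lerDl.
rewrite (le_trans (mx_entry_le _ _ _))// (le_trans (HD _ _))// ler_wpM2r//.
by rewrite (le_trans (ler_norm _))// lerDr.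
Qed.

Lemma mx_lipschitz_usub m1 m2 n : mx_lipschitz (@usubmx R m1 m2 n).
Proof.
exists 1 => x y; rewrite mul1r; apply: mx_norm_le => // i j; rewrite !mxE.
by rewrite (le_trans _ (mx_entry_le _ (lshift m2 i) j))// !mxE.
Qed.

Lemma mx_lipschitz_dsub m1 m2 n : mx_lipschitz (@dsubmx R m1 m2 n).
Proof.
exists 1 => x y; rewrite mul1r; apply: mx_norm_le => // i j; rewrite !mxE.
by rewrite (le_trans _ (mx_entry_le _ (rshift m1 i) j))// !mxE.
Qed.

Lemma mx_lipschitz_comp m n p q r s (L : 'M[R]_(m, n) -> 'M[R]_(p, q))
    (L' : 'M[R]_(p, q) -> 'M[R]_(r, s)) :
  mx_lipschitz L' -> mx_lipschitz L -> mx_lipschitz (L' \o L).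
Proof.
move=> [D HD] [C HC]; exists (`|D| * C) => x y; rewrite (le_trans (HD _ _))//.
rewrite (@le_trans _ _ (`|D| * `|L x - L y|))//; first by rewrite ler_wpM2r// ler_norm.
by rewrite -mulrA ler_wpM2l.
Qed.

(* From increments back to path values: sums of the first b rows, and
   differences of two such sums *)
Definition partial_row m n (x : 'M[R]_(m, n)) (b : nat) (c : 'I_n) : R :=
  \sum_(i < m | (i < b)%N) x i c.

Definition rows_between m n k (a b : 'I_k -> nat) (x : 'M[R]_(m, n)) : 'M[R]_(k, n) :=
  \matrix_(i, c) (partial_row x (b i) c - partial_row x (a i) c).

Lemma partial_row_lip m n (x y : 'M[R]_(m, n)) b c :
  `|partial_row x b c - partial_row y b c| <= m%:R * `|x - y|.
Proof.
rewrite /partial_row -sumrB (le_trans (ler_norm_sum _ _ _))//.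
apply: (@le_trans _ _ (\sum_(i < m) `|x - y|)).
  rewrite big_mkcond; apply: ler_sum => i _; case: ifP => // _.
  by rewrite (le_trans _ (mx_entry_le _ i c))// !mxE.
by rewrite sumr_const card_ord mulr_natl.
Qed.

Lemma mx_lipschitz_rows_between m n k (a b : 'I_k -> nat) :
  mx_lipschitz (@rows_between m n k a b).
Proof.
exists (m%:R + m%:R) => x y; apply: mx_norm_le => [|i c]; rewrite ?mxE.
  by rewrite mulr_ge0// addr_ge0.
rewrite opprB addrCA -addrA addrA.
rewrite (_ : _ + _ = (partial_row x (b i) c - partial_row y (b i) c) -
   (partial_row x (a i) c - partial_row y (a i) c)); last ring.
by rewrite (le_trans (ler_normB _ _))// mulrDl lerD// partial_row_lip.
Qed.

End lipschitz_maps.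

(** * Conditional expectations of cylinder functions *)

Section conditional_expectation.
Context {R : realType} {d : nat} {T : R}.
Local Notation Omega := (path_space (R := R) d T).
Context (G : 'M[R]_d -> R) (PP : set (probability Omega R)).
Hypothesis hPP : represents_G_expectation G PP.
Implicit Types (P : probability Omega R) (X Y xi : Omega -> R).

(** The supremum over an empty family is -oo, which is not the real value that the upper expectation
    of a constant must have. *)
Lemma PP_nonempty : 0 <= T -> PP !=set0.
Proof.
move=> T0; apply/set0P/eqP => PP0.
have c0 : Cb_Lip ((fun=> 0) : 'rV[R]_d -> R).
  by split; exists 0 => *; rewrite ?subrr normr0 ?mul0r.
have [u _ /(_ 0 0 (lexx _) (lexx _))] := hPP.1 _ c0.
rewrite addr0 => /(_ T0); rewrite /upE PP0 image_set0 ereal_sup0.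
by [].
Qed.

Lemma partial_row_increments (tau : nat -> R) m (w : Omega) b c : tau 0%N = 0 -> (b <= m)%N ->
  partial_row (increments tau 0 m w) b c = Bproc (tau b) w 0 c.
Proof.
move=> tau0 bm; rewrite /partial_row.
transitivity (\sum_(i < m | (i < b)%N) (Bproc (tau i.+1) w 0 c - Bproc (tau i) w 0 c)).
  by apply: eq_bigr => i _; rewrite !mxE add0n.
rewrite -(big_ord_widen m (fun i => Bproc (tau i.+1) w 0 c - Bproc (tau i) w 0 c) bm).
rewrite -(big_mkord xpredT (fun i => Bproc (tau i.+1) w 0 c - Bproc (tau i) w 0 c)) telescope_sumr//.
by rewrite tau0 Bproc0 mxE subr0.
Qed.

Definition path_increments (N a k : nat) (z : 'M[R]_(N.+1, d)) : 'M[R]_(k, d) :=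
  \matrix_(i, c) (z (inord (a + i).+1) c - z (inord (a + i)) c).

Lemma mx_lipschitz_path_increments N a k : mx_lipschitz (@path_increments N a k).
Proof.
exists (1 + 1) => x y; apply: mx_norm_le => [|i c]; first by rewrite mulr_ge0.
rewrite !mxE; set p := inord _; set q := inord _.
rewrite (_ : _ - _ = (x p c - y p c) - (x q c - y q c)); last ring.
rewrite (le_trans (ler_normB _ _))// mulrDl mul1r lerD//.
  by rewrite (le_trans _ (mx_entry_le _ p c))// !mxE.
by rewrite (le_trans _ (mx_entry_le _ q c))// !mxE.
Qed.

Lemma path_incrementsE N (tau : nat -> R) a k (w : Omega) : (a + k <= N)%N ->
  increments tau a k w = path_increments a k (cylinder (fun i : 'I_N.+1 => tau i) w).
Proof.
move=> akN; apply/matrixP => i c; rewrite !mxE !inordK//.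
  by rewrite ltnS (leq_trans _ akN)// leq_add2l ltnW.
by rewrite ltnS (leq_trans _ akN)// -addnS leq_add2l.
Qed.

Lemma mx_lipschitz_cst m n p q (A : 'M[R]_(p, q)) : mx_lipschitz (fun _ : 'M[R]_(m, n) => A).
Proof. by exists 0 => x y; rewrite subrr normr0 mul0r. Qed.

Section tail_expectation.
Context (tau : nat -> R) (j m : nat) (phi : 'M[R]_(j + m, d) -> R).
Hypothesis cphi : Cb_Lip phi.

Definition tail_fun (x : 'M[R]_(j, d)) (w : Omega) : R :=
  phi (col_mx x (increments tau j m w)).

Lemma tail_fun_measurable x : measurable_fun setT (tail_fun x).
Proof.
apply: continuous_measurable_path.
rewrite (_ : tail_fun x = (fun w => (phi \o (fun z => col_mx x (path_increments j m z)))
   (cylinder (fun i : 'I_(j + m).+1 => tau i) w))); last first.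
  by apply/funext => w; rewrite /tail_fun (path_incrementsE _ _ (leqnn (j + m))).
apply: cylinder_continuous; apply: Cb_Lip_comp => //; apply: mx_lipschitz_col.
  exact: mx_lipschitz_cst.
exact: mx_lipschitz_path_increments.
Qed.

(** The conditional expectation as a function of the past increments; [fine] is harmless because phi
    is bounded. *)
Definition tail_expectation (x : 'M[R]_(j, d)) : R := fine (upE PP (EFin \o tail_fun x)).

Lemma tail_expectation_Lip : PP !=set0 -> Cb_Lip tail_expectation.
Proof.
move=> PP0; have [[K HK] [C HC]] := cphi; split.
  exists K => x; rewrite -[X in `|X|]subr0.
  have K0 : 0 <= K by exact: le_trans (HK (col_mx x 0)).
  have H : measurable_fun setT ((fun=> 0) : Omega -> R) by exact: measurable_cst.
  have -> : 0 = fine (upE PP (EFin \o ((fun=> 0) : Omega -> R))).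
    have := @upE_center _ _ _ PP PP0 (fun=> 0) K 0 H _ (lexx _).
    rewrite (_ : (fun w => _) = EFin \o ((fun=> 0) : Omega -> R)) => [->//|].
      by move=> w; rewrite normr0.
    by apply/funext => w; rewrite /= mul0r.
  apply: (@fine_upE_lip _ _ _ _ PP0 _ _ K) => [|w||w|w].
  - exact: tail_fun_measurable.
  - exact: HK.
  - exact: H.
  - by rewrite normr0.
  - by rewrite subr0 /tail_fun.
exists `|C| => x y; apply: (@fine_upE_lip _ _ _ _ PP0 _ _ K) => [|w||w|w].
- exact: tail_fun_measurable.
- exact: HK.
- exact: tail_fun_measurable.
- exact: HK.
rewrite (le_trans (HC _ _))// opp_col_mx add_col_mx subrr.
rewrite (@le_trans _ _ (`|C| * `|col_mx (x - y) (0 : 'M[R]_(m, d))|))//.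
  by rewrite ler_wpM2r// ler_norm.
rewrite ler_wpM2l//; apply: mx_norm_le => // i c; rewrite mxE.
case: fintype.split => l; first exact: mx_entry_le.
by rewrite mxE normr0.
Qed.

End tail_expectation.

Lemma cond_exp_Lip_continuous t X Y : PP !=set0 -> cond_exp_Lip PP t X Y ->
  [/\ continuous X, continuous Y & exists K, forall w, `|X w| <= K /\ `|Y w| <= K].
Proof.
move=> PP0 [j [m [tau [phi [_ cphi XE YE]]]]].
have YE' w : Y w = tail_expectation tau phi (increments tau 0 j w).
  by rewrite -[LHS]/(fine (Y w)%:E) YE.
have cY := tail_expectation_Lip tau cphi PP0; split.
- rewrite (_ : X = (fun w => (phi \o (fun z => col_mx (path_increments 0 j z) (path_increments j m z)))
     (cylinder (fun i : 'I_(j + m).+1 => tau i) w))); last first.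
    apply/funext => w; rewrite XE (@path_incrementsE (j + m) tau 0 j) ?leq_addr//.
    by rewrite (@path_incrementsE (j + m) tau j m).
  apply: cylinder_continuous; apply: Cb_Lip_comp => //.
  by apply: mx_lipschitz_col; exact: mx_lipschitz_path_increments.
- rewrite (_ : Y = (fun w => (tail_expectation tau phi \o path_increments 0 j)
     (cylinder (fun i : 'I_j.+1 => tau i) w))); last first.
    by apply/funext => w; rewrite YE' (@path_incrementsE j tau 0 j).
  apply: cylinder_continuous; apply: Cb_Lip_comp => //.
  exact: mx_lipschitz_path_increments.
- have [[K HK] _] := cphi; have [[K' HK'] _] := cY.
  exists (Num.max K K') => w; rewrite XE YE' !le_max HK; split => //.
  by rewrite HK' orbT.
Qed.

(* xi (X - Y) is again a cylinder function, of conditional expectation 0: both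
   are written in terms of increments along the times of xi merged with those
   of X. *)
Lemma cond_exp_Lip_test t X Y xi : PP !=set0 -> cond_exp_Lip PP t X Y ->
  Lip t xi -> (forall w, 0 <= xi w) ->
  cond_exp_Lip PP t (fun w => xi w * (X w - Y w)) (fun=> 0).
Proof.
move=> PP0 [j [m [tau [phi [[tau0 taund tauT taut] cphi XE YE]]]]].
move=> [k [ts [psi [tsP cpsi xiE]]]] xi0.
have tau_le a b : (a <= b)%N -> (b <= j + m)%N -> tau a <= tau b.
  elim: b => [|b IH]; first by rewrite leqn0 => /eqP ->.
  rewrite leq_eqVlt => /predU1P[->//|ab] bjm.
  by rewrite (le_trans (IH _ (ltnW bjm)))// taund.
(* All the times up to t at which X or xi reads the path, with repetitions: j + k + 1 entries, the
   first being 0 and the last t. *)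
pose l := sort <=%R ([seq tau i | i <- iota 0 j.+1] ++ codom ts).
have szl : size l = (j + k).+1.
  by rewrite size_sort size_cat size_map size_iota size_codom card_ord.
have srt : sorted <=%R l by apply: sort_sorted; exact: le_total.
have lin s : s \in l -> 0 <= s <= t.
  rewrite mem_sort mem_cat => /orP[/mapP[i]|/codomP[i ->]]; last exact: tsP.
    rewrite mem_iota add0n ltnS => /= ij ->; rewrite -tau0 -taut !tau_le ?leq_addr//.
    exact: leq_trans ij (leq_addr _ _).
have tau_in i : (i <= j)%N -> tau i \in l.
  by move=> ij; rewrite mem_sort mem_cat map_f// mem_iota.
have ts_in i : ts i \in l.
  by rewrite mem_sort mem_cat codom_f orbT.
have idx_le s : s \in l -> (index s l <= j + k)%N by rewrite -index_mem szl.
pose n := (j + k)%N.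
have nth_le a b : (a <= b)%N -> (b <= n)%N -> l`_a <= l`_b.
  move=> ab bn; apply: (sorted_leq_nth le_trans le_refl) => //.
    by rewrite inE szl ltnS (leq_trans ab).
  by rewrite inE szl ltnS.
have l0 : l`_0 = 0.
  have := tau_in 0%N (leq0n _); rewrite tau0 => h0.
  have /lin/andP[h _] : l`_0 \in l by rewrite mem_nth// szl.
  apply/eqP; rewrite eq_le h andbT -[leRHS](nth_index 0 h0) nth_le//.
  exact: idx_le.
have ln : l`_n = t.
  have := tau_in j (leqnn _); rewrite taut => ht.
  have /lin/andP[_ h] : l`_n \in l by rewrite mem_nth// szl ltnS.
  apply/eqP; rewrite eq_le h/= -[leLHS](nth_index 0 ht) nth_le//.
  exact: idx_le.
(* The merged times up to t, followed by the times of X after t, shifted from position j to position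
   n. *)
pose tau' i := if (i <= n)%N then l`_i else tau (j + (i - n))%N.
have tau'n i : tau' (n + i)%N = tau (j + i)%N.
  rewrite /tau'; case: i => [|i]; first by rewrite !addn0 leqnn ln taut.
  by rewrite addnS ltnNge leq_addr/= -addnS addKn.
have tau'0 : tau' 0%N = 0 by rewrite /tau'/=.
have B_idx s (w : Omega) c : s \in l ->
    partial_row (increments tau' 0 n w) (index s l) c = Bproc s w 0 c.
  move=> sl; rewrite partial_row_increments ?idx_le//.
  by rewrite /tau' idx_le// nth_index.
(* Path values at merged times are sums of initial rows; [La] thus recovers the past increments of
   X, and [Lb] the path values read by xi. *)
pose La (z : 'M[R]_(n + m, d)) : 'M[R]_(j, d) :=
  rows_between (fun i : 'I_j => index (tau i) l) (fun i => index (tau i.+1) l) (usubmx z).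
pose Lb (z : 'M[R]_(n + m, d)) : 'M[R]_(k, d) :=
  rows_between (fun=> 0%N) (fun i => index (ts i) l) (usubmx z).
have LaE (w : Omega) U : La (col_mx (increments tau' 0 n w) U) = increments tau 0 j w.
  apply/matrixP => i c; rewrite mxE col_mxKu !B_idx ?tau_in//; last exact: ltnW.
  by rewrite !mxE add0n.
have LbE (w : Omega) U : Lb (col_mx (increments tau' 0 n w) U) = cylinder ts w.
  apply/matrixP => i c; rewrite mxE col_mxKu B_idx ?ts_in//.
  by rewrite /partial_row big_pred0_eq subr0 !mxE.
have incE (w : Omega) : increments tau' n m w = increments tau j m w.
  by apply/matrixP => i c; rewrite !mxE -!addnS !tau'n.
pose phi2 := tail_expectation tau phi.
exists n, m, tau', (fun z => psi (Lb z) * (phi (col_mx (La z) (dsubmx z)) - phi2 (La z))); split.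
- split => //.
  + move=> i inm; rewrite /tau'; case: (ltnP i n) => [h|h].
      by rewrite (ltnW h) nth_le.
    case: (leqP i n) => [h'|h'].
      have -> : i = n by apply/eqP; rewrite eqn_leq h'.
      rewrite ln -taut subSnn; apply: tau_le; rewrite ?leq_addr//.
      by rewrite leq_add2l -(ltn_add2l n) addn0 (leq_ltn_trans h inm).
    rewrite subSn// addnS; apply: taund.
    by rewrite ltn_add2l ltn_subLR.
  + by rewrite tau'n.
  + by have := tau'n 0%N; rewrite !addn0 taut.
- have cLa : mx_lipschitz La.
    exact: (mx_lipschitz_comp (@mx_lipschitz_rows_between _ _ _ _ _ _) (@mx_lipschitz_usub _ _ _ _)).
  apply: Cb_LipM.
    apply: (@Cb_Lip_comp _ _ _ _ Lb psi) => //.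
    exact: (mx_lipschitz_comp (@mx_lipschitz_rows_between _ _ _ _ _ _) (@mx_lipschitz_usub _ _ _ _)).
  apply: Cb_LipB.
    apply: (@Cb_Lip_comp _ _ _ _ (fun z => col_mx (La z) (dsubmx z)) phi) => //.
    by apply: mx_lipschitz_col => //; exact: mx_lipschitz_dsub.
  by apply: (@Cb_Lip_comp _ _ _ _ La phi2) => //; exact: tail_expectation_Lip.
- move=> w; rewrite LaE LbE col_mxKd incE xiE -XE; congr (_ * (_ - _)).
  by rewrite -[LHS]/(fine (Y w)%:E) YE.
- move=> w; have [[K HK] _] := cphi.
  pose F := tail_fun tau phi (increments tau 0 j w).
  rewrite (_ : (fun w' => _) = (fun w' => (xi w * (F w' - fine (upE PP (EFin \o F))))%:E)).
    rewrite (@upE_center _ _ _ PP PP0 F K (xi w))//; first exact: tail_fun_measurable.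
    by move=> w'; exact: HK.
  by apply/funext => w'; rewrite LaE LbE col_mxKd incE xiE.
Qed.

(** The expectation under one P is below the upper expectation, and the upper expectation of xi (X -
    Y) equals that of its conditional expectation, which is 0. Extended to L1 limits, this gives the
    martingale property when applied to M and -M, and the variance bound when applied to squared
    increments. *)
Lemma cond_exp_Lip_le0 t X Y xi P : PP P -> cond_exp_Lip PP t X Y ->
  Lip t xi -> (forall w, 0 <= xi w) -> Ex P (fun w => xi w * (X w - Y w)) <= 0.
Proof.
move=> PPP XY xiL xi0; have PP0 : PP !=set0 by exists P.
have XY0 := cond_exp_Lip_test PP0 XY xiL xi0.
have [cX cY [K HK]] := cond_exp_Lip_continuous PP0 XY.
have [K' HK'] := Lip_bounded xiL.
have iX : integ P (fun w => xi w * (X w - Y w)).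
  apply: (@integ_boundedM _ _ _ _ xi (fun w => X w - Y w) K') => //.
    exact: Lip_measurable xiL.
  by apply: integB; apply: (@integ_bounded _ _ _ _ _ K);
    try exact: continuous_measurable_path; move=> w; have [] := HK w.
have := hPP.2 _ _ _ XY0; rewrite -lee_fin -(integE iX) => h.
apply: le_trans (le_upE (EFin \o (fun w => xi w * (X w - Y w))) PPP) _.
rewrite -h; apply: upE_le => P' _.
by rewrite integral0_eq.
Qed.

End conditional_expectation.

Definition locally_lipschitz (R : realType) (F : R -> R) : Prop :=
  forall A, exists K, forall a a', `|a| <= A -> `|a'| <= A -> `|F a - F a'| <= K * `|a - a'|.

Lemma locally_lipschitz_bounded (R : realType) (F : R -> R) : locally_lipschitz F ->
  forall A, exists K, forall a, `|a| <= A -> `|F a| <= K.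
Proof.
move=> Fl A; have [K HK] := Fl A; exists (`|K| * A + `|F 0|) => a aA.
have A0 : 0 <= A by exact: le_trans aA.
rewrite -[F a](subrK (F 0)) (le_trans (ler_normD _ _))// lerD2r.
rewrite (le_trans (HK a 0 _ _))// ?normr0// subr0.
rewrite (@le_trans _ _ (`|K| * `|a|))//; first by rewrite ler_wpM2r// ler_norm.
by rewrite ler_wpM2l.
Qed.

Lemma locally_lipschitz_continuous (R : realType) (F : R -> R) :
  locally_lipschitz F -> continuous F.
Proof.
move=> Fl x; have [K HK] := Fl (`|x| + 1); apply/cvgrPdist_le => e e0.
have K10 : 0 < `|K| + 1 by rewrite ltr_pwDr.
near=> y.
have xy1 : `|x - y| <= 1 by near: y; apply: cvgr_dist_le => //; exact: cvg_id.
have xye : `|x - y| <= e / (`|K| + 1).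
  by near: y; apply: cvgr_dist_le; [exact: cvg_id|rewrite divr_gt0].
rewrite (le_trans (HK _ _ _ _))//; first by rewrite lerDl.
  by rewrite -[y](subrK x) (le_trans (ler_normD _ _))// addrC lerD2l distrC.
rewrite (@le_trans _ _ ((`|K| + 1) * (e / (`|K| + 1))))//; last first.
  by rewrite mulrC divfK// gt_eqF.
rewrite (@le_trans _ _ (`|K| * `|x - y|))//; first by rewrite ler_wpM2r// ler_norm.
by rewrite ler_pM// lerDl.
Unshelve. all: end_near. Qed.

Lemma lipschitz_locally (R : realType) (F : R -> R) (K : R) :
  (forall x y, `|F x - F y| <= K * `|x - y|) -> locally_lipschitz F.
Proof. by move=> H A; exists K. Qed.

(* The consequences, for a single probability P, of the hypotheses on M: the
   class Ad t stands for the random variables that are limits of cylinder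
   functions of the path up to time t. *)
Record martingale_setting d (Om : measurableType d) (R : realType)
    (P : probability Om R) (T Lam : R) (Ad : R -> (Om -> R) -> Prop)
    (M : R -> Om -> R) (Q : Om -> cumulative R R) : Prop := {
  ms_T : 0 < T ;
  ms_Lam : 0 <= Lam ;
  Ad_measurable : forall t X, Ad t X -> measurable_fun setT X ;
  Ad_le : forall s t X, s <= t -> Ad s X -> Ad t X ;
  Ad_cst : forall t (a : R), Ad t (fun=> a) ;
  Ad_add : forall t X Y, Ad t X -> Ad t Y -> Ad t (fun w => X w + Y w) ;
  Ad_mul : forall t X Y, Ad t X -> Ad t Y -> Ad t (fun w => X w * Y w) ;
  Ad_comp : forall t (F : R -> R) X, locally_lipschitz F -> Ad t X -> Ad t (fun w => F (X w)) ;
  Ad_M : forall t, 0 <= t <= T -> Ad t (M t) ;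
  M_sq : forall t, 0 <= t <= T -> integ P (fun w => M t w ^+ 2) ;
  M_continuous : forall w, {within `[0, T], continuous (M ^~ w)} ;
  M_martingale : forall s t xi K, 0 <= s -> s <= t -> t <= T -> Ad s xi ->
    (forall w, `|xi w| <= K) -> Ex P (fun w => xi w * (M t w - M s w)) = 0 ;
  M_variance : forall s t xi K, 0 <= s -> s <= t -> t <= T -> Ad s xi ->
    (forall w, 0 <= xi w <= K) ->
    Ex P (fun w => xi w * (M t w - M s w) ^+ 2) <= Lam * (t - s) * Ex P xi ;
  Q_0 : forall w, Q w 0 = 0 ;
  Q_continuous : forall w, {within `[0, T], continuous (Q w : R -> R)} ;
  Q_measurable : forall t, 0 <= t <= T -> measurable_fun setT (fun w => Q w t) ;
  Q_variation : forall t e, 0 <= t <= T -> 0 < e -> exists2 delta, 0 < delta &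
    forall (N : nat) (tau : nat -> R), tau 0%N = 0 -> tau N = t ->
      (forall j, (j < N)%N -> 0 <= tau j.+1 - tau j < delta) ->
      (\int[P]_w (`|\sum_(j < N) (M (tau j.+1) w - M (tau j) w) ^+ 2 - Q w t|)%:E <= e%:E)%E }.

(** * From the family of probabilities to a single one *)

Section G_setting.
Context {R : realType} {d : nat} {T : R}.
Local Notation Omega := (path_space (R := R) d T).
Context (PP : set (probability Omega R)).
Implicit Types (P : probability Omega R) (X Y xi : Omega -> R).

(** Almost sure limits, since they are stable under products and locally Lipschitz maps without any
    moment condition. The class stands in for measurability with respect to the past of t. *)
Definition limit_of_Lip P t X : Prop :=
  measurable_fun setT X /\ exists2 X_ : nat -> Omega -> R,
    (forall n, Lip t (X_ n)) & {ae P, forall w, X_ n w @[n --> \oo] --> X w}.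

(** Convergences under [PP] are used in this form, as one index valid for every P. *)
Lemma upE_cvg0P (X_ : nat -> Omega -> \bar R) : PP !=set0 ->
  (forall n w, (0 <= X_ n w)%E) ->
  upE PP (X_ n) @[n --> \oo] --> 0%E <-> forall e, 0 < e -> exists n0, forall n, (n0 <= n)%N ->
    forall P, PP P -> (\int[P]_w X_ n w <= e%:E)%E.
Proof.
move=> [P0 PP0] X0; split=> [/fine_cvgP[H1 H2] e e0|H].
  move/cvgrPdist_le : H2 => /(_ e e0).
  move=> /(filterI H1)[n0 _ Hn0]; exists n0 => n n0n P PPP.
  have [fin h] := Hn0 n n0n.
  apply: le_trans (le_upE _ PPP) _; rewrite -[X in (X <= _)%E](fineK fin) lee_fin.
  by move: h; rewrite /= sub0r normrN; exact/le_trans/ler_norm.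
have ge0 n : (0 <= upE PP (X_ n))%E.
  by apply: le_trans (le_upE _ PP0); apply: integral_ge0 => w _.
apply/fine_cvgP; split.
  have [n0 Hn0] := H 1 ltr01; exists n0 => // n /= n0n.
  rewrite ge0_fin_numE//; apply: le_lt_trans (ltry 1).
  by apply: upE_le => P PPP; exact: Hn0.
apply/cvgrPdist_le => e e0; have [n0 Hn0] := H e e0; exists n0 => // n /= n0n.
rewrite sub0r normrN ger0_norm ?fine_ge0//.
have h : (upE PP (X_ n) <= e%:E)%E by apply: upE_le => P PPP; exact: Hn0.
by rewrite -lee_fin fineK// ge0_fin_numE// (le_lt_trans h)// ltry.
Qed.

Lemma Lp_cvgP p (X_ : nat -> Omega -> R) X : PP !=set0 ->
  Lp_cvg PP p X_ X <-> forall e, 0 < e -> exists n0, forall n, (n0 <= n)%N ->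
    forall P, PP P -> (\int[P]_w (`|X_ n w - X w| ^+ p)%:E <= e%:E)%E.
Proof. by move=> PP0; apply: upE_cvg0P => // n w; rewrite lee_fin exprn_ge0. Qed.

(** Cauchy-Schwarz in additive form: 2 e |f| <= f^2 + e^2. *)
Lemma L1_cvg_of_L2 P (f : Omega -> R) (e : R) : measurable_fun setT f -> 0 < e ->
  (\int[P]_w (`|f w| ^+ 2)%:E <= (e ^+ 2)%:E)%E -> (\int[P]_w (`|f w|)%:E <= e%:E)%E.
Proof.
move=> mf e0 h.
have mf1 : measurable_fun setT (fun w => `|f w|) by exact: measurableT_comp.
have mf2 : measurable_fun setT (fun w => `|f w| ^+ 2) by exact: measurable_funX.
have [i2 E2] := integ_fin mf2 (fun w => sqr_ge0 _) h.
have i1 : integ P (fun w => `|f w|).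
  apply: integ_sqr => //.
rewrite integE// lee_fin.
have : Ex P (fun w => 2 * e * `|f w|) <= Ex P (fun w => `|f w| ^+ 2 + e ^+ 2).
  apply: Ex_le; [exact: integZ|by apply: integD => //; exact: integ_cst|].
  by move=> w; have := sqr_ge0 (`|f w| - e); nra.
rewrite ExZ// ExD//; last exact: integ_cst.
rewrite Ex_cst => h1; rewrite -(ler_pM2l (_ : 0 < 2 * e)) ?mulr_gt0//.
by nra.
Qed.

Lemma LG_limit_of_Lip p t X P : PP P -> (p == 1) || (p == 2)%N -> LG PP p t X -> limit_of_Lip P t X.
Proof.
move=> PPP p12 [mX [X_ X_L cX]]; split => //.
have PP0 : PP !=set0 by exists P.
have mX_ n : measurable_fun setT (X_ n) by exact: Lip_measurable (X_L n).
have [phi Hphi] : exists phi : nat -> nat, {ae P, forall w, X_ (phi n) w @[n --> \oo] --> X w}.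
  apply: L1_ae_subseq => // e e0; move: p12 => /orP[/eqP|/eqP] pE.
    have [n0 Hn0] := (Lp_cvgP _ _ _ PP0).1 cX e e0; exists n0.
    apply: le_trans (Hn0 n0 (leqnn _) P PPP).
    by rewrite pE.
  have e20 : 0 < e ^+ 2 by rewrite exprn_gt0.
  have [n0 Hn0] := (Lp_cvgP _ _ _ PP0).1 cX _ e20; exists n0.
  apply: L1_cvg_of_L2 => //; first exact: measurable_funB.
  by have := Hn0 n0 (leqnn _) P PPP; rewrite pE.
by exists (X_ \o phi) => // n; exact: X_L.
Qed.

Lemma LG_integ1 t X P : PP P -> LG PP 1 t X -> integ P X.
Proof.
move=> PPP [mX [X_ X_L cX]]; have PP0 : PP !=set0 by exists P.
have [n0 Hn0] := (Lp_cvgP _ _ _ PP0).1 cX 1 ltr01.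
have mXn : measurable_fun setT (X_ n0) by exact: Lip_measurable (X_L n0).
have mD : measurable_fun setT (fun w => X_ n0 w - X w) by exact: measurable_funB.
have i1 : integ P (fun w => `|X_ n0 w - X w|).
  apply: (proj1 (@integ_fin _ _ _ P _ 1 _ _ _)) => //; first exact: measurableT_comp.
  exact: Hn0.
have [K HK] := Lip_bounded (X_L n0).
apply: (@integ_le _ _ _ _ _ (fun w => `|X_ n0 w - X w| + `|X_ n0 w|)) => //.
  move=> w; rewrite [leRHS]ger0_norm ?addr_ge0// addrC -[X in `|X| <= _](subKr (X_ n0 w)).
  exact: ler_normB.
by apply: integD => //; apply/integ_norm/integ_bounded.
Qed.

Lemma LG_integ2 t X P : PP P -> LG PP 2 t X -> integ P (fun w => X w ^+ 2).
Proof.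
move=> PPP [mX [X_ X_L cX]]; have PP0 : PP !=set0 by exists P.
have [n0 Hn0] := (Lp_cvgP _ _ _ PP0).1 cX 1 ltr01.
have mXn : measurable_fun setT (X_ n0) by exact: Lip_measurable (X_L n0).
have mD : measurable_fun setT (fun w => X_ n0 w - X w) by exact: measurable_funB.
have i1 : integ P (fun w => `|X_ n0 w - X w| ^+ 2).
  apply: (proj1 (@integ_fin _ _ _ P _ 1 _ _ _)) => //.
    by apply: measurable_funX; exact: measurableT_comp.
  exact: Hn0.
have [K HK] := Lip_bounded (X_L n0).
apply: (@integ_le _ _ _ _ _ (fun w => 2 * `|X_ n0 w - X w| ^+ 2 + 2 * K ^+ 2)).
- exact: measurable_funX.
- move=> w; rewrite (ger0_norm (sqr_ge0 (X w))) !real_normK ?num_real//.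
  rewrite [leRHS]ger0_norm; last by have := sqr_ge0 (X_ n0 w - X w); have := sqr_ge0 K; lra.
  have := HK w; rewrite ler_norml => /andP[h1 h2].
  have := sqr_ge0 (X w - X_ n0 w - X_ n0 w).
  have K0 : 0 <= K by exact: le_trans (normr_ge0 _) (HK w).
  have : X_ n0 w ^+ 2 <= K ^+ 2.
    by rewrite -(real_normK (num_real (X_ n0 w))) lerXn2r ?nnegrE// HK.
  by nra.
- apply: (@integD _ _ _ P (fun w => 2 * `|X_ n0 w - X w| ^+ 2) (fun=> 2 * K ^+ 2)).
    exact: integZ.
  exact: integ_cst.
Qed.

Lemma cond_exp_le0 (G : 'M[R]_d -> R) t X Y xi P : represents_G_expectation G PP ->
  PP P -> cond_exp PP t X Y -> Lip t xi -> (forall w, 0 <= xi w) ->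
  Ex P (fun w => xi w * (X w - Y w)) <= 0.
Proof.
move=> hPP PPP [LX LY [X_ [Y_ [XY cX cY]]]] xiL xi0.
have PP0 : PP !=set0 by exists P.
have iX := LG_integ1 PPP LX; have iY := LG_integ1 PPP LY.
have [K HK] := Lip_bounded xiL; have mxi := Lip_measurable xiL.
have K0 : 0 <= K by exact: le_trans (normr_ge0 _) (HK point).
apply/ler_addgt0Pr => e e0; rewrite add0r.
(* Each of the two L1 errors is multiplied by the bound K of xi; the added 1 covers K = 0. *)
pose e' := e / (2 * K + 1).
have K10 : 0 < 2 * K + 1 by lra.
have e'0 : 0 < e' by rewrite divr_gt0.
have [n1 Hn1] := (Lp_cvgP _ _ _ PP0).1 cX e' e'0.
have [n2 Hn2] := (Lp_cvgP _ _ _ PP0).1 cY e' e'0.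
pose n := maxn n1 n2.
have [cXn cYn [K' HK']] := cond_exp_Lip_continuous PP0 (XY n).
have mXn := continuous_measurable_path cXn; have mYn := continuous_measurable_path cYn.
have iXn : integ P (X_ n) by apply: (@integ_bounded _ _ _ _ _ K') => // w; have [] := HK' w.
have iYn : integ P (Y_ n) by apply: (@integ_bounded _ _ _ _ _ K') => // w; have [] := HK' w.
have i1 := integ_norm (integB iXn iX); have i2 := integ_norm (integB iYn iY).
have E1 : Ex P (fun w => `|X_ n w - X w|) <= e'.
  by rewrite -lee_fin -integE//; apply: Hn1 => //; exact: leq_maxl.
have E2 : Ex P (fun w => `|Y_ n w - Y w|) <= e'.
  by rewrite -lee_fin -integE//; apply: Hn2 => //; exact: leq_maxr.
have E3 := cond_exp_Lip_le0 hPP PPP (XY n) xiL xi0.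
have i3 : integ P (fun w => xi w * (X_ n w - Y_ n w)).
  by apply: (integ_boundedM mxi HK); exact: integB.
have i12 : integ P (fun w => K * `|X_ n w - X w| + K * `|Y_ n w - Y w|).
  by apply: integD; exact: integZ.
have : Ex P (fun w => xi w * (X w - Y w)) <=
   Ex P (fun w => xi w * (X_ n w - Y_ n w) + (K * `|X_ n w - X w| + K * `|Y_ n w - Y w|)).
  apply: Ex_le; [by apply: (integ_boundedM mxi HK); exact: integB|exact: integD|].
  move=> w; have := HK w; rewrite ger0_norm// => h.
  rewrite (_ : xi w * (X w - Y w) = xi w * (X_ n w - Y_ n w) +
     (xi w * (X w - X_ n w) + xi w * (Y_ n w - Y w))); last ring.
  rewrite lerD2l lerD// (le_trans (ler_norm _))// normrM ger0_norm// ?ler_wpM2r//.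
  by rewrite distrC ler_wpM2r.
rewrite ExD// ExD; [|exact: integZ|exact: integZ].
rewrite !ExZ//.
have : K * Ex P (fun w => `|X_ n w - X w|) <= K * e' by rewrite ler_wpM2l.
have : K * Ex P (fun w => `|Y_ n w - Y w|) <= K * e' by rewrite ler_wpM2l.
have : 2 * K * e' <= e.
  rewrite /e' mulrCA -[leRHS]mulr1 ler_pM2l// ler_pdivrMr//; lra.
lra.
Qed.

End G_setting.

Section G_setting_instance.
Context {R : realType} {d : nat} {T : R}.
Local Notation Omega := (path_space (R := R) d T).
Context (G : 'M[R]_d -> R) (PP : set (probability Omega R)).
Hypotheses (hT : 0 < T) (hPP : represents_G_expectation G PP).
Context (M : R -> Omega -> R) (hM : symmetric_G_martingale PP M)
  (hM2 : forall t : R, 0 <= t <= T -> LG PP 2 t (M t))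
  (Lambda : R) (hLambda : 0 < Lambda) (hMvar : cond_variance_bound PP M Lambda)
  (Q : Omega -> cumulative R R) (hQ : quadratic_variation PP M Q).
Context (P : probability Omega R) (PPP : PP P).

Let Ad := limit_of_Lip P.

Lemma limit_of_Lip_cst t (a : R) : Ad t (fun=> a).
Proof.
split; first exact: measurable_cst.
by exists (fun _ _ => a); [move=> n; exact: Lip_cst|apply: aeW => w; exact: cvg_cst].
Qed.

Lemma limit_of_Lip_add t X Y : Ad t X -> Ad t Y -> Ad t (fun w => X w + Y w).
Proof.
move=> [mX [X_ X_L cX]] [mY [Y_ Y_L cY]]; split; first exact: measurable_funD.
exists (fun n w => X_ n w + Y_ n w); first by move=> n; exact: Lip_add.
by apply: filterS2 cX cY => w cX cY; exact: cvgD.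
Qed.

Lemma limit_of_Lip_mul t X Y : Ad t X -> Ad t Y -> Ad t (fun w => X w * Y w).
Proof.
move=> [mX [X_ X_L cX]] [mY [Y_ Y_L cY]]; split; first exact: measurable_funM.
exists (fun n w => X_ n w * Y_ n w); first by move=> n; exact: Lip_mul.
by apply: filterS2 cX cY => w cX cY; exact: cvgM.
Qed.

Lemma limit_of_Lip_comp t (F : R -> R) X : locally_lipschitz F -> Ad t X -> Ad t (fun w => F (X w)).
Proof.
move=> Fl [mX [X_ X_L cX]]; have cF := locally_lipschitz_continuous Fl; split.
  by apply: measurableT_comp => //; exact: continuous_measurable_fun.
exists (fun n w => F (X_ n w)).
  by move=> n; apply: Lip_comp => //; exact: locally_lipschitz_bounded.
by apply: filterS cX => w; apply: continuous_cvg; exact: cF.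
Qed.

Let LG_M t : 0 <= t <= T -> LG PP 1 t (M t). Proof. by case: hM => -[h _] _ _; exact: h. Qed.

Let iM t : 0 <= t <= T -> integ P (M t).
Proof. by move=> tT; apply: (LG_integ1 PPP); exact: LG_M. Qed.

Lemma bounded_Ad t xi K : Ad t xi -> (forall w, `|xi w| <= K) ->
  exists2 X_ : nat -> Omega -> R, (forall n, Lip t (X_ n) /\ forall w, `|X_ n w| <= K) &
    {ae P, forall w, X_ n w @[n --> \oo] --> xi w}.
Proof.
move=> [mX [X_ X_L cX]] xiK.
have K0 : 0 <= K by exact: le_trans (normr_ge0 _) (xiK point).
exists (fun n w => clamp K (X_ n w)).
  by move=> n; split; [exact: Lip_clamp|move=> w; exact: clamp_le].
apply: filterS cX => w cX; rewrite -[X in _ --> X](clamp_id (xiK w)).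
apply: continuous_cvg => //.
apply: locally_lipschitz_continuous; apply: (@lipschitz_locally _ _ 1) => x y.
by rewrite mul1r clamp_lip.
Qed.

(** M gives one inequality and -M the opposite one. *)
Lemma M_martingale_Lip s t xi : 0 <= s -> s <= t -> t <= T -> Lip s xi ->
  (forall w, 0 <= xi w) -> Ex P (fun w => xi w * (M t w - M s w)) = 0.
Proof.
move=> s0 st tT xiL xi0.
have [[_ h1] [_ h2] _] := hM.
apply/eqP; rewrite eq_le (cond_exp_le0 hPP PPP (h1 _ _ s0 st tT) xiL xi0) /=.
have := cond_exp_le0 hPP PPP (h2 _ _ s0 st tT) xiL xi0.
rewrite (@eq_Ex _ _ _ _ _ (fun w => - 1 * (xi w * (M t w - M s w)))); last first.
  by move=> w; ring.
rewrite ExZ ?mulN1r ?oppr_le0//.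
have [K HK] := Lip_bounded xiL.
apply: (integ_boundedM (Lip_measurable xiL) HK).
by apply: integB; apply: iM; apply/andP; split=> //; [exact: le_trans st|exact: le_trans tT].
Qed.

Lemma M_martingale_limit s t xi K : 0 <= s -> s <= t -> t <= T -> Ad s xi ->
  (forall w, `|xi w| <= K) -> Ex P (fun w => xi w * (M t w - M s w)) = 0.
Proof.
move=> s0 st tT Axi xiK.
have iD : integ P (fun w => M t w - M s w).
  by apply: integB; apply: iM; apply/andP; split=> //; [exact: le_trans st|exact: le_trans tT].
have K0 : 0 <= K by exact: le_trans (normr_ge0 _) (xiK point).
have [X_ X_L cX] := bounded_Ad Axi xiK.
have mX n : measurable_fun setT (X_ n) by exact: Lip_measurable (X_L n).1.
have H n : Ex P (fun w => X_ n w * (M t w - M s w)) = 0.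
  have i1 : integ P (fun w => X_ n w * (M t w - M s w)).
    by apply: (integ_boundedM (mX n) (X_L n).2).
  (* The sign condition is removed by writing a variable bounded by K as the difference of the
     nonnegative [X_ n + K] and K. *)
  have := @M_martingale_Lip s t (fun w => X_ n w + K) s0 st tT.
  have := @M_martingale_Lip s t (fun=> K) s0 st tT (Lip_cst _ _) (fun=> K0).
  rewrite ExZ// => KE.
  rewrite (@eq_Ex _ _ _ _ _ (fun w => X_ n w * (M t w - M s w) + K * (M t w - M s w))); last first.
    by move=> w; ring.
  rewrite ExD ?ExZ//; last exact: integZ.
  rewrite KE addr0; apply; first by apply: Lip_add; [exact: (X_L n).1|exact: Lip_cst].
  by move=> w; have := (X_L n).2 w; rewrite ler_norml => /andP[h _]; rewrite -lerBlDr sub0r.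
have [_ cE] : integ P (fun w => xi w * (M t w - M s w)) /\
    Ex P (fun w => X_ n w * (M t w - M s w)) @[n --> \oo] -->
    Ex P (fun w => xi w * (M t w - M s w)).
  apply: (@dominated_Ex _ _ _ P _ _ (fun w => K * `|M t w - M s w|)).
  - by move=> n; apply: measurable_funM => //; exact: integ_measurable iD.
  - by apply: measurable_funM; [exact: Axi.1|exact: integ_measurable iD].
  - by apply: filterS cX => w cX; apply: cvgM => //; exact: cvg_cst.
  - by move=> n w; rewrite normrM ler_wpM2r//; exact: (X_L n).2.
  - by apply: integZ; exact: integ_norm.
move: cE; rewrite (eq_cvg _ _ H) => cE.
by apply: (cvg_unique _ cE) => //; exact: cvg_cst.
Qed.

Lemma integ_sq_increment s t : 0 <= s <= T -> 0 <= t <= T ->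
  integ P (fun w => (M t w - M s w) ^+ 2).
Proof.
move=> sT tT; have i1 := LG_integ2 PPP (hM2 sT); have i2 := LG_integ2 PPP (hM2 tT).
have m1 := integ_measurable (iM sT); have m2 := integ_measurable (iM tT).
apply: (@eq_integ _ _ _ _ (fun w => (M t w ^+ 2 + M s w ^+ 2) - 2 * (M t w * M s w))).
  by move=> w; ring.
apply: integB; first exact: integD.
by apply: integZ; apply: integ_sqrM.
Qed.

Lemma M_variance_Lip s t xi : 0 <= s -> s <= t -> t <= T -> Lip s xi ->
  (forall w, 0 <= xi w) ->
  Ex P (fun w => xi w * (M t w - M s w) ^+ 2) <= Lambda * (t - s) * Ex P xi.
Proof.
move=> s0 st tT xiL xi0.
have sT : 0 <= s <= T by rewrite s0 (le_trans st).
have tT' : 0 <= t <= T by rewrite (le_trans s0).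
have ts0 : 0 <= t - s by rewrite subr_ge0.
have := hMvar s0 ts0; rewrite [s + _]addrC subrK => /(_ tT)[Y cXY [A [mA A0 AY]]].
have [K HK] := Lip_bounded xiL; have mxi := Lip_measurable xiL.
have iY : integ P Y by case: cXY => _ /(LG_integ1 PPP).
have iX := integ_sq_increment sT tT'.
have := cond_exp_le0 hPP PPP cXY xiL xi0.
rewrite (@eq_Ex _ _ _ _ _ (fun w => xi w * (M t w - M s w) ^+ 2 - xi w * Y w)); last first.
  by move=> w; rewrite real_normK ?num_real//; ring.
have ixX := integ_boundedM mxi HK iX; have ixY := integ_boundedM mxi HK iY.
have ixi : integ P xi by exact: integ_bounded HK.
rewrite ExB// subr_le0 => /le_trans; apply.
rewrite -ExZ//; apply: Ex_le_ae => //; first exact: integZ.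
apply: (@null_ae _ _ _ _ A) => //.
  by apply/eqP; rewrite eq_le measure_ge0 andbT -A0; apply: ereal_sup_ubound; exists P.
by move=> w /AY /= h; rewrite mulrC ler_wpM2r.
Qed.

Lemma M_variance_limit s t xi K : 0 <= s -> s <= t -> t <= T -> Ad s xi ->
  (forall w, 0 <= xi w <= K) ->
  Ex P (fun w => xi w * (M t w - M s w) ^+ 2) <= Lambda * (t - s) * Ex P xi.
Proof.
move=> s0 st tT Axi xiK.
have sT : 0 <= s <= T by rewrite s0 (le_trans st).
have tT' : 0 <= t <= T by rewrite (le_trans s0).
have iD := integ_sq_increment sT tT'.
have xiK' w : `|xi w| <= K by have /andP[h1 h2] := xiK w; rewrite ger0_norm.
have [X_ X_L cX] := bounded_Ad Axi xiK'.
(* Positive parts keep the approximations admissible for the variance bound; they converge to the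
   same limit, which is nonnegative. *)
pose Y n w := Num.max 0 (X_ n w).
have YL n : Lip s (Y n).
  apply: (@Lip_comp _ _ _ _ (Num.max 0)) (X_L n).1.
    move=> A; exists A => a aA; case: (leP 0 a) => // _; rewrite normr0.
    exact: le_trans (normr_ge0 a) aA.
  by move=> A; exists 1 => a a' _ _; rewrite mul1r max_lip.
have mY n : measurable_fun setT (Y n) by exact: Lip_measurable (YL n).
have YK n w : `|Y n w| <= K.
  have := (X_L n).2 w; rewrite /Y; case: (leP 0 (X_ n w)) => // _ _; rewrite normr0.
  exact: le_trans (normr_ge0 _) (xiK' w).
have cY : {ae P, forall w, Y n w @[n --> \oo] --> xi w}.
  apply: filterS cX => w cX; have /andP[h _] := xiK w.
  rewrite -[X in _ --> X](max_r h); apply: (continuous_cvg _ _ cX).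
  apply: locally_lipschitz_continuous; apply: (@lipschitz_locally _ _ 1) => x y.
  by rewrite mul1r max_lip.
have mxi := Axi.1.
have [i1 c1] := @dominated_Ex _ _ _ P Y xi (fun=> K) mY mxi cY YK (integ_cst _ _).
have [i2 c2] : integ P (fun w => xi w * (M t w - M s w) ^+ 2) /\
    Ex P (fun w => Y n w * (M t w - M s w) ^+ 2) @[n --> \oo] -->
    Ex P (fun w => xi w * (M t w - M s w) ^+ 2).
  apply: (@dominated_Ex _ _ _ P _ _ (fun w => K * (M t w - M s w) ^+ 2)).
  - by move=> n; apply: measurable_funM => //; exact: integ_measurable iD.
  - by apply: measurable_funM => //; exact: integ_measurable iD.
  - by apply: filterS cY => w cY'; apply: cvgM => //; exact: cvg_cst.
  - by move=> n w; rewrite normrM [X in _ * X]ger0_norm ?sqr_ge0// ler_wpM2r ?sqr_ge0.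
  - exact: integZ.
have c3 : Lambda * (t - s) * Ex P (Y n) @[n --> \oo] --> Lambda * (t - s) * Ex P xi.
  exact: cvgMr.
apply: (ler_cvg_to c2 c3).
near=> n; apply: M_variance_Lip => // w.
by rewrite /Y le_max lexx.
Unshelve. all: end_near. Qed.

Lemma G_martingale_setting : martingale_setting P T Lambda Ad M Q.
Proof.
have [Q0 Qc Qm Qv] := hQ; have [_ _ Mc] := hM.
split => //.
- exact: ltW.
- by move=> t X [].
- move=> s t X st [mX [X_ X_L cX]]; split => //; exists X_ => // n.
  exact: Lip_le (X_L n).
- exact: limit_of_Lip_cst.
- exact: limit_of_Lip_add.
- exact: limit_of_Lip_mul.
- exact: limit_of_Lip_comp.
- by move=> t tT; apply: (LG_limit_of_Lip PPP _ (hM2 tT)).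
- by move=> t tT; exact: LG_integ2 PPP (hM2 tT).
- exact: M_martingale_limit.
- exact: M_variance_limit.
- move=> t e tT e0; have [delta d0 H] := Qv t tT e e0.
  exists delta => // N tau t0 tN tj; apply/ltW; apply: le_lt_trans (H N tau t0 tN tj).
  exact: (le_upE _ PPP).
Qed.

End G_setting_instance.

(** * Moments of increments under one probability *)

Section martingale_moments.
Context d (Om : measurableType d) (R : realType) (P : probability Om R) (T Lam : R).
Context (Ad : R -> (Om -> R) -> Prop) (M : R -> Om -> R) (Q : Om -> cumulative R R).
Hypothesis ms : martingale_setting P T Lam Ad M Q.
Implicit Types (s t u : R) (xi : Om -> R).

Let T0 : 0 < T := ms_T ms.

Lemma clamp_locally_lipschitz K : locally_lipschitz (@clamp R K).
Proof. by apply: (@lipschitz_locally _ _ 1) => x y; rewrite mul1r clamp_lip. Qed.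

Lemma clamp_cvg (x : R) : clamp n%:R x @[n --> \oo] --> x.
Proof.
apply: cvg_near_cst; near=> n; apply: clamp_id; apply: ltW; near: n.
exact: nbhs_infty_gtr.
Unshelve. all: end_near. Qed.

Lemma sqr_locally_lipschitz : locally_lipschitz (fun x : R => x ^+ 2).
Proof.
move=> A; exists (A + A) => a b aA bA.
rewrite subr_sqr normrM mulrC ler_wpM2r// (le_trans (ler_normD _ _))// lerD//.
Qed.

Lemma norm_locally_lipschitz : locally_lipschitz (fun x : R => `|x|).
Proof. by move=> A; exists 1 => a b _ _; rewrite mul1r ler_dist_dist. Qed.

Lemma Ad_scale t (k : R) xi : Ad t xi -> Ad t (fun w => k * xi w).
Proof. by move=> h; apply: (Ad_mul ms) => //; exact: Ad_cst ms _ _. Qed.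

Lemma Ad_opp t xi : Ad t xi -> Ad t (fun w => - xi w).
Proof.
move=> h; rewrite (_ : (fun w => - xi w) = (fun w => - 1 * xi w)); first exact: Ad_scale.
by apply/funext => w; rewrite mulN1r.
Qed.

Lemma Ad_sub t xi xi' : Ad t xi -> Ad t xi' -> Ad t (fun w => xi w - xi' w).
Proof. by move=> h h'; apply: (Ad_add ms) => //; exact: Ad_opp. Qed.

Lemma Ad_Mle s t : 0 <= s -> s <= t -> t <= T -> Ad t (M s).
Proof. by move=> s0 st tT; apply: (Ad_le ms st); apply: (Ad_M ms); rewrite s0 (le_trans st). Qed.

Lemma Ad_increment s t u : 0 <= s -> s <= t -> t <= u -> u <= T -> Ad u (fun w => M t w - M s w).
Proof. by move=> s0 st tu uT; apply: Ad_sub; apply: Ad_Mle => //; lra. Qed.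

Lemma M_measurable t : 0 <= t <= T -> measurable_fun setT (M t).
Proof. by move=> tT; exact: (Ad_measurable ms (Ad_M ms tT)). Qed.

Lemma integ_M t : 0 <= t <= T -> integ P (M t).
Proof. by move=> tT; apply: integ_sqr; [exact: M_measurable|exact: (M_sq ms tT)]. Qed.

Lemma integ_increment2 s t : 0 <= s <= T -> 0 <= t <= T ->
  integ P (fun w => (M t w - M s w) ^+ 2).
Proof.
move=> sT tT; have i1 := M_sq ms sT; have i2 := M_sq ms tT.
have m1 := M_measurable sT; have m2 := M_measurable tT.
apply: (@eq_integ _ _ _ _ (fun w => (M t w ^+ 2 + M s w ^+ 2) - 2 * (M t w * M s w))).
  by move=> w; ring.
apply: integB; first exact: integD.
by apply: integZ; apply: integ_sqrM.
Qed.

(** Truncation of xi and dominated convergence, with the product itself as majorant: this is why its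
    integrability is the only moment condition. *)
Lemma Ex_martingale s t xi : 0 <= s -> s <= t -> t <= T -> Ad s xi ->
  integ P (fun w => xi w * (M t w - M s w)) -> Ex P (fun w => xi w * (M t w - M s w)) = 0.
Proof.
move=> s0 st tT Axi iD.
have H n : Ex P (fun w => clamp n%:R (xi w) * (M t w - M s w)) = 0.
  apply: (@M_martingale _ _ _ _ _ _ _ _ _ ms _ _ _ n%:R) => //.
    by apply: (Ad_comp ms) => //; exact: clamp_locally_lipschitz.
  by move=> w; exact: clamp_le.
have mD : measurable_fun setT (fun w => M t w - M s w).
  by apply: measurable_funB; apply: M_measurable; lra.
have [_ cE] : integ P (fun w => xi w * (M t w - M s w)) /\
    Ex P (fun w => clamp n%:R (xi w) * (M t w - M s w)) @[n --> \oo] -->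
    Ex P (fun w => xi w * (M t w - M s w)).
  apply: (@dominated_Ex _ _ _ P _ _ (fun w => `|xi w * (M t w - M s w)|)).
  - move=> n; apply: measurable_funM => //; apply: (Ad_measurable ms (t := s)).
    by apply: (Ad_comp ms) => //; exact: clamp_locally_lipschitz.
  - exact: integ_measurable iD.
  - by apply: aeW => w; apply: cvgM; [exact: clamp_cvg|exact: cvg_cst].
  - by move=> n w; rewrite !normrM ler_wpM2r//; exact: clamp_norm.
  - exact: integ_norm.
move: cE; rewrite (eq_cvg _ _ H) => cE.
by apply: (cvg_unique _ cE) => //; exact: cvg_cst.
Qed.

(** Fatou's lemma along the truncations of xi yields the integrability of the product together with
    the bound. *)
Lemma Ex_variance s t xi : 0 <= s -> s <= t -> t <= T -> Ad s xi ->
  (forall w, 0 <= xi w) -> integ P xi ->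
  integ P (fun w => xi w * (M t w - M s w) ^+ 2) /\
  Ex P (fun w => xi w * (M t w - M s w) ^+ 2) <= Lam * (t - s) * Ex P xi.
Proof.
move=> s0 st tT Axi xi0 ixi.
have iD : integ P (fun w => (M t w - M s w) ^+ 2) by apply: integ_increment2; lra.
have mD := integ_measurable iD; have mxi := integ_measurable ixi.
have Acl n : Ad s (fun w => clamp n%:R (xi w)).
  by apply: (Ad_comp ms) => //; exact: clamp_locally_lipschitz.
have cl0 n w : 0 <= clamp n%:R (xi w).
  by rewrite /clamp le_max le_min ler0n xi0/= orbT.
have icl n : integ P (fun w => clamp n%:R (xi w)).
  by apply: (@integ_bounded _ _ _ _ _ n%:R); [exact: Ad_measurable ms _ _ (Acl n)|move=> w; exact: clamp_le].
apply: integ_fin.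
- exact: measurable_funM.
- by move=> w; rewrite mulr_ge0 ?sqr_ge0.
apply: (@fatou_le _ _ _ P setT (fun n w => clamp n%:R (xi w) * (M t w - M s w) ^+ 2)) => //.
- by move=> n; apply: measurable_funM => //; exact: Ad_measurable ms _ _ (Acl n).
- by move=> n w _; rewrite mulr_ge0 ?sqr_ge0.
- by move=> w _; apply: cvgM; [exact: clamp_cvg|exact: cvg_cst].
move=> e e0; exists 0%N => n _.
rewrite integE; last first.
  apply: (@integ_boundedM _ _ _ _ _ _ n%:R) => //; first exact: Ad_measurable ms _ _ (Acl n).
  by move=> w; exact: clamp_le.
rewrite lee_fin (@le_trans _ _ (Lam * (t - s) * Ex P (fun w => clamp n%:R (xi w))))//.
  apply: (@M_variance _ _ _ _ _ _ _ _ _ ms _ _ _ n%:R) => // w.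
  by rewrite cl0/= (le_trans (ler_norm _))// clamp_le.
rewrite (@le_trans _ _ (Lam * (t - s) * Ex P xi))//; last lra.
rewrite ler_wpM2l ?mulr_ge0 ?(ms_Lam ms) ?subr_ge0//; apply: Ex_le => // w.
by rewrite (le_trans (ler_norm _))// (le_trans (clamp_norm _ _))// ger0_norm.
Qed.

Lemma integ_variance s t xi : 0 <= s -> s <= t -> t <= T -> Ad s xi -> integ P xi ->
  integ P (fun w => xi w * (M t w - M s w) ^+ 2).
Proof.
move=> s0 st tT Axi ixi.
have An : Ad s (fun w => `|xi w|).
  by apply: (Ad_comp ms) => //; exact: norm_locally_lipschitz.
have [i _] := Ex_variance s0 st tT An (fun w => normr_ge0 (xi w)) (integ_norm ixi).
apply: integ_le i; last by move=> w; rewrite !normrM normr_id.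
apply: measurable_funM; first exact: integ_measurable ixi.
by apply: measurable_funX; apply: measurable_funB; apply: M_measurable; lra.
Qed.

(** Orthogonality of martingale increments: the cross term, integrable because the two squares
    dominate it, has expectation 0. *)
Lemma Ex_variance_split s u t xi : 0 <= s -> s <= u -> u <= t -> t <= T -> Ad s xi -> integ P xi ->
  Ex P (fun w => xi w * (M t w - M s w) ^+ 2) =
  Ex P (fun w => xi w * (M u w - M s w) ^+ 2) + Ex P (fun w => xi w * (M t w - M u w) ^+ 2).
Proof.
move=> s0 su ut tT Axi ixi.
have u0 := le_trans s0 su; have uT := le_trans ut tT.
have Axiu : Ad u xi by exact: Ad_le ms _ _ _ su Axi.
have i1 := integ_variance s0 su uT Axi ixi.
have i2 := integ_variance u0 ut tT Axiu ixi.
have i3 : integ P (fun w => xi w * (M u w - M s w) * (M t w - M u w)).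
  apply: (@integ_le _ _ _ _ _ (fun w => `|xi w * (M u w - M s w) ^+ 2| + `|xi w * (M t w - M u w) ^+ 2|)).
  - by apply: measurable_funM; [apply: measurable_funM; [exact: integ_measurable ixi|]|];
      apply: measurable_funB; apply: M_measurable; lra.
  - move=> w; rewrite [leRHS]ger0_norm ?addr_ge0// -mulrA !(normrM (xi w)) -mulrDr ler_wpM2l//.
    rewrite !(ger0_norm (sqr_ge0 _)) ler_norml.
    have := sqr_ge0 (M u w - M s w - (M t w - M u w)).
    have := sqr_ge0 (M u w - M s w + (M t w - M u w)).
    move: (M u w - M s w) (M t w - M u w) => x y h1 h2.
    by have := sqr_ge0 x; have := sqr_ge0 y; move=> *; apply/andP; split; nra.
  - by apply: integD; exact: integ_norm.
have E3 : Ex P (fun w => xi w * (M u w - M s w) * (M t w - M u w)) = 0.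
  apply: Ex_martingale => //; apply: (Ad_mul ms) => //; exact: Ad_increment.
rewrite -ExD// -[RHS]addr0 -(mulr0 2) -E3 -ExZ// -ExD//; last exact: integZ.
- by apply: eq_Ex => w; ring.
- exact: integD.
Qed.

Definition grid a b (n : nat) (k : nat) : R := a + k%:R * ((b - a) / n%:R).

Lemma grid0 a b n : grid a b n 0 = a. Proof. by rewrite /grid mul0r addr0. Qed.

Lemma gridn a b n : (0 < n)%N -> grid a b n n = b.
Proof.
move=> n0; rewrite /grid; field.
by rewrite pnatr_eq0 -lt0n.
Qed.

Lemma gridS a b n k : grid a b n k.+1 = grid a b n k + (b - a) / n%:R.
Proof. by rewrite /grid -natr1; ring. Qed.

Lemma grid_le a b n i j : a <= b -> (i <= j)%N -> grid a b n i <= grid a b n j.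
Proof.
move=> ab ij; rewrite /grid lerD2l ler_wpM2r ?ler_nat//.
by rewrite divr_ge0// subr_ge0.
Qed.

Lemma grid_itv a b n k : a <= b -> (k <= n)%N -> (0 < n)%N -> a <= grid a b n k <= b.
Proof.
move=> ab kn n0; apply/andP; split.
  by rewrite -[leLHS](grid0 a b n) grid_le.
by rewrite -[leRHS](gridn a b n0) grid_le.
Qed.

Definition sq_variation s t n (w : Om) : R :=
  \sum_(k < n) (M (grid s t n k.+1) w - M (grid s t n k) w) ^+ 2.

Lemma Ex_variance_grid s t xi n : 0 <= s -> s <= t -> t <= T -> (0 < n)%N ->
  Ad s xi -> integ P xi ->
  integ P (fun w => xi w * sq_variation s t n w) /\
  Ex P (fun w => xi w * (M t w - M s w) ^+ 2) = Ex P (fun w => xi w * sq_variation s t n w).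
Proof.
move=> s0 st tT n0 Axi ixi.
have gI k : (k <= n)%N -> s <= grid s t n k <= t by move=> kn; exact: grid_itv.
have iI k : (k < n)%N ->
    integ P (fun w => xi w * (M (grid s t n k.+1) w - M (grid s t n k) w) ^+ 2).
  move=> kn; have /andP[h1 h2] := gI k (ltnW kn); have /andP[h3 h4] := gI k.+1 kn.
  apply: integ_variance => //; [lra|exact: grid_le|lra|].
  exact: Ad_le ms _ _ _ h1 Axi.
suff H k : (k <= n)%N ->
    integ P (fun w => \sum_(j < k) xi w * (M (grid s t n j.+1) w - M (grid s t n j) w) ^+ 2) /\
    Ex P (fun w => xi w * (M (grid s t n k) w - M s w) ^+ 2) =
    Ex P (fun w => \sum_(j < k) xi w * (M (grid s t n j.+1) w - M (grid s t n j) w) ^+ 2).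
  have [h1 h2] := H n (leqnn _); rewrite gridn// in h2; split.
    by apply: eq_integ h1 => w; rewrite -mulr_sumr.
  by rewrite h2; apply: eq_Ex => w; rewrite -mulr_sumr.
elim: k => [_|k IH kn].
  split; first by apply: (@eq_integ _ _ _ _ (fun=> 0)); [move=> w; rewrite big_ord0|exact: integ_cst].
  by apply: eq_Ex => w; rewrite big_ord0 grid0 subrr expr0n mulr0.
have [h1 h2] := IH (ltnW kn).
have /andP[g1 g2] := gI k (ltnW kn); have /andP[g3 g4] := gI k.+1 kn.
split.
  by apply: (eq_integ _ (integD h1 (iI k kn))) => w; rewrite big_ord_recr.
rewrite (@Ex_variance_split s (grid s t n k)) ?h2//; [|exact: grid_le|lra].
by rewrite -ExD//; [apply: eq_Ex => w; rewrite big_ord_recr|exact: iI].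
Qed.

Lemma sq_variation_measurable s t n : 0 <= s -> s <= t -> t <= T -> (0 < n)%N ->
  measurable_fun setT (sq_variation s t n).
Proof.
move=> s0 st tT n0; apply: measurable_sum => k; apply: measurable_funX.
have /andP[h1 h2] := grid_itv st (ltnW (ltn_ord k)) n0.
have /andP[h3 h4] := grid_itv st (ltn_ord k) n0.
by apply: measurable_funB; apply: M_measurable; lra.
Qed.

(* the subdivision of [0, t] refining both {0, s, t} with mesh going to 0 *)
Let two_grids s t n k := if (k <= n)%N then grid 0 s n k else grid s t n (k - n).

(** The hypothesis on Q concerns subdivisions that start at 0. The sum over [s, t] is the difference
    between the sum along a subdivision of [0, t] through s and its part on [0, s]; each is within
    e/2 of its limit in L1. *)
Lemma sq_variation_cvg s t e : 0 <= s -> s <= t -> t <= T -> 0 < e ->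
  exists n0, forall n, (n0 <= n)%N -> (0 < n)%N ->
    integ P (fun w => `|sq_variation s t n w - (Q w t - Q w s)|) /\
    Ex P (fun w => `|sq_variation s t n w - (Q w t - Q w s)|) <= e.
Proof.
move=> s0 st tT e0.
have sT : 0 <= s <= T by lra. have tT' : 0 <= t <= T by lra.
have e20 : 0 < e / 2 by lra.
have [d1 d10 H1] := Q_variation ms sT e20.
have [d2 d20 H2] := Q_variation ms tT' e20.
pose dd := Num.min d1 d2; have dd0 : 0 < dd by rewrite lt_min d10.
have [n0 Hn0] : exists n0 : nat, T / dd < n0%:R.
  by exists (Num.truncn (T / dd)).+1; rewrite truncnS_gt.
exists n0 => n n0n n0'.
have nR : 0 < n%:R :> R by rewrite ltr0n.
have mesh a b : 0 <= a -> a <= b -> b <= T -> 0 <= (b - a) / n%:R < dd.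
  move=> a0 ab bT; rewrite divr_ge0 ?subr_ge0//=.
  rewrite ltr_pdivrMr// mulrC -ltr_pdivrMr//.
  apply: (@le_lt_trans _ _ (T / dd)); first by rewrite ler_pM2r ?invr_gt0//; lra.
  by rewrite (lt_le_trans Hn0)// ler_nat.
have {}H1 : (\int[P]_w (`|sq_variation 0 s n w - Q w s|)%:E <= (e / 2)%:E)%E.
  apply: (H1 n (grid 0 s n)); rewrite ?grid0 ?gridn// => j jn.
  rewrite gridS addrAC subrr add0r.
  by have /andP[-> h]/= := mesh 0 s (lexx _) s0 (le_trans st tT); rewrite (lt_le_trans h)// ge_min lexx.
pose tau := two_grids s t n.
have tau_lo k : (k <= n)%N -> tau k = grid 0 s n k by rewrite /tau /two_grids => ->.
have tau_hi k : tau (n + k)%N = grid s t n k.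
  rewrite /tau /two_grids; case: k => [|k]; first by rewrite addn0 leqnn gridn// grid0.
  by rewrite addnS ltnNge leq_addr/= -addnS addKn.
have tau2 w : \sum_(j < n + n) (M (tau j.+1) w - M (tau j) w) ^+ 2 =
    sq_variation 0 s n w + sq_variation s t n w.
  rewrite big_split_ord/=; congr (_ + _); apply: eq_bigr => j _ /=.
    by rewrite !tau_lo// ltnW.
  by rewrite -addnS !tau_hi.
have {}H2 : (\int[P]_w (`|sq_variation 0 s n w + sq_variation s t n w - Q w t|)%:E <= (e / 2)%:E)%E.
  under eq_integral do rewrite -tau2.
  apply: H2; first by rewrite tau_lo// grid0.
    by rewrite tau_hi gridn.
  move=> j jn; case: (ltnP j n) => h.
    rewrite !tau_lo//; last exact: ltnW.
    rewrite gridS addrAC subrr add0r.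
    have /andP[-> h']/= := mesh 0 s (lexx _) s0 (le_trans st tT).
    by rewrite (lt_le_trans h')// ge_min lexx orbT.
  rewrite -(subnKC h) -addnS !tau_hi gridS addrAC subrr add0r.
  have /andP[-> h']/= := mesh s t s0 st tT.
  by rewrite (lt_le_trans h')// ge_min lexx orbT.
have mV1 := sq_variation_measurable (lexx 0) s0 (le_trans st tT) n0'.
have mV2 := sq_variation_measurable s0 st tT n0'.
have mQs := Q_measurable ms sT; have mQt := Q_measurable ms tT'.
have [i1 E1] := integ_fin (measurableT_comp (@normr_measurable _ setT) (measurable_funB mV1 mQs))
  (fun w => normr_ge0 _) H1.
have [i2 E2] := integ_fin (measurableT_comp (@normr_measurable _ setT)
  (measurable_funB (measurable_funD mV1 mV2) mQt)) (fun w => normr_ge0 _) H2.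
have le12 w : `|sq_variation s t n w - (Q w t - Q w s)| <=
   `|sq_variation 0 s n w - Q w s| + `|sq_variation 0 s n w + sq_variation s t n w - Q w t|.
  rewrite [leRHS]addrC [X in `|X| <= _](_ : _ = (sq_variation 0 s n w + sq_variation s t n w - Q w t) -
    (sq_variation 0 s n w - Q w s)); last ring.
  exact: ler_normB.
have i3 : integ P (fun w => `|sq_variation s t n w - (Q w t - Q w s)|).
  apply: (integ_le _ _ (integD i1 i2)).
    by apply: measurableT_comp => //; apply: measurable_funB => //; exact: measurable_funB.
  by move=> w; rewrite normr_id (le_trans (le12 w))// ler_norm.
split => //; apply: (le_trans (Ex_le i3 (integD i1 i2) le12)).
by rewrite ExD//; move: E1 E2 => /=; lra.
Qed.

Lemma Q_le s t w : s <= t -> Q w s <= Q w t.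
Proof. exact: cumulative_is_nondecreasing. Qed.

Lemma integ_Q s t : 0 <= s -> s <= t -> t <= T -> integ P (fun w => Q w t - Q w s).
Proof.
move=> s0 st tT; have [n0 H] := sq_variation_cvg s0 st tT ltr01.
have [i1 _] := H n0.+1 (leqnSn _) isT.
have i2 : integ P (sq_variation s t n0.+1).
  have := (Ex_variance_grid s0 st tT (ltn0Sn n0) (Ad_cst ms s 1) (integ_cst P 1)).1.
  by apply: eq_integ => w; rewrite mul1r.
apply: (integ_le _ _ (integD i1 (integ_norm i2))).
  by apply: measurable_funB; apply: (Q_measurable ms); lra.
move=> w; rewrite [leRHS]ger0_norm ?addr_ge0// -{1}(subKr (sq_variation s t n0.+1 w) (Q w t - Q w s)).
by rewrite [leRHS]addrC ler_normB.
Qed.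

(** By orthogonality, the squared increment may be replaced by the sum of squares along any grid
    without changing the left side; along finer grids these sums tend to the increment of Q in
    L1. *)
Lemma Ex_Q_bounded s t xi K : 0 <= s -> s <= t -> t <= T -> Ad s xi -> (forall w, `|xi w| <= K) ->
  Ex P (fun w => xi w * (M t w - M s w) ^+ 2) = Ex P (fun w => xi w * (Q w t - Q w s)).
Proof.
move=> s0 st tT Axi xiK; have mxi := Ad_measurable ms Axi.
have ixi := integ_bounded P mxi xiK.
have iQ := integ_boundedM mxi xiK (integ_Q s0 st tT).
apply/eqP; rewrite -subr_eq0 -normr_eq0 eq_le normr_ge0 andbT.
apply/ler_addgt0Pr => e e0; rewrite add0r.
pose e' := e / (`|K| + 1); have K0 : 0 < `|K| + 1 by rewrite ltr_pwDr.
have e'0 : 0 < e' by rewrite divr_gt0.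
have [n0 H] := sq_variation_cvg s0 st tT e'0.
have [i1 E1] := H n0.+1 (leqnSn _) isT.
have [i2 ->] := Ex_variance_grid s0 st tT (ltn0Sn n0) Axi ixi.
rewrite -ExB//; apply: (le_trans (Ex_norm_le (integB i2 iQ))).
apply: (@le_trans _ _ (Ex P (fun w => (`|K| + 1) * `|sq_variation s t n0.+1 w - (Q w t - Q w s)|))).
  apply: Ex_le; [exact: integ_norm (integB i2 iQ)|exact: integZ|].
  move=> w; rewrite -mulrBr normrM ler_wpM2r// (le_trans (xiK w))//.
  by rewrite (le_trans (ler_norm _))// lerDl.
rewrite ExZ//; apply: (@le_trans _ _ ((`|K| + 1) * e')); first by rewrite ler_wpM2l// ltW.
by rewrite mulrC divfK// gt_eqF.
Qed.

(** Extension from bounded to integrable xi, and the source of the isometry. Integrability against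
    the increment of Q comes first, for |xi|, from the variance bound and Fatou's lemma; it then
    dominates the truncations. *)
Lemma Ex_Q s t xi : 0 <= s -> s <= t -> t <= T -> Ad s xi -> integ P xi ->
  integ P (fun w => xi w * (Q w t - Q w s)) /\
  Ex P (fun w => xi w * (M t w - M s w) ^+ 2) = Ex P (fun w => xi w * (Q w t - Q w s)).
Proof.
move=> s0 st tT.
have mQ : measurable_fun setT (fun w => Q w t - Q w s).
  by apply: measurable_funB; apply: (Q_measurable ms); lra.
have Q0 w : 0 <= Q w t - Q w s by rewrite subr_ge0 Q_le.
have Acl x n : Ad s x -> Ad s (fun w => clamp n%:R (x w)).
  by move=> Ax; apply: (Ad_comp ms) => //; exact: clamp_locally_lipschitz.
have Ecl x n (Ax : Ad s x) := Ex_Q_bounded s0 st tT (Acl x n Ax) (fun w => clamp_le (x w) (ler0n R n)).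
have pos x : Ad s x -> integ P x -> (forall w, 0 <= x w) -> integ P (fun w => x w * (Q w t - Q w s)).
  move=> Ax ix x0.
  have [iV EV] := Ex_variance s0 st tT Ax x0 ix.
  have cl0 n w : 0 <= clamp n%:R (x w) by rewrite /clamp le_max le_min ler0n x0/= orbT.
  have mcl n := Ad_measurable ms (Acl x n Ax).
  apply: (proj1 (@integ_fin _ _ _ P _ (Ex P (fun w => x w * (M t w - M s w) ^+ 2)) _ _ _)).
  - by apply: measurable_funM => //; exact: Ad_measurable ms _ _ Ax.
  - by move=> w; rewrite mulr_ge0.
  apply: (@fatou_le _ _ _ P setT (fun n w => clamp n%:R (x w) * (Q w t - Q w s))) => //.
  - by move=> n; exact: measurable_funM.
  - by move=> n w _; rewrite mulr_ge0.
  - by move=> w _; apply: cvgM; [exact: clamp_cvg|exact: cvg_cst].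
  move=> e e0; exists 0%N => n _.
  rewrite integE; last first.
    apply: (@integ_boundedM _ _ _ _ _ _ n%:R) => //; last exact: integ_Q.
    by move=> w; exact: clamp_le.
  rewrite -Ecl// lee_fin (@le_trans _ _ (Ex P (fun w => x w * (M t w - M s w) ^+ 2)))//; last lra.
  apply: Ex_le => //.
    apply: (@integ_boundedM _ _ _ _ _ _ n%:R) => //; first by move=> w; exact: clamp_le.
    by apply: integ_increment2; lra.
  move=> w; rewrite ler_wpM2r ?sqr_ge0// (le_trans (ler_norm _))//.
  by rewrite (le_trans (clamp_norm _ _))// ger0_norm.
move=> Axi ixi.
have mxi := Ad_measurable ms Axi.
have An : Ad s (fun w => `|xi w|).
  by apply: (Ad_comp ms) => //; exact: norm_locally_lipschitz.
have iQn := pos _ An (integ_norm ixi) (fun w => normr_ge0 _).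
have iVn := integ_variance s0 st tT An (integ_norm ixi).
have iQ : integ P (fun w => xi w * (Q w t - Q w s)).
  apply: integ_le iQn; first exact: measurable_funM.
  by move=> w; rewrite !normrM normr_id.
split => //.
have mM : measurable_fun setT (fun w => (M t w - M s w) ^+ 2).
  by apply: measurable_funX; apply: measurable_funB; apply: M_measurable; lra.
have [_ c1] : integ P (fun w => xi w * (M t w - M s w) ^+ 2) /\
    Ex P (fun w => clamp n%:R (xi w) * (M t w - M s w) ^+ 2) @[n --> \oo] -->
    Ex P (fun w => xi w * (M t w - M s w) ^+ 2).
  apply: (dominated_Ex _ _ _ _ iVn).
  - by move=> n; apply: measurable_funM => //; exact: Ad_measurable ms _ _ (Acl xi n Axi).
  - exact: measurable_funM.
  - by apply: aeW => w; apply: cvgM; [exact: clamp_cvg|exact: cvg_cst].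
  - by move=> n w; rewrite normrM [X in _ * X]ger0_norm ?sqr_ge0// ler_wpM2r ?sqr_ge0// clamp_norm.
have [_ c2] : integ P (fun w => xi w * (Q w t - Q w s)) /\
    Ex P (fun w => clamp n%:R (xi w) * (Q w t - Q w s)) @[n --> \oo] -->
    Ex P (fun w => xi w * (Q w t - Q w s)).
  apply: (dominated_Ex _ _ _ _ iQn).
  - by move=> n; apply: measurable_funM => //; exact: Ad_measurable ms _ _ (Acl xi n Axi).
  - exact: measurable_funM.
  - by apply: aeW => w; apply: cvgM; [exact: clamp_cvg|exact: cvg_cst].
  - by move=> n w; rewrite normrM [X in _ * X]ger0_norm// ler_wpM2r// clamp_norm.
move: c1; rewrite (eq_cvg _ _ (fun n => Ecl xi n Axi)) => c1.
exact: (cvg_unique _ c1 c2).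
Qed.

End martingale_moments.

(** * Integrals against the quadratic variation *)

Lemma within_continuous_left (R : realType) (f : R -> R) a b x :
  {within `[a, b], continuous f} -> a < x -> x <= b -> f y @[y --> x^'-] --> f x.
Proof.
move=> fc ax xb; have ab : a < b by exact: lt_le_trans xb.
have [fin _ fb] := (continuous_within_itvP f ab).1 fc.
move: xb; rewrite le_eqVlt => /predU1P[->//|xb].
by apply: cvg_at_left_filter; apply: fin; rewrite in_itv/= ax.
Qed.

Section stieltjes_integral_of_processes.
Context d (Om : measurableType d) (R : realType) (P : probability Om R) (T : R).
Context (Q : Om -> cumulative R R).
Hypotheses (T0 : 0 < T)
  (Qc : forall w, {within `[0, T], continuous (Q w : R -> R)})
  (mQ : forall t, 0 <= t <= T -> measurable_fun setT (fun w => Q w t)).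
Local Notation LS := lebesgue_stieltjes_measure.
Local Notation D := (`]0%R, T]%classic : set (measurableTypeR R)).

Let mD : measurable D. Proof. exact: measurable_itv. Qed.

(** Restriction to []0, T]] makes the measures finite, and their values on intervals then involve Q
    only at times of [0, T], where it is measurable in w. *)
Let LSD w : {measure set (measurableTypeR R) -> \bar R} := mrestr (LS (Q w)) mD.

Let LSD_fin w : (LSD w setT < +oo)%E.
Proof. by rewrite /LSD /= /mrestr setTI LS_itv_oc ?ltW// ltry. Qed.

Let LSD_measurable B : measurable B -> measurable_fun setT (LSD ^~ B).
Proof.
pose XY := [set B : set (measurableTypeR R) |
  measurable B /\ measurable_fun setT (LSD ^~ B)].
move: B; suff h : (@measurable _ (measurableTypeR R)) `<=` XY by move=> B /h[].
have CXY : @ocitv R `<=` XY.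
  move=> _ [[a b] _ <-]; split => /=; first exact: measurable_itv.
  rewrite /LSD /= /mrestr.
  have -> : `]a, b]%classic `&` `]0%R, T]%classic = `]Num.max a 0, Num.min b T]%classic.
    apply/seteqP; split => x /=; rewrite !in_itv/= gt_max le_min.
      by move=> [/andP[-> ->] /andP[-> ->]].
    by move=> /andP[/andP[-> ->] /andP[-> ->]].
  have [h|h] := leP (Num.max a 0) (Num.min b T); last first.
    rewrite set_itv_ge; last by rewrite bnd_simp -leNgt ltW.
    by under eq_fun do rewrite measure0; exact: measurable_cst.
  under eq_fun do rewrite LS_itv_oc//.
  have h1 : 0 <= Num.max a 0 by rewrite le_max lexx orbT.
  have h2 : Num.min b T <= T by rewrite ge_min lexx orbT.
  by apply/measurable_EFinP; apply: measurable_funB; apply: mQ; lra.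
suff lsys : lambda_system setT XY.
  by apply: lambda_system_subset => //; exact: ocitvI.
split => //.
- split; first exact: measurableT.
  rewrite /LSD/= /mrestr; under eq_fun do rewrite setTI LS_itv_oc ?ltW//.
  by apply/measurable_EFinP; apply: measurable_funB; apply: mQ; rewrite lexx ltW.
- move=> A B BA [mA hA] [mB hB]; split; first exact: measurableD.
  rewrite (_ : (fun _ => _) = (fun w => LSD w A - LSD w B)%E).
    exact: emeasurable_funB.
  apply/funext => w; rewrite measureD//; first by rewrite setIidr.
  by apply: le_lt_trans (LSD_fin w); apply: le_measure => //; rewrite ?inE.
- move=> F ndF mF; have mUF : measurable (\bigcup_i F i).
    by apply: bigcupT_measurable => i; exact: (mF i).1.
  split => //.
  apply: (emeasurable_fun_cvg (fun n w => LSD w (F n))) => [n|w _]; first exact: (mF n).2.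
  by apply: nondecreasing_cvg_mu => // i; exact: (mF i).1.
Qed.

Definition mproc (phi : R -> Om -> R) : Prop :=
  measurable_fun ((`]0%R, T]%classic : set (measurableTypeR R)) `*` [set: Om])
    (fun z : measurableTypeR R * Om => phi z.1 z.2).

Definition IQ (phi : R -> Om -> R) (w : Om) : \bar R :=
  (\int[LS (Q w)]_(s in `]0%R, T]) (phi s w)%:E)%E.

Definition EQ (phi : R -> Om -> R) : \bar R := (\int[P]_w IQ phi w)%E.

Lemma mproc_section phi w : mproc phi -> measurable_fun D (phi ^~ w).
Proof.
move=> mphi; rewrite (_ : phi ^~ w = (fun z : measurableTypeR R * Om => phi z.1 z.2) \o (fun s => (s, w))); last first.
  by apply/funext.
apply: (measurable_comp _ _ mphi).
- exact: measurableX.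
- by move=> _ [s Ds <-].
- exact: measurable_funTS (measurable_pair2 w).
Qed.

Lemma IQ_ge0 phi w : (forall s, D s -> 0 <= phi s w) -> (0 <= IQ phi w)%E.
Proof. by move=> h; apply: integral_ge0 => s Ds; rewrite lee_fin h. Qed.

Lemma IQ_measurable phi : mproc phi -> (forall s w, D s -> 0 <= phi s w) ->
  measurable_fun setT (IQ phi).
Proof.
move=> mphi phi0.
pose k (z : Om * measurableTypeR R) : \bar R :=
  (((fun z : measurableTypeR R * Om => (phi z.1 z.2)%:E) \_ (D `*` setT)) (z.2, z.1))%E.
rewrite (_ : IQ phi = (fun w => \int[LSD w]_s k (w, s))%E); last first.
  apply/funext => w; rewrite /IQ.
  rewrite (@eq_measure_integral _ _ _ D (LSD w) (LS (Q w)) (fun s => (phi s w)%:E)); last first.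
    by move=> A mA AD; rewrite /LSD /= /mrestr setIidl.
  rewrite integral_mkcond; apply: eq_integral => s _; rewrite /k /patch.
  by rewrite in_setX in_setT andbT.
apply: (measurable_fun_family_integral LSD_measurable LSD_fin).
- move=> [w s]; rewrite /k /patch /=; case: ifPn => // /[!inE] -[Ds _].
  by rewrite lee_fin phi0.
- have h : measurable_fun setT ((fun z : measurableTypeR R * Om => (phi z.1 z.2)%:E) \_ (D `*` setT)).
    apply/(measurable_restrictT _ (measurableX mD measurableT)).
    exact/measurable_EFinP.
  apply: (measurableT_comp h); exact: measurable_fun_pair.
Qed.

Lemma EQ_le phi psi : mproc phi -> mproc psi -> (forall s w, D s -> 0 <= phi s w) ->
  (forall s w, D s -> phi s w <= psi s w) -> (EQ phi <= EQ psi)%E.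
Proof.
move=> mphi mpsi phi0 le; have psi0 s w : D s -> 0 <= psi s w.
  by move=> Ds; rewrite (le_trans (phi0 s w Ds))// le.
apply: ge0_le_integral => //.
- by move=> w _; apply: IQ_ge0 => s; exact: phi0.
- exact: IQ_measurable.
- exact: IQ_measurable.
- move=> w _; apply: ge0_le_int => //.
  + exact: mproc_section.
  + exact: mproc_section.
  + by move=> s Ds; exact: phi0.
  + by move=> s Ds; exact: le.
Qed.

Lemma mprocD phi psi : mproc phi -> mproc psi -> mproc (fun s w => phi s w + psi s w).
Proof. by move=> mphi mpsi; exact: measurable_funD. Qed.

Lemma mprocB phi psi : mproc phi -> mproc psi -> mproc (fun s w => phi s w - psi s w).
Proof. by move=> mphi mpsi; exact: measurable_funB. Qed.

Lemma mprocM phi psi : mproc phi -> mproc psi -> mproc (fun s w => phi s w * psi s w).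
Proof. by move=> mphi mpsi; exact: measurable_funM. Qed.

Lemma mproc_cst k : mproc (fun _ _ => k).
Proof. exact: measurable_cst. Qed.

Lemma mprocZ k phi : mproc phi -> mproc (fun s w => k * phi s w).
Proof. by move=> mphi; apply: mprocM => //; exact: mproc_cst. Qed.

Lemma mproc_sqr phi : mproc phi -> mproc (fun s w => phi s w ^+ 2).
Proof. by move=> mphi; exact: measurable_funX. Qed.

Lemma EQ_lin a b phi psi : 0 <= a -> 0 <= b -> mproc phi -> mproc psi ->
  (forall s w, D s -> 0 <= phi s w) -> (forall s w, D s -> 0 <= psi s w) ->
  EQ (fun s w => a * phi s w + b * psi s w) = (a%:E * EQ phi + b%:E * EQ psi)%E.
Proof.
move=> a0 b0 mphi mpsi phi0 psi0.
rewrite -!ge0_integralZl_EFin//.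
- rewrite -ge0_integralD//.
  + apply: eq_integral => w _; rewrite /IQ.
    rewrite -!ge0_integralZl_EFin//.
    * rewrite -ge0_integralD//.
      - by move=> s Ds; rewrite mule_ge0 ?lee_fin ?phi0.
      - by apply: measurable_funeM; apply/measurable_EFinP; exact: mproc_section.
      - by move=> s Ds; rewrite mule_ge0 ?lee_fin ?psi0.
      - by apply: measurable_funeM; apply/measurable_EFinP; exact: mproc_section.
    * by move=> s Ds; rewrite lee_fin psi0.
    * by apply/measurable_EFinP; exact: mproc_section.
    * by move=> s Ds; rewrite lee_fin phi0.
    * by apply/measurable_EFinP; exact: mproc_section.
  + by move=> w _; rewrite mule_ge0 ?lee_fin// IQ_ge0// => s; exact: phi0.
  + by apply: measurable_funeM; exact: IQ_measurable.
  + by move=> w _; rewrite mule_ge0 ?lee_fin// IQ_ge0// => s; exact: psi0.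
  + by apply: measurable_funeM; exact: IQ_measurable.
- by move=> w _; rewrite IQ_ge0// => s; exact: psi0.
- exact: IQ_measurable.
- by move=> w _; rewrite IQ_ge0// => s; exact: phi0.
- exact: IQ_measurable.
Qed.

(** Fatou's lemma is applied twice: on each path against dQ, then under P. *)
Lemma EQ_fatou (phi_ : nat -> R -> Om -> R) phi (c : R) :
  (forall n, mproc (phi_ n)) -> (forall n s w, D s -> 0 <= phi_ n s w) ->
  (forall s w, D s -> phi_ n s w @[n --> \oo] --> phi s w) ->
  (forall e, 0 < e -> exists n0, forall n, (n0 <= n)%N -> (EQ (phi_ n) <= (c + e)%:E)%E) ->
  (EQ phi <= c%:E)%E.
Proof.
move=> mphi_ phi_0 cphi H.
apply: (@le_trans _ _ (\int[P]_w limn_einf (fun n => IQ (phi_ n) w))%E).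
  have mphi : mproc phi by apply: (measurable_fun_cvg mphi_) => -[s w] [Ds _]; exact: cphi.
  have phi0 s w : D s -> 0 <= phi s w.
    move=> Ds; apply: (ler_cvg_to (cvg_cst 0) (cphi s w Ds)).
    by near=> n; exact: phi_0.
  apply: ge0_le_integral => //.
  - by move=> w _; apply: IQ_ge0 => s; exact: phi0.
  - exact: IQ_measurable.
  - under eq_fun do rewrite limn_einf_lim.
    apply: (@emeasurable_fun_cvg _ _ _ _ (fun m w => einfs (fun n => IQ (phi_ n) w) m)) => [m|w _].
      by apply: measurable_fun_einfs => n; apply: IQ_measurable => //; exact: phi_0.
    exact: is_cvg_einfs.
  - move=> w _; rewrite /IQ.
    have -> : (\int[LS (Q w)]_(s in D) (phi s w)%:E =
               \int[LS (Q w)]_(s in D) limn_einf (fun n => (phi_ n s w)%:E))%E.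
      by apply: eq_integral => s; rewrite inE => Ds; rewrite (limn_einf_EFin (cphi s w Ds)).
    apply: fatou => //.
    + by move=> n; apply/measurable_EFinP; exact: mproc_section.
    + by move=> n s Ds; rewrite lee_fin phi_0.
apply: (@le_trans _ _ (limn_einf (fun n => EQ (phi_ n)))); last exact: limn_einf_le.
apply: fatou => // n; first by apply: IQ_measurable => //; exact: phi_0.
by move=> w _; apply: IQ_ge0 => s; exact: phi_0.
Unshelve. all: end_near. Qed.

Lemma LS_point w s : 0 < s -> s <= T -> LS (Q w) [set s] = 0%E.
Proof.
move=> s0 sT; apply: (LS_set1 s0).
have H1 : {within `[0, T], continuous (Q w : R -> R)} by exact: Qc.
exact: within_continuous_left H1 s0 sT.
Qed.

(** Integrands live on cells closed on the left, while Stieltjes measures are computed on cells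
    closed on the right. The endpoints have no mass because Q is continuous, and time 0 is cut off
    by [D]. *)
Lemma LS_co w a b : 0 <= a -> a <= b -> b <= T ->
  LS (Q w) (`[a, b[%classic `&` D) = (Q w b - Q w a)%:E.
Proof.
move=> a0; rewrite le_eqVlt => /predU1P[<- _|ab bT].
  by rewrite subrr set_itv_ge ?bnd_simp// set0I measure0.
have mab : measurable (`[a, b[%classic `&` D : set (measurableTypeR R)).
  by apply: measurableI => //; exact: measurable_itv.
have mp : measurable ([set a] `&` D : set (measurableTypeR R)).
  by apply: measurableI => //; exact: measurable_set1.
have moc : measurable (`]a, b]%classic : set (measurableTypeR R)) by exact: measurable_itv.
have mb : measurable ([set b] : set (measurableTypeR R)) by exact: measurable_set1.
rewrite -(LS_itv_oc (Q w) (ltW ab)); apply/eqP; rewrite eq_le; apply/andP; split.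
- apply: (@le_trans _ _ (LS (Q w) (([set a] `&` D) `|` `]a, b]%classic))).
    apply: le_measure; rewrite ?inE//; first exact: measurableU.
    move=> x [/=]; rewrite !in_itv/= => /andP[ax xb] /andP[x0 xT].
    move: ax; rewrite le_eqVlt => /predU1P[axE|ax]; last by right; rewrite ax ltW.
    by left; split => //; rewrite ?x0.
  apply: le_trans (measureU2 _ mp moc) _.
  rewrite -[leRHS]add0e leeD2r//.
  have [a00|a00] := eqVneq a 0.
    rewrite (_ : _ `&` _ = set0) ?measure0//; apply/seteqP; split => // x [/= ->].
    by rewrite a00 in_itv/= ltxx.
  rewrite -(LS_point w (_ : 0 < a) (_ : a <= T)); last 2 first.
  - by rewrite lt_neqAle eq_sym a00.
  - by rewrite (le_trans (ltW ab)).
  apply: le_measure; rewrite ?inE//.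
- apply: (@le_trans _ _ (LS (Q w) ((`[a, b[%classic `&` D) `|` [set b]))).
    apply: le_measure; rewrite ?inE//; first exact: measurableU.
    move=> x /=; rewrite in_itv/= => /andP[ax xb].
    move: xb; rewrite le_eqVlt => /predU1P[->|xb]; [by right|left; split => /=].
      by rewrite in_itv/= (ltW ax).
    by rewrite in_itv/= (le_lt_trans a0 ax) (le_trans (ltW xb)).
  apply: le_trans (measureU2 _ mab mb) _.
  rewrite -[leRHS]adde0 leeD2l// le_eqVlt; apply/orP; left.
  exact/eqP/(LS_point w (le_lt_trans a0 ab) bT).
Qed.

(** The point T has no mass. It must be discarded since step processes vanish at T, their cells
    being open on the right. *)
Lemma EQ_eq_off_T phi psi : (forall s w, 0 < s < T -> phi s w = psi s w) ->
  mproc phi -> mproc psi -> (forall s w, D s -> 0 <= phi s w) ->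
  (forall s w, D s -> 0 <= psi s w) -> EQ phi = EQ psi.
Proof.
move=> E mphi mpsi phi0 psi0; apply: eq_integral => w _.
apply: ge0_ae_eq_integral => //.
- by apply/measurable_EFinP; exact: mproc_section.
- by apply/measurable_EFinP; exact: mproc_section.
- by move=> s Ds; rewrite lee_fin phi0.
- by move=> s Ds; rewrite lee_fin psi0.
exists [set T]; split; [exact: measurable_set1|exact: LS_point|].
move=> s /= /not_implyP[]; rewrite in_itv/= => /andP[s0 sT] /eqP ne.
apply: contrapT => /eqP sneT; apply: (negP ne); apply/eqP; congr EFin; apply: E.
by rewrite s0 lt_neqAle sneT.
Qed.

Section simple_processes.
Context (I : Type) (e : seq I) (lo hi : I -> R) (xi : I -> Om -> R).
Hypotheses (lo0 : forall i, 0 <= lo i) (lohi : forall i, lo i <= hi i)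
  (hiT : forall i, hi i <= T) (mxi : forall i, measurable_fun setT (xi i)).

Definition simple_process s w : R := \sum_(i <- e) xi i w * \1_(`[lo i, hi i[%classic) s.

(* Q-mass of the intersection of two cells; 0 when they are disjoint *)
Definition overlap i j w : R :=
  let a := Num.max (lo i) (lo j) in Q w (Num.max a (Num.min (hi i) (hi j))) - Q w a.

Lemma simple_process_measurable : mproc simple_process.
Proof.
apply: measurable_sum => i; apply: measurable_funM.
  by apply: measurable_funTS; apply: measurableT_comp => //; exact: measurable_snd.
apply: measurable_funTS.
have h : measurable_fun setT (\1_(`[lo i, hi i[%classic) : measurableTypeR R -> R).
  by apply: measurable_indic; exact: measurable_itv.
exact: (measurableT_comp h (@measurable_fst _ _ _ _)).
Qed.

(** The outer [Num.max] turns disjoint cells into an empty interval, so that intersections keep the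
    format of a cell. *)
Lemma indic_cells i j (s : R) : \1_(`[lo i, hi i[%classic) s * \1_(`[lo j, hi j[%classic) s =
  \1_(`[Num.max (lo i) (lo j),
        Num.max (Num.max (lo i) (lo j)) (Num.min (hi i) (hi j))[%classic) s :> R.
Proof.
rewrite !indicE -natrM mulnb; congr (_%:R); congr nat_of_bool.
rewrite !mem_setE !in_itv/= !ge_max !lt_max lt_min.
by case: (ltP s (lo i)); case: (ltP s (lo j)); rewrite ?andbF ?andbT ?orbF//= andbC.
Qed.

Lemma IQ_simple w : IQ simple_process w =
  (\sum_(i <- e) xi i w * (Q w (hi i) - Q w (lo i)))%:E.
Proof.
have Dfin : (LS (Q w) D < +oo)%E by rewrite LS_itv_oc ?ltW// ltry.
have mI i : measurable (`[lo i, hi i[%classic : set (measurableTypeR R)).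
  exact: measurable_itv.
have iI i : (LS (Q w)).-integrable D (EFin \o (fun s => xi i w * \1_(`[lo i, hi i[%classic) s)).
  apply: measurable_bounded_integrable => //.
    by apply: measurable_funM => //; apply: measurable_indic.
  exists (`|xi i w|); split; first exact: num_real.
  move=> x xb s _ /=; rewrite normrM (le_trans _ (ltW xb))// ler_piMr//.
  by rewrite indicE; case: (_ \in _); rewrite /= ?normr1 ?normr0.
transitivity (\int[LS (Q w)]_(s in D) (\sum_(i <- e) (xi i w * \1_(`[lo i, hi i[%classic) s)%:E))%E.
  by apply: eq_integral => s _; rewrite /simple_process -sumEFin.
rewrite integral_sum//.
rewrite -sumEFin; apply: eq_bigr => i _.
under eq_integral do rewrite EFinM.
rewrite integralZl//; last first.
  apply: measurable_bounded_integrable => //.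
  exists 1; split; first exact: num_real.
  move=> x x1 s _ /=; rewrite (le_trans _ (ltW x1))// indicE.
  by case: (_ \in _); rewrite /= ?normr1 ?normr0.
rewrite integral_indic//.
by rewrite (congr1 _ (LS_co w (lo0 i) (lohi i) (hiT i))) -EFinM.
Qed.

End simple_processes.

(** The square of a simple process is again one, indexed by pairs of cells and supported on their
    intersections. *)
Lemma IQ_simple_sqr (I : Type) (e : seq I) (lo hi : I -> R) (xi : I -> Om -> R) w :
  (forall i, 0 <= lo i) -> (forall i, lo i <= hi i) -> (forall i, hi i <= T) ->
  IQ (fun s w => simple_process e lo hi xi s w ^+ 2) w =
  (\sum_(i <- e) \sum_(j <- e) xi i w * xi j w * overlap lo hi i j w)%:E.
Proof.
move=> lo0 lohi hiT.
pose c (p : I * I) := Num.max (lo p.1) (lo p.2).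
pose c' p := Num.max (c p) (Num.min (hi p.1) (hi p.2)).
transitivity (IQ (simple_process [seq (i, j) | i <- e, j <- e] c c' (fun p w => xi p.1 w * xi p.2 w)) w).
  apply: eq_integral => s _; congr EFin.
  rewrite /simple_process big_allpairs expr2 mulr_suml; apply: eq_bigr => i _.
  by rewrite mulr_sumr; apply: eq_bigr => j _; rewrite mulrACA indic_cells.
rewrite IQ_simple ?big_allpairs//.
- by move=> p; rewrite le_max lo0.
- by move=> p; rewrite /c' le_max lexx.
- by move=> p; rewrite /c' /c !ge_max ge_min !hiT !(le_trans (lohi _)).
Qed.

End stieltjes_integral_of_processes.

(** * Itô integrals *)

Section elementary_integrals.
Context d (Om : measurableType d) (R : realType) (P : probability Om R) (T Lam : R).
Context (Ad : R -> (Om -> R) -> Prop) (M : R -> Om -> R) (Q : Om -> cumulative R R).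
Hypothesis ms : martingale_setting P T Lam Ad M Q.
Implicit Types (s t u : R) (xi : Om -> R).

Let T0 : 0 < T := ms_T ms.
Let Qc := Q_continuous ms.
Let mQ := Q_measurable ms.
Local Notation EQ := (EQ P T Q).
Local Notation mproc := (mproc T).

(** The cells of one integrand may overlap, so that sums of integrands are concatenations; in
    exchange, the isometry has to treat every pair of cells. *)
Record cell := Cell {
  cell_lo : R ; cell_hi : R ; cell_val : Om -> R ;
  cell_lo_ge0 : 0 <= cell_lo ; cell_lo_hi : cell_lo <= cell_hi ; cell_hi_T : cell_hi <= T ;
  cell_Ad : Ad cell_lo cell_val ; cell_sqr : integ P (fun w => cell_val w ^+ 2) }.
Local Notation lo := cell_lo.
Local Notation hi := cell_hi.
Local Notation vl := cell_val.

Let mvl c : measurable_fun setT (vl c).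
Proof. exact: Ad_measurable ms _ _ (cell_Ad c). Qed.

Definition eproc (e : seq cell) : R -> Om -> R := simple_process e lo hi vl.

Definition eint (e : seq cell) t w : R :=
  \sum_(c <- e) vl c w * (M (Num.min (hi c) t) w - M (Num.min (lo c) t) w).

Lemma eproc_measurable e : mproc (eproc e).
Proof. exact: simple_process_measurable. Qed.

Lemma eint_measurable e t : 0 <= t <= T -> measurable_fun setT (eint e t).
Proof.
move=> tT; apply: measurable_sum => c; apply: measurable_funM => //.
have := cell_lo_ge0 c; have := cell_lo_hi c; have := cell_hi_T c => h1 h2 h3.
by apply: measurable_funB; apply: (M_measurable ms);
  rewrite le_min ge_min; apply/andP; split; apply/andP || apply/orP; lra.
Qed.

Let itg2 s p q xi : 0 <= s -> s <= p -> p <= q -> q <= T -> Ad s xi ->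
  integ P (fun w => xi w ^+ 2) ->
  measurable_fun setT (fun w => xi w * (M q w - M p w)) /\
  integ P (fun w => (xi w * (M q w - M p w)) ^+ 2).
Proof.
move=> s0 sp pq qT Axi ixi; split.
  apply: measurable_funM; first exact: Ad_measurable ms _ _ Axi.
  by apply: measurable_funB; apply: (M_measurable ms); lra.
apply: (@eq_integ _ _ _ _ (fun w => xi w ^+ 2 * (M q w - M p w) ^+ 2)).
  by move=> w; rewrite exprMn.
apply: (integ_variance ms) => //; first lra.
exact: (Ad_comp ms (@sqr_locally_lipschitz R) (Ad_le ms sp Axi)).
Qed.

Let itgM xi zeta s s' p q p' q' : 0 <= s -> s <= p -> p <= q -> q <= T ->
  0 <= s' -> s' <= p' -> p' <= q' -> q' <= T -> Ad s xi -> Ad s' zeta ->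
  integ P (fun w => xi w ^+ 2) -> integ P (fun w => zeta w ^+ 2) ->
  integ P (fun w => xi w * (M q w - M p w) * (zeta w * (M q' w - M p' w))).
Proof.
move=> s0 sp pq qT s'0 sp' pq' q'T Ax Az ix iz.
have [m1 i1] := itg2 s0 sp pq qT Ax ix; have [m2 i2] := itg2 s'0 sp' pq' q'T Az iz.
exact: integ_sqrM.
Qed.

(** Both increments are cut at the start s' of the later cell and at the earlier end m. In the
    product, a piece that follows all the others is orthogonal to them, so only the square of the
    common piece on [s', m] survives, and [Ex_Q] trades it for the increment of Q. *)
Lemma cell_pair_le (c c' : cell) : lo c <= lo c' ->
  integ P (fun w => vl c w * (M (hi c) w - M (lo c) w) * (vl c' w * (M (hi c') w - M (lo c') w))) /\
  integ P (fun w => vl c w * vl c' w * overlap Q lo hi c c' w) /\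
  Ex P (fun w => vl c w * (M (hi c) w - M (lo c) w) * (vl c' w * (M (hi c') w - M (lo c') w))) =
  Ex P (fun w => vl c w * vl c' w * overlap Q lo hi c c' w).
Proof.
case: c c' => s r xi s0 sr rT Ax ix [s' r' zt s'0 sr' r'T Az iz]/= ss'.
rewrite /overlap /= (max_r ss').
have Axs' := Ad_le ms ss' Ax.
have Axz : Ad s' (fun w => xi w * zt w) by exact: (Ad_mul ms).
have mx := Ad_measurable ms Ax; have mz := Ad_measurable ms Az.
have ixz : integ P (fun w => xi w * zt w) by exact: integ_sqrM.
have i0 := itgM s0 (lexx _) sr rT s'0 (lexx _) sr' r'T Ax Az ix iz.
split => //.
(* Disjoint cells: the later increment is orthogonal to all that is known at s'. *)
have [rs'|s'r] := leP r s'.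
  have E w : xi w * zt w * (Q w (Num.max s' (Num.min r r')) - Q w s') = 0.
    by rewrite max_l ?subrr ?mulr0// ge_min rs'.
  split; first by apply: (@eq_integ _ _ _ _ (fun=> 0)); [move=> w|exact: integ_cst].
  rewrite (eq_Ex _ E) Ex_cst.
  rewrite -(@Ex_martingale _ _ _ _ _ _ _ _ _ ms s' r' (fun w => xi w * (M r w - M s w) * zt w))//.
  - by apply: eq_Ex => w; rewrite !mulrA.
  - apply: (Ad_mul ms) => //; apply: (Ad_mul ms) => //.
    by apply: (Ad_increment ms) => //; lra.
  - by apply: eq_integ i0 => w; rewrite !mulrA.
have s'm : s' <= Num.min r r' by rewrite le_min (ltW s'r).
have mr : Num.min r r' <= r by rewrite ge_min lexx.
have mr' : Num.min r r' <= r' by rewrite ge_min lexx orbT.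
(* m is one of the two ends, so one of the increments after m is 0. *)
have mM w : (M r w - M (Num.min r r') w) * (M r' w - M (Num.min r r') w) = 0.
  by case: (leP r r') => _; rewrite subrr ?mul0r ?mulr0.
rewrite (max_r s'm); move: (Num.min r r') s'm mr mr' mM => m s'm mr mr' mM.
have m0 : 0 <= m by lra. have mT : m <= T by lra.
have [iQ EE] := Ex_Q ms s'0 s'm mT Axz ixz.
split => //.
have iA : integ P (fun w => xi w * zt w * (M s' w - M s w) * (M r' w - M s' w)).
  apply: eq_integ (itgM s0 (lexx _) ss' _ s'0 (lexx _) sr' r'T Ax Az ix iz) => //; last lra.
  by move=> w; ring.
have iB : integ P (fun w => xi w * zt w * (M m w - M s' w) * (M r' w - M m w)).
  apply: eq_integ (itgM s0 ss' s'm mT s'0 s'm mr' r'T Ax Az ix iz) => //.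
  by move=> w; ring.
have iC : integ P (fun w => xi w * zt w * (M m w - M s' w) * (M r w - M m w)).
  apply: eq_integ (itgM s0 (le_trans ss' s'm) mr rT s'0 (lexx _) s'm mT Ax Az ix iz) => //.
  by move=> w; ring.
have iS : integ P (fun w => xi w * zt w * (M m w - M s' w) ^+ 2).
  by apply: (integ_variance ms).
have EA : Ex P (fun w => xi w * zt w * (M s' w - M s w) * (M r' w - M s' w)) = 0.
  apply: (Ex_martingale ms) => //; apply: (Ad_mul ms) => //.
  by apply: (Ad_increment ms) => //; lra.
have Axzm := Ad_le ms s'm Axz.
have EB : Ex P (fun w => xi w * zt w * (M m w - M s' w) * (M r' w - M m w)) = 0.
  by apply: (Ex_martingale ms) => //; apply: (Ad_mul ms) => //; exact: (Ad_increment ms).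
have EC : Ex P (fun w => xi w * zt w * (M m w - M s' w) * (M r w - M m w)) = 0.
  by apply: (Ex_martingale ms) => //; apply: (Ad_mul ms) => //; exact: (Ad_increment ms).
(* The three vanishing expectations are inserted on the right; both sides then agree pointwise, up
   to the null product [mM]. *)
rewrite -EE -[RHS]add0r -[in RHS]EA -[X in X + _]addr0 -[in RHS]EB -[X in X + _]addr0 -[in RHS]EC.
have iAB := integD iA iB; have iABC := integD iAB iC.
rewrite -(ExD iA iB) -(ExD iAB iC) -(ExD iABC iS).
apply: eq_Ex => w; rewrite -[LHS]addr0 -(mulr0 (- (xi w * zt w))) -(mM w).
by ring.
Qed.

Lemma overlapC (c c' : cell) w : overlap Q lo hi c c' w = overlap Q lo hi c' c w.
Proof. by rewrite /overlap (maxC (lo c)) (minC (hi c)). Qed.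

Lemma cell_pair (c c' : cell) :
  integ P (fun w => vl c w * (M (hi c) w - M (lo c) w) * (vl c' w * (M (hi c') w - M (lo c') w))) /\
  integ P (fun w => vl c w * vl c' w * overlap Q lo hi c c' w) /\
  Ex P (fun w => vl c w * (M (hi c) w - M (lo c) w) * (vl c' w * (M (hi c') w - M (lo c') w))) =
  Ex P (fun w => vl c w * vl c' w * overlap Q lo hi c c' w).
Proof.
have [h|/ltW h] := leP (lo c) (lo c'); first exact: cell_pair_le.
have [h1 [h2 h3]] := cell_pair_le h.
split; first by apply: eq_integ h1 => w; rewrite mulrC.
split; first by apply: eq_integ h2 => w; rewrite overlapC (mulrC (vl c' w)).
rewrite -(eq_Ex _ (g := fun w => vl c w * vl c' w * overlap Q lo hi c c' w)
  (f := fun w => vl c' w * vl c w * overlap Q lo hi c' c w)) -?h3.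
  by apply: eq_Ex => w; rewrite mulrC.
by move=> w; rewrite overlapC (mulrC (vl c' w)).
Qed.

Lemma eint_isometry e :
  (\int[P]_w (eint e T w ^+ 2)%:E)%E = EQ (fun s w => eproc e s w ^+ 2).
Proof.
pose X (c : cell) w := vl c w * (M (hi c) w - M (lo c) w).
have -> : (EQ (fun s w => eproc e s w ^+ 2)%R =
    \int[P]_w (\sum_(c <- e) \sum_(c' <- e) vl c w * vl c' w * overlap Q lo hi c c' w)%:E)%E.
  apply: eq_integral => w _; apply: IQ_simple_sqr => //; [exact: cell_lo_ge0|exact: cell_lo_hi|exact: cell_hi_T].
have -> : (\int[P]_w (eint e T w ^+ 2)%:E =
    \int[P]_w (\sum_(c <- e) \sum_(c' <- e) X c w * X c' w)%:E)%E.
  apply: eq_integral => w _; congr EFin; rewrite expr2 mulr_suml; apply: eq_bigr => c _.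
  rewrite mulr_sumr; apply: eq_bigr => c' _.
  by rewrite /X !(min_l (cell_hi_T _)) !min_l// (le_trans (cell_lo_hi _) (cell_hi_T _)).
rewrite !integE; last 2 first.
- by apply: integ_sum => c; apply: integ_sum => c'; exact: (cell_pair c c').2.1.
- by apply: integ_sum => c; apply: integ_sum => c'; exact: (cell_pair c c').1.
congr EFin; rewrite !Ex_sum.
- apply: eq_bigr => c _; rewrite !Ex_sum.
  + by apply: eq_bigr => c' _; exact: (cell_pair c c').2.2.
  + by move=> c'; exact: (cell_pair c c').2.1.
  + by move=> c'; exact: (cell_pair c c').1.
- by move=> c; apply: integ_sum => c'; exact: (cell_pair c c').2.1.
- by move=> c; apply: integ_sum => c'; exact: (cell_pair c c').1.
Qed.

(** A cell that starts before t is shortened; one that starts after t cannot be, as [lo <= hi] is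
    required, and becomes a zero cell at t. *)
Lemma cell_stop (c : cell) t : 0 <= t <= T -> exists2 c', 
  forall s w, vl c' w * \1_(`[lo c', hi c'[%classic) s =
    vl c w * \1_(`[lo c, hi c[%classic) s * (s < t)%R%:R &
  forall w, vl c' w * (M (hi c') w - M (lo c') w) =
    vl c w * (M (Num.min (hi c) t) w - M (Num.min (lo c) t) w).
Proof.
case: c => s r xi s0 sr rT Ax ix /= /andP[t0 tT].
have [st|ts] := leP s t.
  have h1 : s <= Num.min r t by rewrite le_min sr.
  have h2 : Num.min r t <= T by rewrite ge_min rT.
  exists (@Cell s (Num.min r t) xi s0 h1 h2 Ax ix) => //= u w.
  rewrite -mulrA; congr (_ * _); rewrite !indicE !mem_setE !in_itv/= lt_min andbA.
  by rewrite -natrM mulnb.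
have i0 : integ P (fun w => (fun=> 0 : R) w ^+ 2).
  by apply: (@eq_integ _ _ _ _ (fun=> 0)); [move=> w; rewrite expr0n|exact: integ_cst].
exists (@Cell t t (fun=> 0) t0 (lexx t) tT (Ad_cst ms t 0) i0) => /= [u w|w].
  rewrite mul0r indicE mem_setE in_itv/=; case: (ltP u t) => ut; last by rewrite mulr0.
  by rewrite (leNgt s) (lt_trans ut ts)/= mulr0 mul0r.
by rewrite mul0r min_r ?subrr ?mulr0// (le_trans (ltW ts)).
Qed.

Lemma eint_stop e t : 0 <= t <= T -> exists2 e',
  forall s w, eproc e' s w = eproc e s w * (s < t)%R%:R & eint e' T =1 eint e t.
Proof.
move=> tT; elim: e => [|c e [e' H1 H2]].
  by exists [::] => [s w|w]; rewrite /eproc /simple_process /eint !big_nil ?mul0r.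
have [c' H3 H4] := cell_stop c tT.
exists (c' :: e') => [s w|w].
  by rewrite /eproc /simple_process !big_cons H3 [X in _ + X]H1 -mulrDl.
rewrite /eint !big_cons -[X in _ + X]/(eint e' T w) H2 -H4.
by rewrite (min_l (cell_hi_T _)) min_l// (le_trans (cell_lo_hi _) (cell_hi_T _)).
Qed.

Lemma eint_sqr_le e t : 0 <= t <= T ->
  (\int[P]_w (eint e t w ^+ 2)%:E <= EQ (fun s w => eproc e s w ^+ 2)%R)%E.
Proof.
move=> tT; have [e' H1 H2] := eint_stop e tT.
under eq_integral do rewrite -H2.
rewrite eint_isometry; apply: EQ_le => //.
- by apply: mproc_sqr; exact: eproc_measurable.
- by apply: mproc_sqr; exact: eproc_measurable.
- by move=> s w _; exact: sqr_ge0.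
- move=> s w _; rewrite H1 exprMn; case: (s < t)%R; rewrite ?expr1n ?mulr1//.
  by rewrite expr0n/= mulr0 sqr_ge0.
Qed.

Lemma eproc_cat e e' s w : eproc (e ++ e') s w = eproc e s w + eproc e' s w.
Proof. by rewrite /eproc /simple_process big_cat. Qed.

Lemma eint_cat e e' t w : eint (e ++ e') t w = eint e t w + eint e' t w.
Proof. by rewrite /eint big_cat. Qed.

Lemma eint_scale (a : R) e : exists2 e',
  forall s w, eproc e' s w = a * eproc e s w & forall t w, eint e' t w = a * eint e t w.
Proof.
elim: e => [|c e [e' H1 H2]].
  by exists [::] => [s w|t w]; rewrite /eproc /simple_process /eint ?big_nil ?mulr0.
have i : integ P (fun w => (a * vl c w) ^+ 2).
  apply: eq_integ (integZ (a ^+ 2) (cell_sqr c)) => w; by rewrite exprMn.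
exists (Cell (cell_lo_ge0 c) (cell_lo_hi c) (cell_hi_T c) (Ad_scale ms a (cell_Ad c)) i :: e').
  by move=> s w; rewrite /eproc /simple_process !big_cons/= [X in _ + X]H1 mulrDr mulrA.
by move=> t w; rewrite /eint !big_cons/= [X in _ + X]H2 [RHS]mulrDr mulrA.
Qed.

End elementary_integrals.

Section ito_integral.
Context d (Om : measurableType d) (R : realType) (P : probability Om R) (T Lam : R).
Context (Ad : R -> (Om -> R) -> Prop) (M : R -> Om -> R) (Q : Om -> cumulative R R).
Hypothesis ms : martingale_setting P T Lam Ad M Q.
Implicit Types (s t u : R) (X Y Z : Om -> R) (phi psi eta : R -> Om -> R).

Let T0 : 0 < T := ms_T ms.
Let Qc := Q_continuous ms.
Let mQ := Q_measurable ms.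
Local Notation mproc := (mproc T).
Local Notation cell := (cell P T Ad).

(** Squared distances, possibly infinite: no square root is taken, and each triangle inequality
    costs a factor 2. *)
Definition EQ2 phi psi : \bar R := EQ P T Q (fun s w => (phi s w - psi s w) ^+ 2).

Definition E2 X Y : \bar R := (\int[P]_w ((X w - Y w) ^+ 2)%:E)%E.

Lemma E2C X Y : E2 X Y = E2 Y X.
Proof. by apply: eq_integral => w _; rewrite -sqrrN opprB. Qed.

Lemma EQ2C phi psi : EQ2 phi psi = EQ2 psi phi.
Proof.
by rewrite /EQ2; congr EQ; apply/funext => s; apply/funext => w; rewrite -sqrrN opprB.
Qed.

Lemma E2_refl X : E2 X X = 0%E.
Proof. by apply: integral0_eq => w _; rewrite subrr expr0n. Qed.

Lemma EQ2_refl phi : EQ2 phi phi = 0%E.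
Proof.
rewrite /EQ2 /EQ /IQ; apply: integral0_eq => w _; apply: integral0_eq => s _.
by rewrite subrr expr0n.
Qed.

Let sqrD_le (a b c : R) : (a - c) ^+ 2 <= 2 * (a - b) ^+ 2 + 2 * (b - c) ^+ 2.
Proof. by have := sqr_ge0 (a - b - (b - c)) => h; nra. Qed.

Lemma E2_triangle Y X Z (a b : R) : measurable_fun setT X -> measurable_fun setT Y ->
  measurable_fun setT Z -> (E2 X Y <= a%:E)%E -> (E2 Y Z <= b%:E)%E ->
  (E2 X Z <= (2 * a + 2 * b)%:E)%E.
Proof.
move=> mX mY mZ XY YZ.
have m1 : measurable_fun setT (fun w => (X w - Y w) ^+ 2).
  by apply: measurable_funX; exact: measurable_funB.
have m2 : measurable_fun setT (fun w => (Y w - Z w) ^+ 2).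
  by apply: measurable_funX; exact: measurable_funB.
have [i1 E1] := integ_fin m1 (fun w => sqr_ge0 _) XY.
have [i2 E2] := integ_fin m2 (fun w => sqr_ge0 _) YZ.
have i3 : integ P (fun w => 2 * (X w - Y w) ^+ 2 + 2 * (Y w - Z w) ^+ 2).
  by apply: integD; exact: integZ.
apply: (@le_trans _ _ (\int[P]_w (2 * (X w - Y w) ^+ 2 + 2 * (Y w - Z w) ^+ 2)%:E)%E).
  apply: ge0_le_int => //.
  - by apply: measurable_funX; exact: measurable_funB.
  - exact: integ_measurable i3.
  - by move=> w _; exact: sqr_ge0.
rewrite integE// lee_fin ExD; [|exact: integZ|exact: integZ].
by rewrite !ExZ// lerD// ler_pM2l.
Qed.

Lemma EQ2_triangle psi phi eta (a b : R) : mproc phi -> mproc psi -> mproc eta ->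
  (EQ2 phi psi <= a%:E)%E -> (EQ2 psi eta <= b%:E)%E ->
  (EQ2 phi eta <= (2 * a + 2 * b)%:E)%E.
Proof.
move=> mphi mpsi meta h1 h2.
apply: (@le_trans _ _ (EQ P T Q (fun s w => 2 * (phi s w - psi s w) ^+ 2 + 2 * (psi s w - eta s w) ^+ 2)%R)).
  apply: EQ_le => //.
  - by apply: mproc_sqr; exact: mprocB.
  - by apply: mprocD; apply: mprocZ; apply: mproc_sqr; exact: mprocB.
  - by move=> s w _; exact: sqr_ge0.
rewrite EQ_lin//.
- by rewrite [leRHS]EFinD [X in (_ <= X + _)%E]EFinM [X in (_ <= _ + X)%E]EFinM leeD// lee_wpmul2l// lee_fin.
- by apply: mproc_sqr; exact: mprocB.
- by apply: mproc_sqr; exact: mprocB.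
- by move=> s w _; exact: sqr_ge0.
- by move=> s w _; exact: sqr_ge0.
Qed.

(** Y is, up to P-null sets, the integral of eta from 0 to t: one elementary integrand approximates
    eta and its integral approximates Y. The coefficients are adapted in the sense of [Ad]; those in
    L_G^2 enter only when the family [PP] comes back. *)
Definition is_int t eta Y : Prop :=
  [/\ mproc eta, measurable_fun setT Y & forall eps, 0 < eps ->
    exists e : seq cell, (EQ2 (eproc e) eta <= eps%:E)%E /\ (E2 (eint M e t) Y <= eps%:E)%E].

Lemma eint_E2_le (e e' : seq cell) t : 0 <= t <= T ->
  (E2 (eint M e t) (eint M e' t) <= EQ2 (eproc e) (eproc e'))%E.
Proof.
move=> tT; have [e1 H1 H2] := eint_scale (M := M) ms (-1) e'.
have -> : E2 (eint M e t) (eint M e' t) = (\int[P]_w (eint M (e ++ e1) t w ^+ 2)%:E)%E.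
  by apply: eq_integral => w _; rewrite eint_cat H2 mulN1r.
have -> : EQ2 (eproc e) (eproc e') = EQ P T Q (fun s w => eproc (e ++ e1) s w ^+ 2).
  rewrite /EQ2; congr EQ; apply/funext => s; apply/funext => w.
  by rewrite eproc_cat H1 mulN1r.
exact: (eint_sqr_le ms).
Qed.

(** The constant is 2^4, as c goes through four triangle inequalities. What matters is that it does
    not depend on P. *)
Lemma is_int_isometry t eta eta' Y Y' (c : R) : 0 <= t <= T ->
  is_int t eta Y -> is_int t eta' Y' -> (EQ2 eta eta' <= c%:E)%E ->
  (E2 Y Y' <= (16 * c)%:E)%E.
Proof.
move=> tT [meta mY H] [meta' mY' H'] ec.
apply/lee_addgt0Pr => eps eps0; rewrite -EFinD.
(* The approximation errors add up to 30 times this one. *)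
have e0 : 0 < eps / 100 by lra.
have [e [h1 h2]] := H _ e0; have [e' [h1' h2']] := H' _ e0.
have mE := @eint_measurable _ _ _ _ _ _ _ _ _ ms _ _ tT.
have mE' := @eproc_measurable _ _ _ _ _ _ _ _ _ ms.
have a1 := EQ2_triangle (mE' e) meta meta' h1 ec.
rewrite EQ2C in h1'.
have a2 := EQ2_triangle (mE' e) meta' (mE' e') a1 h1'.
have a3 := le_trans (eint_E2_le e e' tT) a2.
rewrite E2C in h2.
have a4 := E2_triangle mY (mE e) (mE e') h2 a3.
have a5 := E2_triangle mY (mE e') mY' a4 h2'.
by apply: (le_trans a5); rewrite lee_fin; lra.
Qed.

Lemma is_int_unique t eta Y Y' : 0 <= t <= T -> is_int t eta Y -> is_int t eta Y' ->
  {ae P, forall w, Y w = Y' w}.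
Proof.
move=> tT h h'; have [meta mY _] := h; have [_ mY' _] := h'.
have h0 : (EQ2 eta eta <= 0%:E)%E by rewrite EQ2_refl.
have := is_int_isometry tT h h' h0; rewrite mulr0 => E20.
have m2 : measurable_fun setT (fun w => ((Y w - Y' w) ^+ 2)%:E).
  by apply/measurable_EFinP; apply: measurable_funX; exact: measurable_funB.
have [/(_ _) + _] := ae_eq_integral_abs P measurableT m2.
have -> : (\int[P]_(w in setT) `|((Y w - Y' w) ^+ 2)%:E| = 0)%E.
  apply/eqP; rewrite eq_le; apply/andP; split; last exact: integral_ge0.
  apply: le_trans E20; rewrite /E2.
  by under eq_integral do rewrite gee0_abs ?lee_fin ?sqr_ge0//.
move=> /(_ erefl); apply: filterS => w /(_ I) [] /eqP.
by rewrite sqrf_eq0 subr_eq0 => /eqP.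
Qed.

Lemma is_int_lim t eta Y : 0 <= t <= T -> mproc eta -> measurable_fun setT Y ->
  (forall eps, 0 < eps -> exists eta' Y', [/\ is_int t eta' Y',
     (EQ2 eta' eta <= eps%:E)%E & (E2 Y' Y <= eps%:E)%E]) -> is_int t eta Y.
Proof.
move=> tT meta mY H; split => // eps eps0; have e0 : 0 < eps / 4 by lra.
have [eta' [Y' [[meta' mY' H'] h1 h2]]] := H _ e0.
have [e [h3 h4]] := H' _ e0; exists e; split.
  apply: le_trans (EQ2_triangle _ meta' meta h3 h1) _; first exact: (eproc_measurable ms).
  by rewrite lee_fin; lra.
apply: le_trans (E2_triangle _ mY' mY h4 h2) _; first exact: (eint_measurable ms).
by rewrite lee_fin; lra.
Qed.

Lemma is_intD t eta eta' Y Y' : 0 <= t <= T -> is_int t eta Y -> is_int t eta' Y' ->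
  is_int t (fun s w => eta s w + eta' s w) (fun w => Y w + Y' w).
Proof.
move=> tT [meta mY H] [meta' mY' H'].
split; [exact: mprocD|exact: measurable_funD|move=> eps eps0].
have e0 : 0 < eps / 4 by lra.
have [e [h1 h2]] := H _ e0; have [e' [h1' h2']] := H' _ e0.
have mE := @eint_measurable _ _ _ _ _ _ _ _ _ ms _ _ tT.
have mE' := @eproc_measurable _ _ _ _ _ _ _ _ _ ms.
exists (e ++ e'); split.
- have a1 : (EQ2 (eproc (e ++ e')) (fun s w => eta s w + eproc e' s w)%R <= (eps / 4)%:E)%E.
    apply: le_trans h1; rewrite le_eqVlt; apply/orP; left; apply/eqP.
    rewrite /EQ2; congr EQ; apply/funext => s; apply/funext => w.
    by rewrite eproc_cat; congr (_ ^+ _); ring.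
  have a2 : (EQ2 (fun s w => eta s w + eproc e' s w)%R (fun s w => eta s w + eta' s w)%R <= (eps / 4)%:E)%E.
    apply: le_trans h1'; rewrite le_eqVlt; apply/orP; left; apply/eqP.
    rewrite /EQ2; congr EQ; apply/funext => s; apply/funext => w.
    by congr (_ ^+ _); ring.
  apply: le_trans (EQ2_triangle _ _ _ a1 a2) _; [exact: mE'|exact: mprocD|exact: mprocD|].
  by rewrite lee_fin; lra.
- have a1 : (E2 (eint M (e ++ e') t) (fun w => Y w + eint M e' t w)%R <= (eps / 4)%:E)%E.
    apply: le_trans h2; rewrite le_eqVlt; apply/orP; left; apply/eqP.
    apply: eq_integral => w _; rewrite eint_cat; congr ((_ ^+ _)%:E); ring.
  have a2 : (E2 (fun w => Y w + eint M e' t w)%R (fun w => Y w + Y' w)%R <= (eps / 4)%:E)%E.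
    apply: le_trans h2'; rewrite le_eqVlt; apply/orP; left; apply/eqP.
    apply: eq_integral => w _; congr ((_ ^+ _)%:E); ring.
  apply: le_trans (E2_triangle _ _ _ a1 a2) _; [exact: mE|exact: measurable_funD|exact: measurable_funD|].
  by rewrite lee_fin; lra.
Qed.

Lemma is_intZ t (a : R) eta Y : 0 <= t <= T -> is_int t eta Y ->
  is_int t (fun s w => a * eta s w) (fun w => a * Y w).
Proof.
move=> tT [meta mY H].
split; [exact: mprocZ|by apply: measurable_funM|move=> eps eps0].
have a20 : 0 < a ^+ 2 + 1 by rewrite ltr_wpDl ?sqr_ge0.
have e0 : 0 < eps / (a ^+ 2 + 1) by rewrite divr_gt0.
have ale : a ^+ 2 * (eps / (a ^+ 2 + 1)) <= eps.
  rewrite mulrCA -[leRHS]mulr1 ler_wpM2l ?(ltW eps0)// ler_pdivrMr// mul1r; lra.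
have [e [h1 h2]] := H _ e0.
have [e' H1 H2] := eint_scale (M := M) ms a e.
have mE := @eint_measurable _ _ _ _ _ _ _ _ _ ms e _ tT.
have mE' := @eproc_measurable _ _ _ _ _ _ _ _ _ ms e.
exists e'; split.
- have -> : EQ2 (eproc e') (fun s w => a * eta s w) =
    EQ P T Q (fun s w => a ^+ 2 * (eproc e s w - eta s w) ^+ 2 + 0 * (eproc e s w - eta s w) ^+ 2).
    rewrite /EQ2; congr EQ; apply/funext => s; apply/funext => w.
    by rewrite H1; ring.
  have m2 : mproc (fun s w => (eproc e s w - eta s w) ^+ 2) by apply: mproc_sqr; exact: mprocB.
  rewrite EQ_lin ?sqr_ge0 => //; [|by move=> s w _; exact: sqr_ge0|by move=> s w _; exact: sqr_ge0].
  rewrite mul0e adde0; apply: (@le_trans _ _ ((a ^+ 2)%:E * (eps / (a ^+ 2 + 1))%:E)%E).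
    by rewrite lee_wpmul2l// lee_fin sqr_ge0.
  by rewrite -EFinM lee_fin.
- have -> : E2 (eint M e' t) (fun w => a * Y w) = ((a ^+ 2)%:E * E2 (eint M e t) Y)%E.
    rewrite /E2 -ge0_integralZl_EFin ?sqr_ge0//.
    + by apply: eq_integral => w _; rewrite H2 -EFinM; congr EFin; ring.
    + by move=> w _; rewrite lee_fin sqr_ge0.
    + by apply/measurable_EFinP; apply: measurable_funX; exact: measurable_funB.
  apply: (@le_trans _ _ ((a ^+ 2)%:E * (eps / (a ^+ 2 + 1))%:E)%E).
    by rewrite lee_wpmul2l// lee_fin sqr_ge0.
  by rewrite -EFinM lee_fin.
Qed.

Lemma is_int_elementary t (e : seq cell) : 0 <= t <= T -> is_int t (eproc e) (eint M e t).
Proof.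
move=> tT; split; [exact: (eproc_measurable ms)|exact: (eint_measurable ms)|].
by move=> eps eps0; exists e; rewrite E2_refl EQ2_refl lee_fin ltW.
Qed.

(** A single cell on [0, T[, which differs from the constant process only at T and outside
    [0, T]. *)
Lemma is_int_cst t (a : R) : 0 <= t <= T ->
  is_int t (fun _ _ => a) (fun w => a * (M t w - M 0 w)).
Proof.
move=> tT.
have i2 : integ P (fun w => (fun=> a : R) w ^+ 2) by exact: integ_cst.
pose e : seq cell := [:: Cell (lexx 0) (ltW T0) (lexx T) (Ad_cst ms 0 a) i2].
have eE : eint M e t = (fun w => a * (M t w - M 0 w)).
  apply/funext => w; rewrite /eint big_seq1/=.
  by move: tT => /andP[t0 tT]; rewrite min_r// min_l.
split; first exact: mproc_cst.
  apply: measurable_funM => //; apply: measurable_funB; apply: (M_measurable ms) => //.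
  by rewrite lexx ltW.
move=> eps eps0; exists e; split.
  apply: (@le_trans _ _ 0%:E); last by rewrite lee_fin ltW.
  rewrite le_eqVlt; apply/orP; left; apply/eqP.
  rewrite /EQ2 (@EQ_eq_off_T _ _ _ P T Q T0 Qc _ (fun _ _ => 0)).
  - by apply: integral0_eq => w _; apply: integral0_eq.
  - move=> s w /andP[s0 sT]; rewrite /eproc /simple_process big_seq1/=.
    by rewrite indicE mem_setE in_itv/= (ltW s0) sT mulr1 subrr expr0n.
  - by apply: mproc_sqr; apply: mprocB; [exact: (eproc_measurable ms)|exact: mproc_cst].
  - exact: mproc_cst.
  - by move=> s w _; exact: sqr_ge0.
  - by [].
by rewrite eE E2_refl lee_fin ltW.
Qed.

End ito_integral.

(** * Estimates for functions of M *)

Lemma within_continuous_dist (R : realType) (f : R -> R) (a b x e : R) :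
  {within `[a, b], continuous f} -> a <= x <= b -> 0 < e ->
  exists2 dl, 0 < dl & forall y, a <= y <= b -> `|x - y| < dl -> `|f x - f y| < e.
Proof.
move=> /subspace_continuousP fc xab e0.
have xI : [set` `[a, b]] x by rewrite /= in_itv.
have /cvgrPdist_lt/(_ e e0) := fc x xI.
rewrite near_withinE => /nbhs_ballP[dl /= dl0 H]; exists dl => // y yab xy.
by apply: H => //=; rewrite in_itv.
Qed.

Lemma within_continuous_comp_real (R : realType) (f h : R -> R) (a b : R) :
  {within `[a, b], continuous f} -> continuous h ->
  {within `[a, b], continuous (fun x => h (f x))}.
Proof.
move=> /subspace_continuousP fc ch; apply/subspace_continuousP => x xab.
by apply: (@continuous_cvg _ _ _ _ _ _ h); [exact: ch|exact: fc].
Qed.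

Lemma within_uniformly_continuous (R : realType) (f : R -> R) (a b e : R) :
  {within `[a, b], continuous f} -> 0 < e ->
  exists2 dl, 0 < dl & forall x y, a <= x <= b -> a <= y <= b ->
    `|x - y| < dl -> `|f x - f y| < e.
Proof.
move=> fc e0.
have /compact_near_coveringP nc := @segment_compact R a b.
pose Pr (dl x : R) := a <= x <= b -> forall y, a <= y <= b -> `|x - y| < dl -> `|f x - f y| < e.
have H : \forall dl \near 0^'+, [set` `[a, b]] `<=` Pr dl.
  apply: nc => x; rewrite /= in_itv/= => xab.
  have e20 : 0 < e / 2 by lra.
  have [r r0 Hr] := within_continuous_dist fc xab e20.
  have r20 : 0 < r / 2 by lra.
  near=> x' dl => /= x'ab y yab x'y.
  have xx' : `|x - x'| < r / 2.
    by near: x'; exact: nbhsx_ballx.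
  have dlr : dl < r / 2.
    by near: dl; exact: nbhs_right_lt.
  have h1 := Hr x' x'ab (lt_trans xx' _).
  have h2 : `|f x - f y| < e / 2.
    apply: Hr => //; rewrite -[x - y](subrKA x').
    by rewrite (le_lt_trans (ler_normD _ _))//; lra.
  rewrite -[f x' - f y](subrKA (f x)) (le_lt_trans (ler_normD _ _))// distrC.
  by have := h1 ltac:(lra); lra.
have [dl [dl0 Hdl]] : exists dl, 0 < dl /\ [set` `[a, b]] `<=` Pr dl.
  near ((0:R)^'+) => dl; exists dl; split; first by near: dl; exact: nbhs_right_gt.
  by near: dl.
by exists dl => // x y xab; apply: Hdl; rewrite //= in_itv.
Unshelve. all: end_near. Qed.

Section grids.
Context (R : realType) (a b : R) (n : nat).
Hypotheses (ab : a <= b) (n0 : (0 < n)%N).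
Local Notation g := (grid a b n).

Lemma grid_cell s : a <= s < b -> exists k : 'I_n, g k <= s < g k.+1.
Proof.
move=> /andP[as_ sb]; have h0 : 0 < (b - a) / n%:R by rewrite divr_gt0 ?ltr0n//; lra.
have q0 : 0 <= (s - a) / ((b - a) / n%:R) by rewrite divr_ge0 ?subr_ge0// ltW.
set k := Num.truncn ((s - a) / ((b - a) / n%:R)).
have h1 : k%:R * ((b - a) / n%:R) <= s - a by rewrite -ler_pdivlMr// truncn_le.
have h2 : s - a < k.+1%:R * ((b - a) / n%:R) by rewrite -ltr_pdivrMr// truncnS_gt.
have kn : (k < n)%N.
  rewrite -(ltr_nat R) -(ltr_pM2r h0) (le_lt_trans h1)//.
  by rewrite mulrCA divff ?mulr1 ?pnatr_eq0 -?lt0n// ltrD2r.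
by exists (Ordinal kn); rewrite /grid /=; lra.
Qed.

Lemma sum_grid_indic (c : nat -> R) s (k : 'I_n) : g k <= s < g k.+1 ->
  \sum_(j < n) c j * \1_(`[g j, g j.+1[%classic) s = c k.
Proof.
move=> /andP[ks sk]; rewrite (bigD1 k)//= big1 ?addr0.
  by rewrite indicE mem_setE in_itv/= ks sk mulr1.
move=> j jk; rewrite indicE mem_setE in_itv/=.
have [jk'|kj] := ltnP j k.
  have -> : (s < g j.+1) = false; last by rewrite andbF mulr0.
  by apply/negbTE; rewrite -leNgt (le_trans _ ks)// grid_le.
rewrite leNgt (lt_le_trans sk) ?mulr0// grid_le//.
by rewrite ltn_neqAle kj eq_sym jk.
Qed.

Lemma sum_grid_indic0 (c : nat -> R) s : ~~ (a <= s < b) ->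
  \sum_(j < n) c j * \1_(`[g j, g j.+1[%classic) s = 0.
Proof.
move=> sab; rewrite big1// => j _; rewrite indicE mem_setE in_itv/=.
case h : (g j <= s < g j.+1); last by rewrite mulr0.
move: h => /andP[h1 h2].
have /andP[h3 _] := grid_itv ab (ltnW (ltn_ord j)) n0.
have /andP[_ h4] := grid_itv ab (ltn_ord j) n0.
by move/negP : sab; case; rewrite (le_trans h3)//= (lt_le_trans h2).
Qed.

End grids.

Lemma continuous_paths_measurable d (Om : measurableType d) (R : realType) (T : R)
    (X : R -> Om -> R) : 0 < T ->
  (forall t, 0 <= t <= T -> measurable_fun setT (X t)) ->
  (forall w, {within `[0, T], continuous (X ^~ w)}) ->
  measurable_fun (`[0, T] `*` setT) (fun z : measurableTypeR R * Om => X z.1 z.2).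
Proof.
move=> T0 mX cX.
pose gr n k : R := grid 0 T n.+1 k.
(* Paths frozen at the left grid points. The cells are open on the right, so the time T needs a term
   of its own. *)
pose X_ n (z : measurableTypeR R * Om) : R :=
  \sum_(k < n.+1) X (gr n k) z.2 * \1_(`[gr n k, gr n k.+1[%classic) z.1 +
  X T z.2 * \1_([set T]) z.1.
have mD : measurable (`[0, T]%classic `*` setT : set (measurableTypeR R * Om)).
  by apply: measurableX => //; exact: measurable_itv.
have mi (B : set (measurableTypeR R)) : measurable B ->
    measurable_fun setT (fun z : measurableTypeR R * Om => \1_B z.1 : R).
  move=> mB; have h : measurable_fun setT (\1_B : measurableTypeR R -> R) by exact: measurable_indic.
  exact: (measurableT_comp h (@measurable_fst _ _ _ _)).
apply: (measurable_fun_cvg (h := X_)) => [n|[s w] [/= + _]].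
  apply: measurable_funTS; apply: measurable_funD.
    apply: measurable_sum => k; apply: measurable_funM; last by apply: mi; exact: measurable_itv.
    have := mX (gr n k) (grid_itv (ltW T0) (ltnW (ltn_ord k)) isT).
    by move=> h; exact: (measurableT_comp h (@measurable_snd _ _ _ _)).
  apply: measurable_funM; last by apply: mi; exact: measurable_set1.
  have TT : 0 <= T <= T by rewrite lexx ltW.
  exact: (measurableT_comp (mX T TT) (@measurable_snd _ _ _ _)).
rewrite in_itv/= => sT.
have [sE|sne] := eqVneq s T.
  apply: cvg_near_cst; apply: nearW => n; rewrite /X_/= sE indicE mem_set//= mulr1.
  rewrite (sum_grid_indic0 (ltW T0) (ltn0Sn n) (fun k => X (gr n k) w)) ?add0r//.
  by rewrite ltxx andbF.
have sT' : 0 <= s < T by move: sT => /andP[-> ?]/=; rewrite lt_neqAle sne.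
apply/cvgrPdist_lt => e e0.
have [dl dl0 H] := within_continuous_dist (cX w) sT e0.
near=> n; rewrite /X_ /= indicE memNset ?mulr0 ?addr0; last by move=> h; rewrite h eqxx in sne.
have [k kP] := grid_cell (ltn0Sn n) sT'.
rewrite (sum_grid_indic (ltW T0) (fun k => X (gr n k) w) kP).
apply: H; first exact: (grid_itv (ltW T0) (ltnW (ltn_ord k)) isT).
move: kP => /andP[h1]; rewrite gridS subr0 => h2.
rewrite ger0_norm ?subr_ge0// ltrBlDl (lt_le_trans h2)// lerD2l.
rewrite ler_pdivrMr// mulrC -ler_pdivrMr//.
by apply: ltW; near: n; exists (Num.truncn (T / dl)) => // m /= hm;
  rewrite (lt_le_trans (truncnS_gt _))// ler_nat ltnS.
Unshelve. all: end_near. Qed.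

Section riemann_sums.
Context d (Om : measurableType d) (R : realType) (P : probability Om R) (T : R).
Context (Q : Om -> cumulative R R).
Hypotheses (T0 : 0 < T)
  (Qc : forall w, {within `[0, T], continuous (Q w : R -> R)})
  (mQ : forall t, 0 <= t <= T -> measurable_fun setT (fun w => Q w t)).
Local Notation D := (`]0%R, T]%classic : set (measurableTypeR R)).
Local Notation EQ := (EQ P T Q).
Local Notation mproc := (mproc (Om := Om) T).
Implicit Types phi : R -> Om -> R.

Lemma mproc_continuous (X : R -> Om -> R) :
  (forall t, 0 <= t <= T -> measurable_fun setT (X t)) ->
  (forall w, {within `[0, T], continuous (X ^~ w)}) -> mproc X.
Proof.
move=> mX cX; apply: measurable_funS (continuous_paths_measurable T0 mX cX).
  by apply: measurableX => //; exact: measurable_itv.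
move=> [s w] [/= + _]; rewrite in_itv/= => /andP[s0 sT].
by split => //=; rewrite in_itv/= (ltW s0).
Qed.

Lemma mproc_indic u v : mproc (fun s w => \1_(`[u, v[%classic) s).
Proof.
apply: measurable_funTS.
have h : measurable_fun setT (\1_(`[u, v[%classic) : measurableTypeR R -> R).
  by apply: measurable_indic; exact: measurable_itv.
exact: (measurableT_comp h (@measurable_fst _ _ _ _)).
Qed.

Lemma EQ0 : EQ (fun _ _ => 0) = 0%E.
Proof. by apply: integral0_eq => w _; apply: integral0_eq. Qed.

Lemma EQZ_le (k b : R) phi : mproc phi -> (forall s w, D s -> 0 <= phi s w) -> 0 <= k ->
  (EQ phi <= b%:E)%E -> (EQ (fun s w => k * phi s w)%R <= (k * b)%:E)%E.
Proof.
move=> mphi phi0 k0 H.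
rewrite (_ : (fun s w => _) = (fun s w => k * phi s w + 0 * phi s w)); last first.
  by apply/funext => s; apply/funext => w; rewrite mul0r addr0.
by rewrite EQ_lin// mul0e adde0 EFinM lee_wpmul2l ?lee_fin.
Qed.

Lemma EQ_sum (I : Type) (e : seq I) (c : I -> R) (phi : I -> R -> Om -> R) (b : I -> R) :
  (forall i, mproc (phi i)) -> (forall i s w, D s -> 0 <= phi i s w) ->
  (forall i, 0 <= c i) -> (forall i, (EQ (phi i) <= (b i)%:E)%E) ->
  (EQ (fun s w => \sum_(i <- e) c i * phi i s w)%R <= (\sum_(i <- e) c i * b i)%:E)%E.
Proof.
move=> mphi phi0 c0 H; elim: e => [|i e IH].
  by under eq_fun do under eq_fun do rewrite big_nil; rewrite EQ0 big_nil.
under eq_fun do under eq_fun do rewrite big_cons.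
rewrite (_ : (fun s w => _) = (fun s w => c i * phi i s w + 1 * \sum_(j <- e) c j * phi j s w)); last first.
  by apply/funext => s; apply/funext => w; rewrite mul1r.
have me : mproc (fun s w => \sum_(j <- e) c j * phi j s w).
  by apply: measurable_sum => j; exact: mprocZ.
rewrite EQ_lin//; last by move=> s w Ds; apply: sumr_ge0 => j _; rewrite mulr_ge0 ?phi0.
by rewrite big_cons mul1e [leRHS]EFinD leeD// [leRHS]EFinM lee_wpmul2l ?lee_fin.
by move=> s w; exact: phi0.
Qed.

Definition riemann_sum (phi : R -> Om -> R) (u v : R) n w : R :=
  \sum_(k < n) phi (grid u v n k) w * (Q w (grid u v n k.+1) - Q w (grid u v n k)).

(* Fatou's lemma along the step processes that freeze phi on a grid. *)
Lemma EQ_riemann phi u v c : 0 <= u -> u <= v -> v <= T ->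
  (forall t, 0 <= t <= T -> measurable_fun setT (phi t)) ->
  (forall s w, 0 <= s <= T -> 0 <= phi s w) ->
  (forall w, {within `[0, T], continuous (phi ^~ w)}) ->
  (forall e, 0 < e -> exists n0, forall n, (n0 <= n)%N -> (0 < n)%N ->
     (\int[P]_w (riemann_sum phi u v n w)%:E <= (c + e)%:E)%E) ->
  (EQ (fun s w => phi s w * \1_(`[u, v[%classic) s)%R <= c%:E)%E.
Proof.
move=> u0 uv vT mphi phi0 cphi H.
have gI n k : (k <= n.+1)%N -> 0 <= grid u v n.+1 k <= T.
  move=> kn; have /andP[h1 h2] := grid_itv uv kn (ltn0Sn n).
  by rewrite (le_trans u0 h1) (le_trans h2 vT).
pose lo n (k : 'I_n.+1) := grid u v n.+1 k.
pose hi n (k : 'I_n.+1) := grid u v n.+1 k.+1.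
pose xi n (k : 'I_n.+1) := phi (grid u v n.+1 k).
pose f n := simple_process (index_enum 'I_n.+1) (lo n) (hi n) (xi n).
have mxi n k : measurable_fun setT (xi n k) by apply: mphi; apply: gI; exact: ltnW.
apply: (@EQ_fatou _ _ _ P T Q T0 mQ f) => //.
- by move=> n; exact: simple_process_measurable.
- move=> n s w _; apply: sumr_ge0 => k _; rewrite mulr_ge0//.
  by apply: phi0; apply: gI; exact: ltnW.
- move=> s w; rewrite /= in_itv/= => /andP[s0 sT].
  have [suv|suv] := boolP (u <= s < v); last first.
    rewrite indicE mem_setE in_itv/= (negbTE suv) mulr0.
    apply: cvg_near_cst; apply: nearW => n; rewrite /f /simple_process /xi.
    exact: (sum_grid_indic0 uv (ltn0Sn n) (phi ^~ w \o grid u v n.+1)).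
  rewrite indicE mem_setE in_itv/= suv mulr1.
  apply/cvgrPdist_lt => e e0; have sI : 0 <= s <= T by rewrite (ltW s0).
  have [dl dl0 Hd] := within_continuous_dist (cphi w) sI e0.
  near=> n; have [k kP] := grid_cell (ltn0Sn n) suv.
  rewrite /f /simple_process /xi (sum_grid_indic uv (phi ^~ w \o grid u v n.+1) kP)/=.
  apply: Hd; first by apply: gI; exact: ltnW.
  move: kP => /andP[h1]; rewrite gridS => h2.
  rewrite ger0_norm ?subr_ge0// ltrBlDl (lt_le_trans h2)// lerD2l.
  rewrite ler_pdivrMr// mulrC -ler_pdivrMr//.
  by apply: ltW; near: n; exists (Num.truncn ((v - u) / dl)) => // m /= hm;
    rewrite (lt_le_trans (truncnS_gt _))// ler_nat ltnS.
- move=> e e0; have [n0 Hn0] := H e e0; exists n0 => n n0n.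
  apply: le_trans (Hn0 n.+1 (leqW n0n) isT).
  rewrite le_eqVlt; apply/orP; left; apply/eqP; apply: eq_integral => w _.
  rewrite /f IQ_simple//.
  + by move=> k; have /andP[] := gI n k (ltnW (ltn_ord k)).
  + by move=> k; exact: grid_le.
  + by move=> k; have /andP[] := gI n k.+1 (ltn_ord k).
Unshelve. all: end_near. Qed.

End riemann_sums.

Section integrand_estimates.
Context d (Om : measurableType d) (R : realType) (P : probability Om R) (T Lam : R).
Context (Ad : R -> (Om -> R) -> Prop) (M : R -> Om -> R) (Q : Om -> cumulative R R).
Hypothesis ms : martingale_setting P T Lam Ad M Q.

Let T0 : 0 < T := ms_T ms.
Let Qc := Q_continuous ms.
Let mQ := Q_measurable ms.
Local Notation D := (`]0%R, T]%classic : set (measurableTypeR R)).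
Local Notation mproc := (mproc (Om := Om) T).
Local Notation EQ := (EQ P T Q).
Implicit Types phi : R -> Om -> R.

Lemma continuous_comp_path (h : R -> R) w : continuous h ->
  {within `[0, T], continuous (fun s => h (M s w))}.
Proof.
by move=> ch; apply: within_continuous_comp_real => //; exact: (M_continuous ms).
Qed.

Lemma Ex_increment2 s t : 0 <= s -> s <= t -> t <= T ->
  Ex P (fun w => (M t w - M s w) ^+ 2) <= Lam * (t - s).
Proof.
move=> s0 st tT.
have [_] := Ex_variance ms s0 st tT (Ad_cst ms s 1) (fun=> ler01) (integ_cst P 1).
by rewrite Ex_cst mulr1 (eq_Ex P (g := fun w => (M t w - M s w) ^+ 2))// => w; rewrite mul1r.
Qed.

(** On each grid cell the integrand is frozen at the left end, where it is known; there [Ex_Q] and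
    the variance bound replace dQ by [Lam] ds in expectation. *)
Lemma EQ_adapted_le phi u v B : 0 <= u -> u <= v -> v <= T ->
  (forall t, 0 <= t <= T -> measurable_fun setT (phi t)) ->
  (forall s w, 0 <= s <= T -> 0 <= phi s w) ->
  (forall w, {within `[0, T], continuous (phi ^~ w)}) ->
  (forall s, u <= s <= v -> Ad s (phi s) /\ integ P (phi s) /\ Ex P (phi s) <= B) ->
  (EQ (fun s w => phi s w * \1_(`[u, v[%classic) s)%R <= (Lam * (v - u) * B)%:E)%E.
Proof.
move=> u0 uv vT mphi phi0 cphi H; apply: (EQ_riemann T0 Qc mQ) => // e e0; exists 0%N => n _ n0.
have gI k : (k <= n)%N -> u <= grid u v n k <= v by move=> kn; exact: grid_itv.
have step (k : 'I_n) : integ P (fun w => phi (grid u v n k) w *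
      (Q w (grid u v n k.+1) - Q w (grid u v n k))) /\
    Ex P (fun w => phi (grid u v n k) w * (Q w (grid u v n k.+1) - Q w (grid u v n k))) <=
    Lam * ((v - u) / n%:R) * B.
  have kg := gI k (ltnW (ltn_ord k)); have /andP[g1 g2] := kg.
  have /andP[g3 g4] := gI k.+1 (ltn_ord k).
  have [A1 [i1 B1]] := H _ kg.
  have gg : grid u v n k <= grid u v n k.+1 by exact: grid_le.
  have gk0 := le_trans u0 g1; have gT := le_trans g4 vT.
  have p0 w : 0 <= phi (grid u v n k) w by apply: phi0; rewrite gk0 (le_trans g2 vT).
  have [iQ EE] := Ex_Q ms gk0 gg gT A1 i1.
  split => //; rewrite -EE.
  have [_ EV] := Ex_variance ms gk0 gg gT A1 p0 i1.
  apply: le_trans EV _; rewrite gridS addrAC subrr add0r ler_wpM2l//.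
  by rewrite mulr_ge0 ?(ms_Lam ms)// divr_ge0// subr_ge0.
rewrite integE; last by apply: (integ_sum (index_enum 'I_n)) => k; exact: (step k).1.
rewrite lee_fin Ex_sum; last by move=> k; exact: (step k).1.
apply: (@le_trans _ _ (\sum_(k < n) Lam * ((v - u) / n%:R) * B)).
  by apply: ler_sum => k _; exact: (step k).2.
rewrite sumr_const card_ord -[leLHS]mulr_natl.
rewrite [leLHS](_ : _ = Lam * (v - u) * B); first by rewrite lerDl ltW.
by field; rewrite pnatr_eq0 -lt0n.
Qed.

Lemma M_mproc : mproc M.
Proof. by apply: mproc_continuous => //; [exact: (M_measurable ms)|exact: (M_continuous ms)]. Qed.

Lemma Lip_continuous_real (h : R -> R) K : (forall x y, `|h x - h y| <= K * `|x - y|) -> continuous h.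
Proof. by move=> hl; exact: locally_lipschitz_continuous (lipschitz_locally hl). Qed.

Lemma EQ_off_T phi : (forall t, 0 <= t <= T -> measurable_fun setT (phi t)) ->
  (forall s w, 0 <= s <= T -> 0 <= phi s w) ->
  (forall w, {within `[0, T], continuous (phi ^~ w)}) ->
  EQ phi = EQ (fun s w => phi s w * \1_(`[0, T[%classic) s).
Proof.
move=> mphi phi0 cphi; have mp := mproc_continuous T0 mphi cphi.
have sI s : D s -> 0 <= s <= T by rewrite /= in_itv/= => /andP[/ltW-> ->].
apply: (@EQ_eq_off_T _ _ _ P T Q T0 Qc) => //.
- by move=> s w /andP[s0 sT]; rewrite indicE mem_setE in_itv/= (ltW s0) sT mulr1.
- by apply: mprocM => //; exact: mproc_indic.
- by move=> s w /sI; exact: phi0.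
- by move=> s w /sI h; rewrite mulr_ge0 ?phi0// indicE.
Qed.

Definition grid_process (h : R -> R) n s w : R :=
  \sum_(k < n) h (M (grid 0 T n k) w) * \1_(`[grid 0 T n k, grid 0 T n k.+1[%classic) s.

(** Over one grid step M moves by at most [Lam * (T / n)] in mean square, and dQ is dominated in
    expectation by [Lam] ds; the n cells together leave one factor 1/n. *)
Lemma grid_process_error (h : R -> R) K n : (0 < n)%N ->
  (forall x y, `|h x - h y| <= K * `|x - y|) ->
  (EQ2 P T Q (grid_process h n) (fun s w => h (M s w)) <=
    (K ^+ 2 * Lam ^+ 2 * T ^+ 2 / n%:R)%:E)%E.
Proof.
move=> n0 hl; have hc := Lip_continuous_real hl.
have TT := ltW T0.
pose g := grid 0 T n.
have gI k : (k <= n)%N -> 0 <= g k <= T by move=> kn; exact: grid_itv.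
have gg k : g k <= g k.+1 by exact: grid_le.
pose phi (k : 'I_n) s w := (h (M (g k) w) - h (M s w)) ^+ 2.
have mh t : 0 <= t <= T -> measurable_fun setT (fun w => h (M t w)).
  by move=> tT; apply: measurableT_comp; [exact: continuous_measurable_fun|exact: (M_measurable ms)].
have mphi k t : 0 <= t <= T -> measurable_fun setT (phi k t).
  by move=> tT; apply: measurable_funX; apply: measurable_funB; apply: mh => //; apply: gI; exact: ltnW.
have cphi k w : {within `[0, T], continuous (phi k ^~ w)}.
  apply: (@continuous_comp_path (fun x => (h (M (g k) w) - h x) ^+ 2)) => x.
  by apply: (@continuous_comp _ _ _ (fun x => h (M (g k) w) - h x) (fun x => x ^+ 2));
    [apply: cvgB; [exact: cvg_cst|exact: hc]|exact: exprn_continuous].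
have sI s : D s -> 0 <= s <= T by rewrite /= in_itv/= => /andP[/ltW-> ->].
have mpk k : mproc (fun s w => phi k s w * \1_(`[g k, g k.+1[%classic) s).
  apply: mprocM; last exact: mproc_indic.
  by apply: mproc_continuous => //; exact: mphi.
have mg : mproc (grid_process h n).
  apply: (@simple_process_measurable _ _ _ T _ (index_enum 'I_n) (fun k => g k) (fun k => g k.+1) (fun k w => h (M (g k) w))).
  by move=> k; apply: mh; apply: gI; exact: ltnW.
have mhM : mproc (fun s w => h (M s w)).
  by apply: mproc_continuous => //; move=> w; exact: continuous_comp_path.
rewrite /EQ2 (@EQ_eq_off_T _ _ _ P T Q T0 Qc _ (fun s w => \sum_(k <- index_enum 'I_n) 1 * (phi k s w * \1_(`[g k, g k.+1[%classic) s))).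
- rewrite (_ : (K ^+ 2 * _ * _ / _)%:E = (\sum_(k <- index_enum 'I_n) 1 * (Lam * (T / n%:R) * (K ^+ 2 * (Lam * (T / n%:R)))))%:E).
    apply: EQ_sum => //.
      by move=> k s w _; rewrite mulr_ge0 ?sqr_ge0// indicE.
    move=> k; have kn := ltn_ord k.
    have /andP[gk0 gkT] := gI k (ltnW kn); have /andP[_ gT] := gI k.+1 kn.
    rewrite -{1}(_ : g k.+1 - g k = T / n%:R); last by rewrite /g gridS subr0 addrAC subrr add0r.
    apply: EQ_adapted_le => //; [exact: mphi|by move=> *; exact: sqr_ge0|].
    move=> s /andP[ks sk]; have sT : 0 <= s <= T by rewrite (le_trans gk0 ks) (le_trans sk gT).
    have ll := lipschitz_locally hl.
    have Ak : Ad s (fun w => h (M (g k) w)).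
      by apply: (Ad_le ms ks); apply: (Ad_comp ms) => //; apply: (Ad_M ms); rewrite gk0.
    have As : Ad s (fun w => h (M s w)) by apply: (Ad_comp ms) => //; exact: (Ad_M ms).
    have i1 : integ P (fun w => (M s w - M (g k) w) ^+ 2).
      by apply: (integ_increment2 ms) => //; rewrite gk0.
    have le1 w : phi k s w <= K ^+ 2 * (M s w - M (g k) w) ^+ 2.
      rewrite /phi -real_normK ?num_real// -[X in K ^+ 2 * X]real_normK ?num_real// -exprMn.
      rewrite lerXn2r ?nnegrE//; first exact: le_trans (hl _ _).
      by rewrite distrC (le_trans (hl _ _)) .
    have i2 : integ P (phi k s).
      apply: (integ_le _ _ (integZ (K ^+ 2) i1)); first exact: mphi.
      move=> w; have p0 : 0 <= phi k s w by exact: sqr_ge0.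
      by rewrite (ger0_norm p0) (le_trans (le1 w))// ler_norm.
    split; [|split => //].
      by apply: (Ad_comp ms (@sqr_locally_lipschitz R)); exact: (Ad_sub ms).
    rewrite (le_trans (Ex_le i2 (integZ (K ^+ 2) i1) le1))// ExZ// ler_wpM2l ?sqr_ge0//.
    have sTT : s <= T by case/andP: sT.
    apply: le_trans (Ex_increment2 gk0 ks sTT) _; rewrite ler_wpM2l ?(ms_Lam ms)//.
    by move: sk; rewrite /g gridS subr0; lra.
  congr EFin; rewrite sumr_const card_ord -mulr_natl.
  by field; rewrite pnatr_eq0 -lt0n.
- move=> s w /andP[s0 sT].
  have sT' : 0 <= s < T by rewrite (ltW s0).
  have [k kP] := grid_cell n0 sT'.
  rewrite /grid_process (sum_grid_indic TT (fun k => h (M (grid 0 T n k) w)) kP).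
  under eq_bigr do rewrite mul1r.
  by rewrite (sum_grid_indic TT (fun j => (h (M (g j) w) - h (M s w)) ^+ 2) kP).
- by apply: mproc_sqr; exact: mprocB.
- by apply: measurable_sum => k; apply: measurable_funM; [exact: measurable_cst|exact: mpk].
- by move=> s w _; exact: sqr_ge0.
- move=> s w _; apply: sumr_ge0 => k _.
  by rewrite mul1r mulr_ge0 ?sqr_ge0// indicE.
Qed.

(** The square of [excess K] is convex with derivative [2 * excess K]. The linear term of its
    tangent at M_s has expectation 0 along the martingale, so the expectation of the square is
    largest at T. *)
Lemma excess_tail K : 0 <= K ->
  (EQ (fun s w => excess K (M s w) ^+ 2)%R <=
    (Lam * T * Ex P (fun w => excess K (M T w) ^+ 2)%R)%:E)%E.
Proof.
move=> K0; have TT := ltW T0; have hl := @excess_lip R K; have hc := Lip_continuous_real hl.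
have mh t : 0 <= t <= T -> measurable_fun setT (fun w => excess K (M t w)).
  by move=> tT; apply: measurableT_comp; [exact: continuous_measurable_fun|exact: (M_measurable ms)].
have c2 : continuous (fun x => excess K x ^+ 2).
  by move=> x; apply: (@continuous_comp _ _ _ (excess K) (fun x => x ^+ 2)); [exact: hc|exact: exprn_continuous].
have m2 t : 0 <= t <= T -> measurable_fun setT (fun w => excess K (M t w) ^+ 2).
  by move=> tT; apply: measurable_funX; exact: mh.
rewrite EQ_off_T//; last 2 first.
- by move=> *; exact: sqr_ge0.
- by move=> w; exact: (continuous_comp_path (h := fun x => excess K x ^+ 2)).
rewrite -[X in Lam * X]subr0; apply: EQ_adapted_le => //.
- by move=> *; exact: sqr_ge0.
- by move=> w; exact: (continuous_comp_path (h := fun x => excess K x ^+ 2)).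
move=> s sT; have /andP[s0 sT'] := sT.
have AE : Ad s (fun w => excess K (M s w)).
  by apply: (Ad_comp ms (lipschitz_locally hl)); exact: (Ad_M ms).
have ie t : 0 <= t <= T -> integ P (fun w => excess K (M t w) ^+ 2).
  move=> tT; apply: (integ_le _ _ (M_sq ms tT)); first exact: m2.
  move=> w; rewrite !ger0_norm ?sqr_ge0// -real_normK ?num_real// -[leRHS]real_normK ?num_real//.
  rewrite lerXn2r ?nnegrE//.
  by have := excess_dist (M t w) (y := 0) (K := K); rewrite normr0 subr0; apply.
split; [|split].
- exact: (Ad_comp ms (@sqr_locally_lipschitz R)).
- exact: ie.
have tT : 0 <= T <= T by rewrite lexx TT.
have iM : integ P (fun w => 2 * excess K (M s w) * (M T w - M s w)).
  apply: (@eq_integ _ _ _ _ (fun w => 2 * (excess K (M s w) * (M T w - M s w)))).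
    by move=> w; rewrite mulrA.
  apply: integZ; apply: integ_sqrM; [exact: mh| |exact: ie|exact: (integ_increment2 ms)].
  by apply: measurable_funB; exact: (M_measurable ms).
have E0 : Ex P (fun w => 2 * excess K (M s w) * (M T w - M s w)) = 0.
  by apply: (Ex_martingale ms) => //; exact: (Ad_scale ms).
rewrite -[leLHS]addr0 -E0 -ExD//; last exact: ie.
apply: Ex_le; [by apply: integD => //; exact: ie|exact: ie|].
by move=> w; exact: excess_convex.
Qed.

Let max_increment n w : R :=
  \big[Num.max/0]_(k < n) `|M (grid 0 T n k.+1) w - M (grid 0 T n k) w|.

Let max_increment_measurable n : (0 < n)%N -> measurable_fun setT (max_increment n).
Proof.
move=> n0; rewrite /max_increment; elim: (index_enum _) => [|k e IH].
  by under eq_fun do rewrite big_nil; exact: measurable_cst.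
under eq_fun do rewrite big_cons; apply: measurable_maxr => //.
apply: measurableT_comp => //; apply: measurable_funB; apply: (M_measurable ms).
  exact: (grid_itv (ltW T0) (ltn_ord k) n0).
exact: (grid_itv (ltW T0) (ltnW (ltn_ord k)) n0).
Qed.

Let max_increment_cvg w : max_increment n w @[n --> \oo] --> 0.
Proof.
apply/cvgr0Pnorm_le => e e0.
have cM : {within `[0, T], continuous (M ^~ w)} by exact: (M_continuous ms).
have [dl dl0 H] := within_uniformly_continuous cM e0.
near=> n.
have n0 : (0 < n)%N by near: n; exact: nbhs_infty_gt.
have TT := ltW T0.
have max0 : 0 <= max_increment n w.
  by rewrite /max_increment; elim/big_ind: _ => // x y *; rewrite le_max; apply/orP; left.
rewrite ger0_norm//; rewrite /max_increment.
elim/big_ind: _ => [|x y *|k _]; [exact: ltW|by rewrite ge_max; apply/andP|].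
apply/ltW/H; rewrite ?(grid_itv TT (ltn_ord k) n0) ?(grid_itv TT (ltnW (ltn_ord k)) n0)//.
rewrite gridS addrAC subrr add0r subr0 ger0_norm ?divr_ge0// ltr_pdivrMr ?ltr0n//.
rewrite mulrC -ltr_pdivrMr//; near: n.
exists (Num.truncn (T / dl)).+1 => // m /= hm.
by rewrite (lt_le_trans (truncnS_gt _))// ler_nat.
Unshelve. all: end_near. Qed.

(** The ramp is a continuous stand-in for the event that some increment reaches r. No common
    majorant of the sums of squares is at hand, so they are exchanged for the fixed integrable Q_T -
    Q_0 at the cost of their L1 distance; dominated convergence then applies. *)
Let big_increments r e : 0 < r -> 0 < e -> exists n0, forall n, (n0 <= n)%N -> (0 < n)%N ->
  integ P (fun w => sq_variation M 0 T n w * ramp 0 r (max_increment n w)) /\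
  Ex P (fun w => sq_variation M 0 T n w * ramp 0 r (max_increment n w)) <= e.
Proof.
move=> r0 e0; have TT := ltW T0; have e20 : 0 < e / 2 by lra.
have [n1 H1] := sq_variation_cvg ms (lexx 0) TT (lexx T) e20.
have ramp_c : continuous (ramp 0 r : R -> R).
  by apply: (@Lip_continuous_real _ r^-1) => x y; exact: ramp_lip.
have rm n : (0 < n)%N -> measurable_fun setT (fun w => ramp 0 r (max_increment n w)).
  move=> n0; apply: measurableT_comp; first exact: continuous_measurable_fun.
  exact: max_increment_measurable.
have r01 n w : `|ramp 0 r (max_increment n w)| <= 1.
  by have /andP[h1 h2] := ramp_itv 0 r (max_increment n w); rewrite ger0_norm.
have iQ := integ_Q ms (lexx 0) TT (lexx T).
have [_ cQ] : integ P (fun=> 0) /\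
    Ex P (fun w => (Q w T - Q w 0) * ramp 0 r (max_increment n.+1 w)) @[n --> \oo] --> Ex P (fun=> 0).
  apply: (dominated_Ex _ _ _ _ iQ).
  - by move=> n; apply: measurable_funM; [exact: integ_measurable iQ|exact: rm].
  - exact: measurable_cst.
  - apply: aeW => w; rewrite -[X in _ --> X](mulr0 (Q w T - Q w 0)); apply: cvgMr.
    rewrite -[X in _ --> X](ramp0 r0 (lexx 0)).
    apply: (@continuous_cvg _ _ _ _ _ _ (ramp 0 r)); first exact: ramp_c.
    by have := max_increment_cvg w; rewrite -cvg_shiftS.
  - move=> n w; have Q0' : 0 <= Q w T - Q w 0 by rewrite subr_ge0; exact: cumulative_is_nondecreasing.
    by rewrite normrM ger0_norm// ler_piMr.
have [n2 _ H2] : \forall n \near \oo, Ex P (fun w => (Q w T - Q w 0) * ramp 0 r (max_increment n.+1 w)) <= e / 2.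
  move: cQ; rewrite Ex_cst => /cvgr0Pnorm_le/(_ _ e20); apply: filterS => n.
  by apply: le_trans; exact: ler_norm.
exists (maxn n1 n2).+1 => -[//|n]; rewrite ltnS geq_max => /andP[n1n n2n] _.
have [i1 E1] := H1 n.+1 (leqW n1n) isT.
have E2' := H2 n n2n.
have i2 : integ P (fun w => (Q w T - Q w 0) * ramp 0 r (max_increment n.+1 w)).
  apply: (@eq_integ _ _ _ _ (fun w => ramp 0 r (max_increment n.+1 w) * (Q w T - Q w 0))).
    by move=> w; rewrite mulrC.
  by apply: (integ_boundedM _ _ iQ); [exact: rm|exact: r01].
have V0 w : 0 <= sq_variation M 0 T n.+1 w by apply: sumr_ge0 => k _; exact: sqr_ge0.
have le1 w : sq_variation M 0 T n.+1 w * ramp 0 r (max_increment n.+1 w) <=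
    `|sq_variation M 0 T n.+1 w - (Q w T - Q w 0)| +
    (Q w T - Q w 0) * ramp 0 r (max_increment n.+1 w).
  have /andP[h1 h2] := ramp_itv 0 r (max_increment n.+1 w).
  have h3 := ler_norm (sq_variation M 0 T n.+1 w - (Q w T - Q w 0)).
  have h4 := normr_ge0 (sq_variation M 0 T n.+1 w - (Q w T - Q w 0)).
  by rewrite -lerBlDr -mulrBl (le_trans (ler_wpM2r h1 h3))// ler_piMr.
have i3 : integ P (fun w => sq_variation M 0 T n.+1 w * ramp 0 r (max_increment n.+1 w)).
  apply: (integ_le _ _ (integD i1 i2)).
    apply: measurable_funM; last exact: rm.
    exact: (sq_variation_measurable ms).
  move=> w; rewrite ger0_norm; first by rewrite (le_trans (le1 w))// ler_norm.
  by rewrite mulr_ge0//; case/andP: (ramp_itv 0 r (max_increment n.+1 w)).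
split => //; rewrite (le_trans (Ex_le i3 (integD i1 i2) le1))// ExD//; lra.
Qed.

(* On increments of size at most r, the square is at most twice the excess over
   its tangent of the Huber function of threshold 2 r, whose increments telescope;
   the contribution of the larger increments vanishes by path continuity. *)
Lemma EQ_level_set c r : 0 < r ->
  (EQ (fun s w => (`|M s w - c| <= r / 2)%R%:R)%R <=
    (4 * r * Ex P (fun w => `|M T w - M 0 w|)%R)%:E)%E.
Proof.
move=> r0; have TT := ltW T0; have r20 : 0 < r / 2 by lra.
(* A Lipschitz bump, 1 on the window and 0 beyond distance r from c: being continuous, it can be
   frozen on grids. *)
pose k (x : R) := 1 - ramp (r / 2) (r / 2) `|x - c|.
have k01 x : 0 <= k x <= 1.
  by have := ramp_itv (r / 2) (r / 2) `|x - c|; rewrite /k; lra.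
have k1 x : `|x - c| <= r / 2 -> k x = 1 by move=> h; rewrite /k ramp0// subr0.
have k0 x : r < `|x - c| -> k x = 0 by move=> h; rewrite /k ramp1 ?subrr//; lra.
have kl x y : `|k x - k y| <= (r / 2)^-1 * `|x - y|.
  rewrite /k opprB addrC addrA subrK distrC (le_trans (ramp_lip _ _ _ r20))//.
  apply: ler_wpM2l; first by rewrite invr_ge0 ltW.
  rewrite (le_trans (ler_dist_dist _ _))//.
  by rewrite (_ : x - c - _ = x - y)//; ring.
have kc := Lip_continuous_real kl.
have mM t : 0 <= t <= T -> measurable_fun setT (M t) by exact: (M_measurable ms).
have mk t : 0 <= t <= T -> measurable_fun setT (fun w => k (M t w)).
  by move=> tT; apply: measurableT_comp; [exact: continuous_measurable_fun|exact: mM].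
have ck w : {within `[0, T], continuous (fun s => k (M s w))} by exact: continuous_comp_path.
have kM0 s w : 0 <= k (M s w) by case/andP: (k01 (M s w)).
apply: (@le_trans _ _ (EQ (fun s w => k (M s w)))).
  apply: EQ_le => //.
  - pose h : measurableTypeR R -> R := \1_(`[c - r / 2, c + r / 2]%classic).
    have mh : measurable_fun setT h by apply: measurable_indic; exact: measurable_itv.
    have := measurableT_comp mh M_mproc; apply: eq_measurable_fun => -[s w] _ /=.
    by rewrite /h indicE mem_setE in_itv/= ler_distl.
  - exact: mproc_continuous.
  - move=> s w _; case: (boolP (`|M s w - c| <= r / 2)) => h /=; last exact: kM0.
    by rewrite k1.
rewrite EQ_off_T//; apply: (EQ_riemann T0 Qc mQ) => // e e0.
have [n1 H1] := big_increments r0 e0; exists n1 => n n1n n0.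
have [iV EV] := H1 n n1n n0.
pose g i := grid 0 T n i; pose dM i w := M (g i.+1) w - M (g i) w.
have gI i : (i <= n)%N -> 0 <= g i <= T by move=> h; exact: grid_itv.
have gg i : g i <= g i.+1 by exact: grid_le.
have step (i : 'I_n) :
    [/\ integ P (fun w => k (M (g i) w) * (Q w (g i.+1) - Q w (g i))),
        integ P (fun w => k (M (g i) w) * dM i w ^+ 2),
        Ex P (fun w => k (M (g i) w) * (Q w (g i.+1) - Q w (g i))) =
          Ex P (fun w => k (M (g i) w) * dM i w ^+ 2),
        integ P (fun w => clamp (2 * r) (M (g i) w - c) * dM i w) &
        Ex P (fun w => clamp (2 * r) (M (g i) w - c) * dM i w) = 0].
  have gi := gI i (ltnW (ltn_ord i)); have /andP[g0 g1] := gi.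
  have gi1 := gI i.+1 (ltn_ord i); have /andP[_ g2] := gi1.
  have Ak : Ad (g i) (fun w => k (M (g i) w)).
    by apply: (Ad_comp ms (lipschitz_locally kl)); exact: (Ad_M ms).
  have ik : integ P (fun w => k (M (g i) w)).
    apply: (@integ_bounded _ _ _ _ _ 1); first exact: mk.
    by move=> w; case/andP: (k01 (M (g i) w)) => h1 h2; rewrite ger0_norm.
  have [j1 j2] := Ex_Q ms g0 (gg i) g2 Ak ik.
  have j3 := integ_variance ms g0 (gg i) g2 Ak ik.
  have Ac : Ad (g i) (fun w => clamp (2 * r) (M (g i) w - c)).
    apply: (Ad_comp ms (clamp_locally_lipschitz (2 * r))).
    by apply: (Ad_sub ms); [exact: (Ad_M ms)|exact: (Ad_cst ms)].
  have j4 : integ P (fun w => clamp (2 * r) (M (g i) w - c) * dM i w).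
    apply: (@integ_boundedM _ _ _ _ _ _ (2 * r)).
    - exact: (Ad_measurable ms Ac).
    - by move=> w; apply: clamp_le; lra.
    - by apply: integB; exact: (integ_M ms).
  by split => //; apply: (Ex_martingale ms).
have iS : integ P (fun w => \sum_(i <- index_enum 'I_n) k (M (g i) w) * dM i w ^+ 2).
  by apply: integ_sum => i; have [] := step i.
have iC : integ P (fun w => \sum_(i <- index_enum 'I_n) clamp (2 * r) (M (g i) w - c) * dM i w).
  by apply: integ_sum => i; have [] := step i.
have hT : 0 <= T <= T by rewrite TT lexx.
have h0 : 0 <= (0 : R) <= T by rewrite TT lexx.
have iD : integ P (fun w => `|M T w - M 0 w|).
  by apply: integ_norm; apply: integB; exact: (integ_M ms).
have r2 : 0 <= 2 * r by lra.
(* 4r is twice the Lipschitz constant 2r of the Huber function; the sum with factor -2 has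
   expectation 0. *)
pose F w := 4 * r * `|M T w - M 0 w| +
  (-2) * (\sum_(i <- index_enum 'I_n) clamp (2 * r) (M (g i) w - c) * dM i w) +
  sq_variation M 0 T n w * ramp 0 r (max_increment n w).
have iF1 := integD (integZ (4 * r) iD) (integZ (-2) iC).
have iF : integ P F by exact: (integD iF1 iV).
rewrite integE; last by apply: (integ_sum (index_enum 'I_n)) => i; have [] := step i.
rewrite lee_fin Ex_sum; last by move=> i; have [] := step i.
have -> : \sum_(i < n) Ex P (fun w => k (M (g i) w) * (Q w (g i.+1) - Q w (g i))) =
   Ex P (fun w => \sum_(i <- index_enum 'I_n) k (M (g i) w) * dM i w ^+ 2).
  by rewrite Ex_sum; [apply: eq_bigr => i _|move=> i]; have [] := step i.
apply: (@le_trans _ _ (Ex P F)); last first.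
  rewrite (ExD iF1 iV) (ExD (integZ (4 * r) iD) (integZ (-2) iC)) !ExZ// Ex_sum; last first.
    by move=> i; have [] := step i.
  rewrite big1 ?mulr0 ?addr0; last by move=> i _; have [] := step i.
  by rewrite lerD2l.
apply: Ex_le => // w.
pose hu x := huber (2 * r) (x - c).
have tel : \sum_(i < n) (hu (M (g i.+1) w) - hu (M (g i) w)) <= 2 * r * `|M T w - M 0 w|.
  rewrite -(big_mkord xpredT (fun i => hu (M (g i.+1) w) - hu (M (g i) w))).
  rewrite telescope_sumr// /g gridn// grid0 /hu (le_trans (huber_lip _ _ r2))//.
  by rewrite (_ : M T w - c - _ = M T w - M 0 w)//; ring.
apply: (@le_trans _ _ (2 * (\sum_(i < n) (hu (M (g i.+1) w) - hu (M (g i) w))) +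
  (-2) * (\sum_(i <- index_enum 'I_n) clamp (2 * r) (M (g i) w - c) * dM i w) +
  sq_variation M 0 T n w * ramp 0 r (max_increment n w))); last first.
  rewrite /F -!addrA lerD2r; lra.
rewrite /sq_variation !mulr_sumr mulr_suml -!big_split/=; apply: ler_sum => i _.
set x := M (g i) w - c; set y := M (g i.+1) w - c.
have -> : dM i w = y - x by rewrite /dM /x /y; ring.
have -> : M (grid 0 T n i.+1) w - M (grid 0 T n i) w = y - x by rewrite /x /y /g; ring.
have tg := huber_tangent x y r2.
rewrite /hu -/x -/y.
have /andP[p0 p1] := ramp_itv 0 r (max_increment n w).
have s0 := sqr_ge0 (y - x).
have pk0 : 0 <= (y - x) ^+ 2 * ramp 0 r (max_increment n w) by rewrite mulr_ge0.
have [/andP[kk0 kk1]] := k01 (M (g i) w).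
(* For a small step starting within r of c, the square is exactly twice the Huber remainder. For a
   small step starting farther away, k is 0 and the remainder is nonnegative. For a large step the
   ramp is 1 and pays for the whole square. *)
have [yx|yx] := leP `|y - x| r.
  have [xr|xr] := leP `|x| r; last by rewrite k0// mul0r; lra.
  have hq := huber_quadratic (ltW r0) xr yx.
  have : k (M (g i) w) * (y - x) ^+ 2 <= (y - x) ^+ 2 by rewrite ler_piMl.
  lra.
rewrite ramp1// ?add0r.
  have : k (M (g i) w) * (y - x) ^+ 2 <= (y - x) ^+ 2 by rewrite ler_piMl.
  lra.
rewrite (le_trans (ltW yx))// /max_increment (bigD1 i)//= le_max.
by rewrite (_ : M _ w - M _ w = y - x) ?lexx// /x /y /g; ring.
Qed.

End integrand_estimates.

Lemma div_natS_le (R : realType) (c e : R) : 0 < e ->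
  exists n0, forall n, (n0 <= n)%N -> c / n.+1%:R <= e.
Proof.
move=> e0; exists (Num.truncn (c / e)) => n n0n.
rewrite ler_pdivrMr ?ltr0n// mulrC -ler_pdivrMr//.
by rewrite (le_trans (ltW (truncnS_gt _)))// ler_nat ltnS.
Qed.

Lemma fatou_le_ae d (X : measurableType d) (R : realType) (mu : {measure set X -> \bar R})
    (f_ : nat -> X -> R) (f : X -> R) (c : R) :
  (forall n, measurable_fun setT (f_ n)) -> measurable_fun setT f ->
  (forall n x, 0 <= f_ n x) -> (forall x, 0 <= f x) ->
  {ae mu, forall x, f_ n x @[n --> \oo] --> f x} ->
  (forall e, 0 < e -> exists n0, forall n, (n0 <= n)%N ->
     (\int[mu]_x (f_ n x)%:E <= (c + e)%:E)%E) ->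
  (\int[mu]_x (f x)%:E <= c%:E)%E.
Proof.
move=> mf_ mf f_0 f0 [N [mN N0 NE]] H.
have mC : measurable (setT `\` N) by exact: measurableD.
rewrite (ge0_negligible_integral mN)//; first last.
- by move=> x _; rewrite lee_fin.
- exact/measurable_EFinP.
apply: (@fatou_le _ _ _ _ _ f_) => //.
- by move=> n; exact: measurable_funTS.
- by move=> x [_ /=]; apply: contra_notP => nx; exact: NE.
move=> e e0; have [n0 Hn0] := H e e0; exists n0 => n n0n.
apply: le_trans (Hn0 n n0n); apply: ge0_subset_integral => //.
  exact/measurable_EFinP.
by move=> x _; rewrite lee_fin.
Qed.

(** * Limits of integrals and integrands with jumps *)

Section ito_limits.
Context d (Om : measurableType d) (R : realType) (P : probability Om R) (T Lam : R).
Context (Ad : R -> (Om -> R) -> Prop) (M : R -> Om -> R) (Q : Om -> cumulative R R).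
Hypothesis ms : martingale_setting P T Lam Ad M Q.
Implicit Types (s t u : R) (Y : Om -> R) (eta : R -> Om -> R).

Let T0 : 0 < T := ms_T ms.
Let TT : 0 <= T := ltW T0.
Let mQ := Q_measurable ms.
Local Notation mproc := (mproc (Om := Om) T).
Local Notation is_int := (is_int P T Ad M Q).
Local Notation EQ2 := (EQ2 P T Q).

(** The [Y_ n] converge only almost surely. The isometry makes them a Cauchy sequence in L2, and
    Fatou's lemma in the second index identifies the L2 limit with Y. *)
Lemma is_int_fatou t eta Y (eta_ : nat -> R -> Om -> R) (Y_ : nat -> Om -> R) :
  0 <= t <= T -> mproc eta -> measurable_fun setT Y ->
  (forall n, is_int t (eta_ n) (Y_ n)) ->
  (forall e, 0 < e -> exists n0, forall n, (n0 <= n)%N -> (EQ2 (eta_ n) eta <= e%:E)%E) ->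
  {ae P, forall w, Y_ n w @[n --> \oo] --> Y w} -> is_int t eta Y.
Proof.
move=> tT meta mY hint H cY; apply: (is_int_lim ms) => // e e0.
(* 64 = 16 * (2 + 2): the isometry constant, and two errors in one triangle inequality. *)
have e640 : 0 < e / 64 by lra.
have [n0 Hn0] := H _ e640.
have mY_ n : measurable_fun setT (Y_ n) by have [] := hint n.
have m_ n : mproc (eta_ n) by have [] := hint n.
exists (eta_ n0), (Y_ n0); split => //.
  by apply: le_trans (Hn0 n0 (leqnn _)) _; rewrite lee_fin; lra.
apply: (@fatou_le_ae _ _ _ _ (fun n w => (Y_ n0 w - Y_ n w) ^+ 2)) => //.
- by move=> n; apply: measurable_funX; exact: measurable_funB.
- by apply: measurable_funX; exact: measurable_funB.
- by move=> *; exact: sqr_ge0.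
- by move=> *; exact: sqr_ge0.
- apply: filterS cY => w cw.
  apply: (@continuous_cvg _ _ _ _ _ (fun n => Y_ n0 w - Y_ n w) (fun x => x ^+ 2)).
    exact: exprn_continuous.
  by apply: cvgB => //; exact: cvg_cst.
move=> e' e'0; exists n0 => n n0n.
have h1 := Hn0 n0 (leqnn _); have h2 := Hn0 n n0n; rewrite EQ2C in h2.
have h3 := EQ2_triangle ms (m_ n0) meta (m_ n) h1 h2.
apply: le_trans (is_int_isometry ms tT (hint n0) (hint n) h3) _.
by rewrite lee_fin; lra.
Qed.

Lemma is_int_ae t eta Y Y' : 0 <= t <= T -> is_int t eta Y -> measurable_fun setT Y' ->
  {ae P, forall w, Y w = Y' w} -> is_int t eta Y'.
Proof.
move=> tT h mY' YY'; have [meta mY _] := h.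
apply: (@is_int_fatou _ _ _ (fun=> eta) (fun=> Y)) => //.
  by move=> e e0; exists 0%N => n _; rewrite EQ2_refl lee_fin ltW.
by apply: filterS YY' => w ->; exact: cvg_cst.
Qed.

Lemma is_int_sum t (I : Type) (e : seq I) (c : I -> R) (eta : I -> R -> Om -> R)
    (Y : I -> Om -> R) : 0 <= t <= T -> (forall i, is_int t (eta i) (Y i)) ->
  is_int t (fun s w => \sum_(i <- e) c i * eta i s w) (fun w => \sum_(i <- e) c i * Y i w).
Proof.
move=> tT H; elim: e => [|i e IH].
  have := is_int_cst ms 0 tT.
  rewrite (_ : (fun w => \sum_(i <- [::]) c i * Y i w) = (fun w => 0 * (M t w - M 0 w))); last first.
    by apply/funext => w; rewrite big_nil mul0r.
  rewrite (_ : (fun s w => \sum_(i <- [::]) c i * eta i s w) = (fun _ _ => 0))//.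
  by apply/funext => s; apply/funext => w; rewrite big_nil.
rewrite (_ : (fun w => \sum_(j <- _) _) = (fun w => c i * Y i w + \sum_(j <- e) c j * Y j w)); last first.
  by apply/funext => w; rewrite big_cons.
rewrite (_ : (fun s w => \sum_(j <- _) _) = (fun s w => c i * eta i s w + \sum_(j <- e) c j * eta j s w)); last first.
  by apply/funext => s; apply/funext => w; rewrite big_cons.
by apply: (is_intD ms) => //; apply: (is_intZ ms).
Qed.

Lemma E2_ae_subseq (Y_ : nat -> Om -> R) Y : (forall n, measurable_fun setT (Y_ n)) ->
  measurable_fun setT Y -> (forall e, 0 < e -> exists n, (E2 P (Y_ n) Y <= e%:E)%E) ->
  exists phi : nat -> nat, {ae P, forall w, Y_ (phi n) w @[n --> \oo] --> Y w}.
Proof.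
move=> mY_ mY H.
have m2 n : measurable_fun setT (fun w => (Y_ n w - Y w) ^+ 2).
  by apply: measurable_funX; exact: measurable_funB.
have [phi Hphi] : exists phi : nat -> nat,
    {ae P, forall w, (Y_ (phi n) w - Y w) ^+ 2 @[n --> \oo] --> (fun=> 0) w}.
  apply: (L1_ae_subseq m2) => [|e e0]; first exact: measurable_cst.
  have [n Hn] := H e e0; exists n; apply: le_trans Hn.
  by rewrite le_eqVlt; apply/orP; left; apply/eqP; apply: eq_integral => w _;
    rewrite subr0 ger0_norm ?sqr_ge0.
exists phi; apply: filterS Hphi => w h.
apply/subr_cvg0/cvgr0Pnorm_lt => e e0.
have e20 : 0 < e ^+ 2 by rewrite exprn_gt0.
move/cvgr0Pnorm_lt : h => /(_ _ e20); apply: filterS => n.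
by rewrite normrX ltr_pXn2r// ?nnegrE// ltW.
Qed.

Definition grid_integral (h : R -> R) n t w : R :=
  \sum_(k < n) h (M (grid 0 T n k) w) *
    (M (Num.min (grid 0 T n k.+1) t) w - M (Num.min (grid 0 T n k) t) w).

Lemma is_int_grid (h : R -> R) K B n t : (0 < n)%N -> 0 <= t <= T ->
  (forall x y, `|h x - h y| <= K * `|x - y|) -> (forall x, `|h x| <= B) ->
  is_int t (grid_process T M h n) (grid_integral h n t).
Proof.
move=> n0 tT hl hB.
have gI k : (k <= n)%N -> 0 <= grid 0 T n k <= T by move=> kn; exact: grid_itv.
have lo0 (k : 'I_n) : 0 <= grid 0 T n k by case/andP: (gI k (ltnW (ltn_ord k))).
have hiT (k : 'I_n) : grid 0 T n k.+1 <= T by case/andP: (gI k.+1 (ltn_ord k)).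
have lohi (k : 'I_n) : grid 0 T n k <= grid 0 T n k.+1 by exact: grid_le.
have A (k : 'I_n) : Ad (grid 0 T n k) (fun w => h (M (grid 0 T n k) w)).
  by apply: (Ad_comp ms (lipschitz_locally hl)); apply: (Ad_M ms); exact: gI (ltnW _).
have i (k : 'I_n) : integ P (fun w => h (M (grid 0 T n k) w) ^+ 2).
  apply: (@integ_bounded _ _ _ _ _ (B ^+ 2)).
    by apply: measurable_funX; exact: (Ad_measurable ms (A k)).
  by move=> w; rewrite normrX lerXn2r ?nnegrE// (le_trans _ (hB (M (grid 0 T n k) w))).
pose c k := Cell (lo0 k) (lohi k) (hiT k) (A k) (i k).
have := is_int_elementary ms [seq c k | k <- index_enum 'I_n] tT.
have -> : eproc [seq c k | k <- index_enum 'I_n] = grid_process T M h n.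
  apply/funext => s; apply/funext => w; rewrite /eproc /simple_process big_map.
  exact: eq_bigr.
have -> // : eint M [seq c k | k <- index_enum 'I_n] t = grid_integral h n t.
by apply/funext => w; rewrite /eint big_map; exact: eq_bigr.
Qed.

Lemma mproc_comp (h : R -> R) : measurable_fun setT h -> mproc (fun s w => h (M s w)).
Proof. by move=> mh; exact: (measurableT_comp mh (M_mproc ms)). Qed.

Let B := Ex P (fun w => `|M T w - M 0 w|).

Let in_cell_EQ (c r : R) : 0 < r ->
  mproc (fun s w => (`|M s w - c| <= r)%R%:R).
Proof.
move=> r0; apply: (mproc_comp (h := fun x => (`|x - c| <= r)%R%:R)).
have mh : measurable_fun setT (\1_(`[c - r, c + r]%classic) : R -> R).
  by apply: measurable_indic; exact: measurable_itv.
by apply: eq_measurable_fun mh => x _; rewrite indicE mem_setE in_itv/= ler_distl.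
Qed.

Lemma EQ2_cell (h1 h2 : R -> R) c r k : 0 < r -> 0 <= k ->
  measurable_fun setT h1 -> measurable_fun setT h2 ->
  (forall x, `|h1 x - h2 x| <= k * (`|x - c| <= r / 2)%R%:R) ->
  (EQ2 (fun s w => h1 (M s w)) (fun s w => h2 (M s w)) <= (k ^+ 2 * (4 * r * B))%:E)%E.
Proof.
move=> r0 k0 m1 m2 H; have r20 : 0 < r / 2 by lra.
have mi := in_cell_EQ c r20.
apply: (@le_trans _ _ (EQ P T Q (fun s w => k ^+ 2 * (`|M s w - c| <= r / 2)%R%:R)%R)).
  apply: EQ_le => //.
  - by apply: mproc_sqr; apply: mprocB; exact: mproc_comp.
  - by apply: measurable_funM; [exact: measurable_cst|exact: mi].
  - by move=> *; exact: sqr_ge0.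
  - move=> s w _; rewrite -real_normK ?num_real//.
    apply: (@le_trans _ _ ((k * (`|M s w - c| <= r / 2)%R%:R) ^+ 2)).
      by rewrite lerXn2r ?nnegrE ?mulr_ge0.
    by rewrite exprMn; case: (`|M s w - c| <= r / 2); rewrite /= ?expr1n ?expr0n.
by apply: (EQZ_le T0 mQ) => //; [exact: sqr_ge0|exact: (EQ_level_set ms)].
Qed.

Section step_errors.
Context (g : R -> R) (N : R) (m : nat).
Hypotheses (gnd : {homo g : x y / x <= y}) (N0 : 0 < N) (m0 : (0 < m)%N).

Let V := g N - g (- N).

(** [cell_weight] is at most V, so its square is at most V times itself, a combination of windows of
    width [mesh]. Each window has mass of order [mesh] and the jumps add up to V, however g
    distributes them. *)
Lemma EQ2_cell_weight (h1 h2 : R -> R) : measurable_fun setT h1 -> measurable_fun setT h2 ->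
  (forall x, `|h1 x - h2 x| <= cell_weight g N m x) ->
  (EQ2 (fun s w => h1 (M s w)) (fun s w => h2 (M s w)) <= (V ^+ 2 * (4 * mesh N m * B))%:E)%E.
Proof.
move=> m1 m2 H.
have J0 i : 0 <= jump g N m i by exact: jump_ge0.
have V0 : 0 <= V by rewrite subr_ge0; apply: gnd; rewrite ge0_cp ?ltW.
have me0 : 0 < mesh N m by exact: mesh_gt0.
have me20 : 0 < mesh N m / 2 by lra.
have mi (i : 'I_m) : mproc (fun s w => in_cell N m i (M s w)) by exact: in_cell_EQ.
have w0 x : 0 <= cell_weight g N m x by exact: cell_weight_ge0.
apply: (@le_trans _ _ (EQ P T Q (fun s w => \sum_(i <- index_enum 'I_m) (V * jump g N m i) * in_cell N m i (M s w))%R)).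
  apply: EQ_le => //.
  - by apply: mproc_sqr; apply: mprocB; exact: mproc_comp.
  - by apply: measurable_sum => i; apply: measurable_funM; [exact: measurable_cst|exact: mi].
  - by move=> *; exact: sqr_ge0.
  - move=> s w _; rewrite -real_normK ?num_real//.
    apply: (@le_trans _ _ (V * cell_weight g N m (M s w))).
      rewrite expr2 ler_pM// (le_trans (H _))//; exact: cell_weight_le.
    by rewrite /cell_weight mulr_sumr; apply: ler_sum => i _; rewrite mulrA.
rewrite [X in (_ <= X%:E)%E](_ : _ = \sum_(i <- index_enum 'I_m) (V * jump g N m i) * (4 * mesh N m * B)).
  apply: EQ_sum => //.
  - by move=> i; rewrite mulr_ge0.
  - by move=> i; exact: (EQ_level_set ms).
rewrite -mulr_suml -mulr_sumr sum_jump//.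
Qed.

End step_errors.

Lemma EQ2_clamp_growth (g : R -> R) C K : {homo g : x y / x <= y} ->
  (forall x, `|g x| <= C * (1 + `|x|)) -> 1 <= K ->
  (EQ2 (fun s w => g (clamp (2 * K) (M s w))) (fun s w => g (M s w)) <=
    ((6 * C) ^+ 2 * (Lam * T * Ex P (fun w => excess K (M T w) ^+ 2)%R))%:E)%E.
Proof.
move=> gnd gC K1; have K0 : 0 <= K by lra.
have mg : measurable_fun setT g by apply: nondecreasing_measurable.
have mgc : measurable_fun setT (fun x => g (clamp (2 * K) x)).
  by apply: nondecreasing_measurable => // x y xy; apply/gnd/clamp_nd.
have ec : continuous (@excess R K) by apply: (@Lip_continuous_real _ _ 2); exact: excess_lip.
have me : mproc (fun s w => excess K (M s w) ^+ 2).
  by apply: mproc_sqr; apply: mproc_comp; exact: continuous_measurable_fun.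
apply: (@le_trans _ _ (EQ P T Q (fun s w => (6 * C) ^+ 2 * excess K (M s w) ^+ 2)%R)).
  apply: EQ_le => //.
  - by apply: mproc_sqr; apply: mprocB; [exact: (mproc_comp mgc)|exact: (mproc_comp mg)].
  - by apply: measurable_funM; [exact: measurable_cst|exact: me].
  - by move=> *; exact: sqr_ge0.
  - move=> s w _; rewrite -real_normK ?num_real// -(real_normK (num_real (excess K _))) -exprMn.
    have h := clamp_growth gC (M s w) K1.
    by rewrite lerXn2r ?nnegrE// (le_trans _ h).
apply: (EQZ_le T0 mQ) => //; [by move=> *; exact: sqr_ge0|exact: sqr_ge0|exact: (excess_tail ms)].
Qed.

Lemma sgn_ramp (a r x : R) : 0 < r ->
  `|2 * ramp a r x - 1 - sgn_left (x - a)| <= 2 * (`|x - (a + r / 2)| <= r / 2)%R%:R.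
Proof.
move=> r0; rewrite /sgn_left subr_gt0.
have /andP[p0 p1] := ramp_itv a r x.
have [xa|ax] := leP x a.
  by rewrite ramp0// mulr0 add0r subrr normr0 mulr_ge0.
have [xr|rx] := leP (a + r) x.
  by rewrite ramp1// mulr1 (_ : _ - _ = 0) ?normr0 ?mulr_ge0//; ring.
have -> : `|x - (a + r / 2)| <= r / 2 by rewrite ler_distl; apply/andP; split; lra.
by rewrite mulr1 ler_norml; apply/andP; split; lra.
Qed.

Lemma grid_integral_cst (h : R -> R) n t w (c : R) : (0 < n)%N -> 0 <= t <= T ->
  (forall k : 'I_n, h (M (grid 0 T n k) w) = c) ->
  grid_integral h n t w = c * (M t w - M 0 w).
Proof.
move=> n0 /andP[t0 tT] hc; rewrite /grid_integral.
under eq_bigr => k _ do rewrite hc.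
rewrite -mulr_sumr -(big_mkord xpredT (fun k => M (Num.min (grid 0 T n k.+1) t) w - M (Num.min (grid 0 T n k) t) w)).
by rewrite telescope_sumr// gridn// grid0 (min_r tT) (min_l t0).
Qed.

(* The sign is a limit of ramps that are constant on [-N, N]: on the paths bounded
   by N their grid integrals telescope. *)
Lemma is_int_sgn_local t a N Y : 0 <= t <= T -> 0 <= N -> N < `|a| ->
  is_int t (fun s w => sgn_left (M s w - a)) Y ->
  {ae P, forall w, (forall s, 0 <= s <= T -> `|M s w| <= N) ->
     Y w = - Num.sg a * (M t w - M 0 w)}.
Proof.
move=> tT N0 Na hint; have [meta mY _] := hint.
(* At most |a| - N, so that the sloping part of the ramp, from a to a + r, stays off ]-N, N[ for
   either sign of a. *)
pose r n := (`|a| - N) / n.+1%:R.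
have r0 n : 0 < r n by rewrite divr_gt0 ?ltr0n// subr_gt0.
have rle n : r n <= `|a| - N.
  rewrite /r ler_pdivrMr ?ltr0n//; apply: ler_peMr; first by rewrite subr_ge0 ltW.
  by rewrite ler1n.
pose h n x := 2 * ramp a (r n) x - 1.
have hl n x y : `|h n x - h n y| <= 2 * (r n)^-1 * `|x - y|.
  rewrite /h (_ : _ - _ - _ = 2 * (ramp a (r n) x - ramp a (r n) y)); last by ring.
  by rewrite normrM ger0_norm// -mulrA ler_pM2l// ramp_lip.
have hb n x : `|h n x| <= 1.
  have /andP[p0 p1] := ramp_itv a (r n) x.
  by rewrite /h ler_norml; apply/andP; split; lra.
have hm n : measurable_fun setT (h n).
  by apply: continuous_measurable_fun; exact: (Lip_continuous_real (hl n)).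
have sm : measurable_fun setT (fun x : R => sgn_left (x - a)).
  apply: nondecreasing_measurable => // x y xy; rewrite /sgn_left.
  case: ifPn => // h1; last by case: ifPn => _; lra.
  by rewrite ifT// (lt_le_trans h1)// lerD2r.
have B0 : 0 <= B by apply: Ex_ge0.
have /choice[p Hp] : forall j, exists p : nat * nat,
    (E2 P (grid_integral (h p.1) p.2.+1 t) Y <= (j.+1%:R^-1)%:E)%E.
  (* 64 = 16 * (2 + 2): the error of freezing and that of the ramp, through one triangle inequality
     and the isometry. *)
  move=> j; pose e : R := j.+1%:R^-1 / 64; have e0 : 0 < e by rewrite divr_gt0.
  have [n Hn] := div_natS_le (16 * (`|a| - N) * B) e0.
  pose K := 2 * (r n)^-1.
  have [m Hm] := div_natS_le (K ^+ 2 * Lam ^+ 2 * T ^+ 2) e0.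
  exists (n, m); rewrite /=.
  have hint' : is_int t (grid_process T M (h n) m.+1) (grid_integral (h n) m.+1 t).
    exact: (is_int_grid (ltn0Sn m) tT (hl n) (hb n)).
  have h1 : (EQ2 (grid_process T M (h n) m.+1) (fun s w => h n (M s w)) <= e%:E)%E.
    apply: le_trans (grid_process_error ms (ltn0Sn m) (hl n)) _.
    by rewrite lee_fin Hm.
  have h2 : (EQ2 (fun s w => h n (M s w)) (fun s w => sgn_left (M s w - a)) <= e%:E)%E.
    apply: le_trans (EQ2_cell (h2 := fun x => sgn_left (x - a)) (r0 n) (ler0n _ 2) (hm n) sm (fun x => sgn_ramp a x (r0 n))) _.
    rewrite lee_fin (le_trans _ (Hn n (leqnn n)))// /r.
    by rewrite le_eqVlt; apply/orP; left; apply/eqP; ring.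
  have mg : mproc (grid_process T M (h n) m.+1) by case: hint'.
  have h3 := EQ2_triangle ms mg (mproc_comp (hm n)) meta h1 h2.
  apply: le_trans (is_int_isometry ms tT hint' hint h3) _.
  rewrite lee_fin (_ : 16 * _ = 64 * e); last by ring.
  by rewrite /e mulrC divfK.
have mI j : measurable_fun setT (grid_integral (h (p j).1) (p j).2.+1 t).
  by have [] : is_int t (grid_process T M (h (p j).1) (p j).2.+1) (grid_integral (h (p j).1) (p j).2.+1 t)
    by exact: (is_int_grid (ltn0Sn _) tT (hl _) (hb _)).
have [phi Hphi] : exists phi : nat -> nat, {ae P, forall w,
    grid_integral (h (p (phi j)).1) (p (phi j)).2.+1 t w @[j --> \oo] --> Y w}.
  apply: (E2_ae_subseq mI mY) => e e0; have [n Hn] := div_natS_le 1 e0.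
  exists n; apply: le_trans (Hp n) _; rewrite lee_fin.
  by have := Hn n (leqnn n); rewrite div1r.
apply: filterS Hphi => w cw HN.
suff c2 : grid_integral (h (p (phi j)).1) (p (phi j)).2.+1 t w @[j --> \oo] -->
    - Num.sg a * (M t w - M 0 w) by exact: (cvg_unique _ cw c2).
apply: cvg_near_cst; apply: nearW => j; apply: grid_integral_cst => // k.
have := HN _ (grid_itv TT (ltnW (ltn_ord k)) (ltn0Sn _)).
move: (M _ w) => x; rewrite ler_norml => /andP[x1 x2].
have := rle (p (phi j)).1; move: Na; rewrite /h.
case: (ltgtP a 0) => [a0|a0|->].
- rewrite ltr0_norm// ltr0_sg// => Na h1; rewrite ramp1//; [lra|lra].
- by rewrite gtr0_norm// gtr0_sg// => Na h1; rewrite ramp0//; lra.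
- by rewrite normr0 => h1; have := lt_le_trans h1 N0; rewrite ltxx.
Qed.

End ito_limits.

(** * Stieltjes measures of convex functions *)

(** Along a subdivision into n + 1 equal pieces the bounds telescope in g and sum to (g b - g a) (b
    - a) / (n + 1). *)
Lemma increments_const (R : realType) (F g : R -> R) (a b : R) : a <= b ->
  (forall x y, a <= x -> x <= y -> y <= b -> `|F y - F x| <= (g y - g x) * (y - x)) ->
  F b = F a.
Proof.
move=> ab H; apply/eqP; rewrite -subr_eq0 -normr_eq0 eq_le normr_ge0 andbT.
apply/ler_addgt0Pr => e e0; rewrite add0r.
have [n Hn] := div_natS_le ((g b - g a) * (b - a)) e0.
apply: le_trans (Hn n (leqnn n)).
pose c k := grid a b n.+1 k.
have -> : F b - F a = \sum_(0 <= k < n.+1) (F (c k.+1) - F (c k)).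
  by rewrite telescope_sumr// /c gridn// grid0.
have -> : (g b - g a) * (b - a) / n.+1%:R =
    \sum_(0 <= k < n.+1) (g (c k.+1) - g (c k)) * (c k.+1 - c k).
  have cS k : c k.+1 - c k = (b - a) / n.+1%:R by rewrite /c gridS addrAC subrr add0r.
  under [RHS]eq_bigr do rewrite cS.
  by rewrite -mulr_suml telescope_sumr// /c gridn// grid0 mulrA.
rewrite !big_mkord (le_trans (ler_norm_sum _ _ _))//; apply: ler_sum => k _.
have /andP[h1 _] := grid_itv ab (ltnW (ltn_ord k)) (ltn0Sn n).
have /andP[_ h2] := grid_itv ab (ltn_ord k) (ltn0Sn n).
by apply: H => //; exact: grid_le.
Qed.

Section stieltjes_convex.
Context (R : realType) (g : R -> R) (mu : {measure set (measurableTypeR R) -> \bar R}).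
Hypotheses (gnd : {homo g : x y / x <= y}) (muE : is_stieltjes_measure g mu).
Implicit Types (N x y : R) (phi : R -> R).
Local Notation I N := (`[- N, N[%classic : set (measurableTypeR R)).

Let mI N : measurable (I N). Proof. exact: measurable_itv. Qed.

Lemma stieltjes_interval N : 0 <= N -> mu (I N) = (g N - g (- N))%:E.
Proof. by move=> N0; apply: muE; rewrite ge0_cp. Qed.

Let I_fin N : 0 <= N -> (mu (I N) < +oo)%E.
Proof. by move=> N0; rewrite stieltjes_interval// ltry. Qed.

Lemma continuous_interval_bounded N phi : continuous phi ->
  exists2 C, 0 <= C & forall x, - N <= x <= N -> `|phi x| <= C.
Proof.
move=> cphi; have [N0|N0] := leP 0 N; last by exists 0 => // x; lra.
have cn : {within `[- N, N], continuous (fun x => `|phi x|)}.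
  apply: continuous_subspaceT => x; apply: (@continuous_comp _ _ _ phi (fun x => `|x|)).
    exact: cphi.
  exact: norm_continuous.
have NN : - N <= N by rewrite ge0_cp.
have [c _ H] := EVT_max NN cn.
by exists `|phi c| => // x xN; apply: H; rewrite in_itv.
Qed.

Lemma integrable_continuous_interval N phi : 0 <= N -> continuous phi ->
  mu.-integrable (I N) (EFin \o phi).
Proof.
move=> N0 cphi; apply: measurable_bounded_integrable => //.
- exact: I_fin.
- by apply: measurable_funTS; exact: continuous_measurable_fun.
have [C C0 HC] := continuous_interval_bounded N cphi.
exists C; split; first exact: num_real.
move=> x Cx y /=; rewrite in_itv/= => /andP[y1 y2].
by rewrite (le_trans _ (ltW Cx))// HC// y1 ltW.
Qed.

Lemma node_grid N m i : node N m i = grid (- N) N m i.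
Proof. by rewrite /node /mesh /grid opprK mulr2n mulrDl mul1r. Qed.

(** Each sum is exactly the mu-integral of phi frozen at the left nodes, since mu of a cell closed
    on the left is a jump of g; dominated convergence concludes. *)
Lemma riemann_stieltjes_cvg N phi : 0 < N -> continuous phi ->
  \sum_(i < m.+1) jump g N m.+1 i * phi (node N m.+1 i) @[m --> \oo] -->
  (\int[mu]_(a in I N) phi a)%R.
Proof.
move=> N0 cphi; have NN : - N <= N by rewrite ge0_cp// ltW.
have [C C0 HC] := continuous_interval_bounded N cphi.
pose cl m i : set (measurableTypeR R) := `[grid (- N) N m.+1 i, grid (- N) N m.+1 i.+1[%classic.
have mcl m i : measurable (cl m i) by exact: measurable_itv.
pose p m (a : R) := \sum_(i < m.+1) phi (grid (- N) N m.+1 i) * \1_(cl m i) a.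
have II m (i : 'I_m.+1) : mu (cl m i `&` I N) = (jump g N m.+1 i)%:E.
  have /andP[h1 _] := grid_itv NN (ltnW (ltn_ord i)) (ltn0Sn m).
  have /andP[_ h2] := grid_itv NN (ltn_ord i) (ltn0Sn m).
  rewrite setIidl; last first.
    move=> a; rewrite /cl /= !in_itv/= => /andP[h3 h4].
    by rewrite (le_trans h1)//= (lt_le_trans h4).
  by rewrite muE ?grid_le// /jump !node_grid.
have iI m (i : 'I_m.+1) : mu.-integrable (I N) (EFin \o (\1_(cl m i) : R -> R)).
  apply: measurable_bounded_integrable => //; first exact/I_fin/ltW.
  exists 1; split; first exact: num_real.
  move=> x x1 a _ /=; rewrite (le_trans _ (ltW x1))// indicE.
  by case: (_ \in _); rewrite /= ?normr1 ?normr0.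
have pE m : (\int[mu]_(a in I N) (p m a)%:E =
    (\sum_(i < m.+1) jump g N m.+1 i * phi (node N m.+1 i))%:E)%E.
  rewrite /p; under eq_integral do rewrite -sumEFin.
  rewrite integral_sum//; last first.
    by move=> i; exact: (integrableZl (mI N) (phi (grid (- N) N m.+1 i)) (iI m i)).
  rewrite -sumEFin; apply: eq_bigr => i _.
  under eq_integral do rewrite EFinM.
  rewrite integralZl//; last exact: iI.
  by rewrite integral_indic// II node_grid -EFinM mulrC.
have [] := @dominated_convergence _ _ _ mu (I N) (mI N) (fun m a => (p m a)%:E) (EFin \o phi) (fun=> C%:E).
- move=> m; apply/measurable_EFinP; apply: measurable_sum => i.
  by apply: measurable_funM => //; apply: measurable_indic.
- by apply/measurable_EFinP; apply: measurable_funTS; exact: continuous_measurable_fun.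
- apply: aeW => a /=; rewrite in_itv/= => /andP[a1 a2].
  apply/cvg_EFin; first by apply: nearW.
  apply/cvgrPdist_lt => e e0.
  have [dl dl0 Hd] : exists2 dl, 0 < dl & forall y, `|a - y| < dl -> `|phi a - phi y| < e.
    have /cvgrPdist_lt/(_ e e0)/nbhs_ballP[dl /= dl0 Hd] := cphi a.
    by exists dl => // y ya; apply: Hd.
  have dl20 : 0 < dl / 2 by rewrite divr_gt0.
  have [n0 Hn0] := div_natS_le (N - - N) dl20.
  exists n0 => // m /= n0m.
  have aN : - N <= a < N by rewrite a1.
  have [k kP] := grid_cell (ltn0Sn m) aN.
  rewrite /p (sum_grid_indic NN (phi \o grid (- N) N m.+1) kP)/=.
  apply: Hd; move: kP => /andP[h1]; rewrite gridS => h2.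
  rewrite ger0_norm ?subr_ge0//.
  rewrite ltrBlDl (lt_le_trans h2)// lerD2l (le_trans (Hn0 m n0m))//.
  by rewrite ler_pdivrMr// ler_peMr ?ltW// ltr1n.
- exact: (integrable_continuous_interval (ltW N0) (@cst_continuous _ _ C)).
- apply: aeW => a m /=; rewrite in_itv/= => /andP[a1 a2].
  have aN : - N <= a < N by rewrite a1.
  have [k kP] := grid_cell (ltn0Sn m) aN.
  rewrite lee_fin /p (sum_grid_indic NN (phi \o grid (- N) N m.+1) kP)/=.
  by apply: HC; exact: (grid_itv NN (ltnW (ltn_ord k)) (ltn0Sn m)).
have E : mu.-integrable (I N) (EFin \o phi) ->
    (\int[mu]_(a in I N) (EFin \o phi) a)%E = ((\int[mu]_(a in I N) phi a)%R)%:E.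
  by move=> i; rewrite /Rintegral fineK// integrable_fin_num.
move=> iphi _; rewrite (E iphi) => /fine_cvg.
by apply: cvg_trans; apply: near_eq_cvg; apply: nearW => m; rewrite /= pE.
Qed.

Section convex_formula.
Context (f : R -> R) (N : R).
Hypotheses (N0 : 0 <= N) (fg : forall x y, g x * (y - x) <= f y - f x).

Definition mean_slope := (g N + g (- N)) / 2.

Let dist_continuous y : continuous (fun a : R => `|y - a|).
Proof.
move=> a; apply: (@continuous_comp _ _ _ (fun a => y - a) (fun x => `|x|)).
  by apply: cvgB; [exact: cvg_cst|exact: cvg_id].
exact: norm_continuous.
Qed.

Let H y := (\int[mu]_(a in I N) `|y - a|)%R.

Lemma stieltjes_indic x : - N <= x <= N ->
  mu.-integrable (I N) (EFin \o (fun a => (a < x)%R%:R)) /\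
  (\int[mu]_(a in I N) (a < x)%R%:R)%R = g x - g (- N).
Proof.
move=> /andP[Nx xN].
have E : (fun a : R => ((a < x)%R%:R : R)%:E) = (fun a => (\1_(`]-oo, x[%classic) a)%:E).
  by apply/funext => a; rewrite indicE mem_setE in_itv.
have mx : measurable (`]-oo, x[%classic : set (measurableTypeR R)) by exact: measurable_itv.
split.
  rewrite (_ : _ \o _ = (EFin \o (\1_(`]-oo, x[%classic) : R -> R))); last exact: E.
  apply: measurable_bounded_integrable => //; first exact: I_fin.
  exists 1; split; first exact: num_real.
  move=> y y1 a _ /=; rewrite (le_trans _ (ltW y1))// indicE.
  by case: (_ \in _); rewrite /= ?normr1 ?normr0.
rewrite /Rintegral E integral_indic// (_ : _ `&` _ = `[- N, x[%classic); last first.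
  apply/seteqP; split => a /=; rewrite !in_itv/=.
    by move=> [ax /andP[->]].
  by move=> /andP[-> ax]; split => //; rewrite (lt_le_trans ax).
by rewrite muE.
Qed.

Let dist_increment (x y a : R) : x <= y ->
  (y - x) * (2 * (a < x)%R%:R - 1) <= `|y - a| - `|x - a| <= (y - x) * (2 * (a < y)%R%:R - 1).
Proof.
move=> xy; case: (ltP a x) => ax; case: (ltP a y) => ay /=.
- rewrite !gtr0_norm ?subr_gt0//; lra.
- by have := lt_le_trans ax xy; rewrite ltNge ay.
- rewrite gtr0_norm ?subr_gt0// ler0_norm ?subr_le0//; lra.
- rewrite !ler0_norm ?subr_le0//; lra.
Qed.

Lemma stieltjes_dist_bounds x y : - N <= x -> x <= y -> y <= N ->
  (y - x) * (2 * g x - (g N + g (- N))) <= H y - H x <= (y - x) * (2 * g y - (g N + g (- N))).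
Proof.
move=> Nx xy yN.
have xN : - N <= x <= N by rewrite Nx (le_trans xy).
have yN' : - N <= y <= N by rewrite yN (le_trans Nx).
have iH z := integrable_continuous_interval N0 (@dist_continuous z).
have -> : H y - H x = (\int[mu]_(a in I N) (`|y - a| - `|x - a|))%R.
  by rewrite RintegralB//; exact: iH.
have iHH : mu.-integrable (I N) (EFin \o (fun a => `|y - a| - `|x - a|)).
  exact: (integrableB (mI N) (iH y) (iH x)).
have bnd z : - N <= z <= N ->
    mu.-integrable (I N) (EFin \o (fun a => (y - x) * (2 * (a < z)%R%:R - 1))) /\
    (\int[mu]_(a in I N) ((y - x) * (2 * (a < z)%R%:R - 1)))%R = (y - x) * (2 * g z - (g N + g (- N))).
  move=> zN; have [i1 E1] := stieltjes_indic zN.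
  (* On [I N] the condition a < N always holds; the constant 1 is written this way so that
     [stieltjes_indic] also yields the total mass. *)
  have NNN : - N <= N <= N by rewrite lexx ge0_cp.
  have [i2 E2] := stieltjes_indic NNN.
  have Ei (a : R) : I N a -> (y - x) * (2 * (a < z)%R%:R - 1) =
      (2 * (y - x)) * (a < z)%R%:R - (y - x) * (a < N)%R%:R.
    by rewrite /= in_itv/= => /andP[_ ->] /=; ring.
  have j1 := integrableZl (mI N) (2 * (y - x)) i1; have j2 := integrableZl (mI N) (y - x) i2.
  split.
    apply: eq_integrable (integrableB (mI N) j1 j2) => //.
    by move=> a; rewrite inE => /Ei Ea /=; rewrite Ea EFinB !EFinM.
  transitivity (\int[mu]_(a in I N) ((2 * (y - x)) * (a < z)%R%:R - (y - x) * (a < N)%R%:R))%R.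
    by apply: eq_Rintegral => a; rewrite inE => /Ei.
  rewrite RintegralB//.
  by rewrite !RintegralZl// E1 E2; ring.
have [l1 <-] := bnd x xN; have [l2 <-] := bnd y yN'.
by apply/andP; split; apply: le_Rintegral => // a _; case/andP: (dist_increment a xy).
Qed.

(* The increments of both sides lie between g x (y - x) and g y (y - x). *)
Lemma convex_stieltjes x y : - N <= x <= N -> - N <= y <= N ->
  f y - f x = mean_slope * (y - x) + 2^-1 * (\int[mu]_(a in I N) (`|y - a| - `|x - a|))%R.
Proof.
suff H0 u v : - N <= u -> u <= v -> v <= N ->
    f v - mean_slope * v - 2^-1 * H v = f u - mean_slope * u - 2^-1 * H u.
  move=> /andP[Nx xN] /andP[Ny yN].
  rewrite RintegralB//; try exact: (integrable_continuous_interval N0 (@dist_continuous _)).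
  rewrite -/(H y) -/(H x).
  have [xy|/ltW yx] := leP x y.
    by have := H0 _ _ Nx xy yN; lra.
  by have := H0 _ _ Ny yx xN; lra.
move=> Nu uv vN.
apply: (increments_const (F := fun y => f y - mean_slope * y - 2^-1 * H y) (g := g) uv) => p q up pq qv.
have /andP[h1 h2] := stieltjes_dist_bounds (le_trans Nu up) pq (le_trans qv vN).
have h3 := fg p q; have h4 := fg q p.
rewrite /mean_slope ler_norml; apply/andP; split; lra.
Qed.

(** To the left of all nodes every sign is -1, and [mean_slope] is the constant that makes the value
    there g(-N). *)
Lemma step_fun_sgn m x : (0 < m)%N -> step_fun g N m x =
  mean_slope + 2^-1 * \sum_(i < m) jump g N m i * sgn_left (x - node N m i).
Proof.
move=> m0; rewrite /step_fun /mean_slope.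
have -> : \sum_(i < m) jump g N m i * sgn_left (x - node N m i) =
    2 * (\sum_(i < m) jump g N m i * (node N m i < x)%R%:R) - (g N - g (- N)).
  rewrite -(sum_jump g N m0) mulr_sumr -sumrB; apply: eq_bigr => i _.
  by rewrite /sgn_left subr_gt0; case: (_ < _) => /=; ring.
by field.
Qed.

End convex_formula.

Lemma Rintegral_compact_support N phi : (forall a, N <= `|a| -> phi a = 0) ->
  (\int[mu]_a phi a)%R = (\int[mu]_(a in I N) phi a)%R.
Proof.
move=> phi0; rewrite /Rintegral [in RHS]integral_mkcond; congr fine.
apply: eq_integral => a _; rewrite /patch; case: ifPn => //.
rewrite notin_setE/= in_itv/= => h; rewrite phi0//.
by rewrite leNgt; apply/negP => h'; apply: h; move: h'; rewrite ltr_norml => /andP[/ltW-> ->].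
Qed.

Lemma integrable_compact_support N phi : 0 <= N -> continuous phi ->
  (forall a, N <= `|a| -> phi a = 0) -> mu.-integrable setT (EFin \o phi).
Proof.
move=> N0 cphi phi0.
have /(integrable_mkcond _ (mI N)) := integrable_continuous_interval N0 cphi.
rewrite (_ : _ \_ _ = EFin \o phi)//; apply/funext => a; rewrite /patch; case: ifPn => //.
rewrite notin_setE/= in_itv/= => h; rewrite phi0//.
by rewrite leNgt; apply/negP => h'; apply: h; move: h'; rewrite ltr_norml => /andP[/ltW-> ->].
Qed.

(** For nonnegative integrands, the integrals over [-n, n[ are limits of Riemann sums and increase
    to the whole. For signed l, the integrals of the positive and negative parts are subtracted in
    the extended reals before [fine] is taken, so the argument covers the w where l is not
    integrable. *)
Lemma measurable_stieltjes d (Om : measurableType d) (l : R -> Om -> R) :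
  (forall a, measurable_fun setT (l a)) -> (forall w, continuous (l ^~ w)) ->
  measurable_fun setT (fun w => (\int[mu]_a l a w)%R).
Proof.
move=> ml cl.
have pos (k : R -> Om -> R) : (forall a, measurable_fun setT (k a)) ->
    (forall w, continuous (k ^~ w)) -> (forall a w, 0 <= k a w) ->
    measurable_fun setT (fun w => \int[mu]_a (k a w)%:E)%E.
  move=> mk ck k0.
  have mkI N : 0 < N -> measurable_fun setT (fun w => (\int[mu]_(a in I N) k a w)%R).
    move=> N0.
    apply: (measurable_fun_cvg (h := fun m w => \sum_(i < m.+1) jump g N m.+1 i * k (node N m.+1 i) w)).
      by move=> m; apply: measurable_sum => i; apply: measurable_funM.
    by move=> w _; exact: riemann_stieltjes_cvg.
  apply: (emeasurable_fun_cvg (fun n w => \int[mu]_(a in I n.+1%:R) (k a w)%:E)%E).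
    move=> n; rewrite (_ : (fun w => _) = (fun w => ((\int[mu]_(a in I n.+1%:R) k a w)%R)%:E)).
      by apply/measurable_EFinP; exact: mkI.
    apply/funext => w; rewrite /Rintegral fineK//; apply: integrable_fin_num => //.
    by apply: (integrable_continuous_interval (N := n.+1%:R)) => //.
  move=> w _.
  have -> : [set: measurableTypeR R] = \bigcup_n I n.+1%:R.
    apply/seteqP; split => // a _; exists (Num.truncn `|a|) => //=.
    have := truncnS_gt `|a|; rewrite in_itv/= ltr_norml => /andP[h1 h2].
    by rewrite (ltW h1).
  apply: ge0_nondecreasing_set_cvg_integral => //.
  - by move=> m n mn; apply/subsetPset => a; rewrite /= !in_itv/= => /andP[h1 h2];
      rewrite (le_trans _ h1) ?(lt_le_trans h2) ?lerN2 ?ler_nat.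
  - move=> n; apply/measurable_EFinP; apply: measurable_funTS; exact: continuous_measurable_fun.
  - by move=> n a _; rewrite lee_fin.
rewrite /Rintegral; apply: (measurableT_comp (@fine_measurable R setT measurableT)).
rewrite (_ : (fun w => _) = (fun w => \int[mu]_a (Num.max (l a w) 0)%:E - \int[mu]_a (Num.max (- l a w) 0)%:E)%E); last first.
  apply/funext => w; rewrite integralE; congr (_ - _)%E; apply: eq_integral => a _.
    by rewrite funeposE /= EFin_max.
  by rewrite funenegE /= EFin_max.
apply: emeasurable_funB; apply: pos.
- by move=> a; exact: measurable_maxr.
- by move=> w a; apply: (@continuous_comp _ _ _ (l ^~ w) (fun x => Num.max x 0)); [exact: cl|];
    apply: (@Lip_continuous_real _ _ 1) => x y; rewrite mul1r !(maxC _ 0) max_lip.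
- by move=> a w; rewrite le_max lexx orbT.
- by move=> a; apply: measurable_maxr => //; exact: measurableT_comp.
- by move=> w a; apply: (@continuous_comp _ _ _ (l ^~ w) (fun x => Num.max (- x) 0)); [exact: cl|];
    apply: (@Lip_continuous_real _ _ 1) => x y; rewrite mul1r !(maxC _ 0) (le_trans (max_lip _ _ _))// -opprD normrN.
- by move=> a w; rewrite le_max lexx orbT.
Qed.

End stieltjes_convex.

(** * The Itô–Tanaka formula *)

Lemma convex_locally_lipschitz (R : realType) (f g : R -> R) :
  {homo g : x y / x <= y} -> (forall x y, g x * (y - x) <= f y - f x) -> locally_lipschitz f.
Proof.
move=> gnd fg A; exists (`|g A| + `|g (- A)|) => a a' aA aA'.
have gb x : `|x| <= A -> `|g x| <= `|g A| + `|g (- A)|.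
  rewrite ler_norml => /andP[/gnd h1 /gnd h2].
  have := ler_norm (g A); have := ler_norm (- g (- A)); rewrite normrN => h3 h4.
  have := normr_ge0 (g A); have := normr_ge0 (g (- A)).
  by rewrite ler_norml => *; apply/andP; split; lra.
have bd x y : `|x| <= A -> f x - f y <= (`|g A| + `|g (- A)|) * `|x - y|.
  move=> xA; have := fg x y; rewrite -opprB mulrN => h.
  have : g x * (x - y) <= (`|g A| + `|g (- A)|) * `|x - y|.
    by rewrite (le_trans (ler_norm _))// normrM ler_wpM2r// gb.
  lra.
have h1 := bd a a' aA; have := bd a' a aA'; rewrite distrC => h2.
by rewrite ler_norml; apply/andP; split; lra.
Qed.

Lemma continuous_path_bounded (R : realType) (f : R -> R) (a b : R) : a <= b ->
  {within `[a, b], continuous f} -> exists n : nat, forall s, a <= s <= b -> `|f s| <= n%:R.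
Proof.
move=> ab fc; have cn := within_continuous_comp_real fc (@norm_continuous R R).
have [c _ H] := EVT_max ab cn.
exists (Num.truncn `|f c|).+1 => s sab.
by rewrite (le_trans (H s _)) ?in_itv// ltW// truncnS_gt.
Qed.

Section ito_tanaka.
Context d (Om : measurableType d) (R : realType) (P : probability Om R) (T Lam : R).
Context (Ad : R -> (Om -> R) -> Prop) (M : R -> Om -> R) (Q : Om -> cumulative R R).
Hypothesis ms : martingale_setting P T Lam Ad M Q.
Context (f g : R -> R) (C : R) (mu : {measure set (measurableTypeR R) -> \bar R}).
Hypotheses (gnd : {homo g : x y / x <= y}) (gC : forall x, `|g x| <= C * (1 + `|x|))
  (fg : forall x y, g x * (y - x) <= f y - f x) (muE : is_stieltjes_measure g mu).
Context (t : R) (l : R -> Om -> R).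
Hypotheses (tT : 0 <= t <= T) (ml : forall a, measurable_fun setT (l a))
  (cl : forall w, continuous (l ^~ w)).
Local Notation is_int := (is_int P T Ad M Q).
Local Notation EQ2 := (EQ2 P T Q).
Local Notation I N := (`[- N, N[%classic : set (measurableTypeR R)).
Hypothesis l_int : forall a,
  is_int t (fun s w => sgn_left (M s w - a)) (fun w => `|M t w - a| - `|M 0 w - a| - l a w).

Let T0 := ms_T ms.
Let TT := ltW T0.
Let zT : 0 <= (0 : R) <= T. Proof. by rewrite lexx TT. Qed.

(** On a path that stays on one side of a, the integral of the sign, by [is_int_sgn_local], and |M_t
    - a| - |M_0 - a| both equal -sg(a) (M_t - M_0). The null set still depends on a and on P. *)
Lemma local_time_support a N : 0 <= N -> N < `|a| ->
  {ae P, forall w, (forall s, 0 <= s <= T -> `|M s w| <= N) -> l a w = 0}.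
Proof.
move=> N0 Na; have := is_int_sgn_local ms tT N0 Na (l_int a).
apply: filterS => w + H => /(_ H) E.
have := H t tT; have := H 0 zT; rewrite !ler_norml => /andP[h1 h2] /andP[h3 h4].
suff : `|M t w - a| - `|M 0 w - a| = - Num.sg a * (M t w - M 0 w) by move: E; lra.
move: Na; case: (ltgtP a 0) => [a0|a0|->].
- by rewrite ltr0_norm// ltr0_sg// => Na; rewrite !gtr0_norm; lra.
- by rewrite gtr0_norm// gtr0_sg// => Na; rewrite !ltr0_norm; lra.
- by rewrite normr0 => h; have := lt_le_trans h N0; rewrite ltxx.
Qed.

Let phi w a : R := `|M t w - a| - `|M 0 w - a| - l a w.

Let dist_continuous (y : R) : continuous (fun a : R => `|y - a|).
Proof.
move=> a; apply: (@continuous_comp _ _ _ (fun a => y - a) (fun x => `|x|)).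
  by apply: cvgB; [exact: cvg_cst|exact: cvg_id].
exact: norm_continuous.
Qed.

Let cphi w : continuous (phi w).
Proof. by move=> a; apply: cvgB; [apply: cvgB; exact: dist_continuous|exact: cl]. Qed.

Let mg : measurable_fun setT g.
Proof. exact: nondecreasing_measurable. Qed.

Let mgc N : measurable_fun setT (fun x => g (clamp N x)).
Proof. by apply: nondecreasing_measurable => // x y xy; apply/gnd/clamp_nd. Qed.

Let Z N w := mean_slope g N * (M t w - M 0 w) + 2^-1 * (\int[mu]_(a in I N) phi w a)%R.

Lemma is_int_clamp N : 0 < N -> is_int t (fun s w => g (clamp N (M s w))) (Z N).
Proof.
move=> N0.
pose Y m w := mean_slope g N * (M t w - M 0 w) +
  2^-1 * \sum_(i < m.+1) jump g N m.+1 i * phi w (node N m.+1 i).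
have mst m : measurable_fun setT (step_fun g N m.+1).
  apply: nondecreasing_measurable => // x y xy; rewrite /step_fun lerD2l.
  apply: ler_sum => i _; rewrite ler_wpM2l ?jump_ge0//.
  by case: (ltP (node N m.+1 i) x) => h //=; rewrite (lt_le_trans h xy).
have hint m : is_int t (fun s w => step_fun g N m.+1 (M s w)) (Y m).
  rewrite (_ : (fun s w => _) = (fun s w => mean_slope g N + 2^-1 * \sum_(i <- index_enum 'I_m.+1)
     jump g N m.+1 i * sgn_left (M s w - node N m.+1 i))); last first.
    by apply/funext => s; apply/funext => w; rewrite step_fun_sgn.
  apply: (is_intD ms tT); first exact: (is_int_cst ms).
  apply: (is_intZ ms _ tT).
  exact: (is_int_sum ms (index_enum 'I_m.+1) (fun i : 'I_m.+1 => jump g N m.+1 i) tT (fun i : 'I_m.+1 => l_int (node N m.+1 i))).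
have cY w : Y m w @[m --> \oo] --> Z N w.
  apply: cvgD; first exact: cvg_cst.
  by apply: cvgMr; exact: riemann_stieltjes_cvg.
have mY m : measurable_fun setT (Y m) by case: (hint m).
apply: (is_int_fatou ms tT _ _ hint).
- exact: (mproc_comp ms (mgc N)).
- by apply: (measurable_fun_cvg mY) => w _; exact: cY.
- move=> e e0.
  have [n0 Hn0] := div_natS_le ((g N - g (- N)) ^+ 2 * (4 * (2 * N) * Ex P (fun w => `|M T w - M 0 w|))) e0.
  exists n0 => m n0m.
  apply: le_trans (EQ2_cell_weight ms gnd N0 (ltn0Sn m) (mst m) (mgc N) (step_fun_clamp gnd N0 (ltn0Sn m))) _.
  rewrite lee_fin (le_trans _ (Hn0 m n0m))// /mesh le_eqVlt; apply/orP; left; apply/eqP; ring.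
- by apply: aeW.
Qed.

Lemma Ex_excess_cvg : Ex P (fun w => excess n.+1%:R (M T w) ^+ 2) @[n --> \oo] --> 0.
Proof.
have hT : 0 <= T <= T by rewrite TT lexx.
have ec (K : R) : continuous (@excess R K) by apply: (@Lip_continuous_real _ _ 2); exact: excess_lip.
have [_] : integ P (fun=> 0) /\ Ex P (fun w => excess n.+1%:R (M T w) ^+ 2) @[n --> \oo] --> Ex P (fun=> 0).
  apply: (dominated_Ex _ _ _ _ (M_sq ms hT)).
  - move=> n; apply: measurable_funX; apply: measurableT_comp; last exact: (M_measurable ms).
    exact: continuous_measurable_fun.
  - exact: measurable_cst.
  - apply: aeW => w; apply: cvg_near_cst; near=> n.
    rewrite /excess clamp_id ?subrr ?expr0n//.
    apply: ltW; apply: lt_trans (_ : n%:R < _); last by rewrite ltr_nat.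
    by near: n; exact: nbhs_infty_gtr.
  - move=> n w; rewrite ger0_norm ?sqr_ge0// -real_normK ?num_real// -[leRHS]real_normK ?num_real//.
    rewrite lerXn2r ?nnegrE//.
    by have := excess_dist (M T w) (y := 0) (K := n.+1%:R); rewrite normr0 subr0; apply.
by rewrite Ex_cst.
Unshelve. all: end_near. Qed.

(** One null set for all levels a and all bounds n; [bad_set] will provide it. *)
Hypothesis l_support : {ae P, forall w, forall n : nat,
  (forall s, 0 <= s <= T -> `|M s w| <= n%:R) -> forall a, n%:R < `|a| -> l a w = 0}.

(** Along the cut-offs 2 (n + 1) the integrals [Z] are eventually constant on each path: once the
    cut-off exceeds the path, the local time lives inside the interval and [convex_stieltjes] is
    exact. *)
Lemma is_int_tanaka : is_int t (fun s w => g (M s w))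
  (fun w => f (M t w) - f (M 0 w) - 2^-1 * (\int[mu]_a l a w)%R).
Proof.
have cf : continuous f by exact: locally_lipschitz_continuous (convex_locally_lipschitz gnd fg).
have mf s : 0 <= s <= T -> measurable_fun setT (fun w => f (M s w)).
  by move=> sT; apply: measurableT_comp; [exact: continuous_measurable_fun|exact: (M_measurable ms)].
pose K n : R := n.+1%:R; have K1 n : 1 <= K n by rewrite ler1n.
have K20 n : 0 < 2 * K n by have := K1 n; lra.
apply: (is_int_fatou ms tT _ _ (fun n => is_int_clamp (K20 n))).
- exact: (mproc_comp ms mg).
- apply: measurable_funB; first by apply: measurable_funB; exact: mf.
  by apply: measurable_funM => //; exact: (measurable_stieltjes muE).
- move=> e e0; pose c := (6 * C) ^+ 2 * (Lam * T).
  have c0 : 0 <= c by rewrite mulr_ge0 ?sqr_ge0// mulr_ge0// (ms_Lam ms).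
  have ec0 : 0 < e / (c + 1) by rewrite divr_gt0//; lra.
  have /cvgr0Pnorm_le/(_ _ ec0) [n0 _ Hn0] := Ex_excess_cvg.
  exists n0 => n n0n; apply: le_trans (EQ2_clamp_growth ms gnd gC (K1 n)) _.
  rewrite lee_fin mulrA -/c (@le_trans _ _ (c * (e / (c + 1))))//.
    by rewrite ler_wpM2l// (le_trans (ler_norm _))// Hn0.
  by rewrite mulrCA -[leRHS]mulr1 ler_wpM2l ?(ltW e0)// ler_pdivrMr ?mul1r; lra.
- apply: filterS l_support => w Hw.
  have cM : {within `[0, T], continuous (M ^~ w)} by exact: (M_continuous ms).
  have [n0 Hn0] := continuous_path_bounded TT cM.
  apply: cvg_near_cst; exists n0 => // n /= n0n.
  have nK : n0%:R < 2 * K n :> R.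
    by rewrite /K -natrM ltr_nat mul2n -addnn (leq_ltn_trans n0n)// ltnS leq_addr.
  have KK := ltW (K20 n).
  have lsup a : 2 * K n <= `|a| -> l a w = 0.
    by move=> h; apply: (Hw n0 Hn0); rewrite (lt_le_trans nK).
  have inN s : 0 <= s <= T -> - (2 * K n) <= M s w <= 2 * K n.
    by move=> /Hn0 h; rewrite -ler_norml (le_trans h)// ltW.
  rewrite (Rintegral_compact_support mu lsup) (convex_stieltjes muE KK fg (inN 0 zT) (inN t tT)).
  rewrite /Z /phi RintegralB//; last 2 first.
  - apply: (integrable_continuous_interval (phi := fun a => `|M t w - a| - `|M 0 w - a|) muE KK).
    by move=> a; apply: cvgB; exact: dist_continuous.
  - exact: (integrable_continuous_interval muE KK).
  by ring.
Qed.

End ito_tanaka.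

(** * The spaces L_G^1 and L_G^2 *)

Section LG_spaces.
Context {R : realType} {d : nat} {T : R}.
Local Notation Omega := (path_space (R := R) d T).
Context (PP : set (probability Omega R)).
Hypothesis PP0 : PP !=set0.
Implicit Types (P : probability Omega R) (X Y : Omega -> R) (t : R).

Lemma LG2P t X : LG PP 2 t X <-> measurable_fun setT X /\
  exists2 X_ : nat -> Omega -> R, (forall n, Lip t (X_ n)) &
    forall e, 0 < e -> exists n0, forall n, (n0 <= n)%N -> forall P, PP P -> (E2 P (X_ n) X <= e%:E)%E.
Proof.
have E e P (Z : Omega -> R) : (\int[P]_w (`|Z w - X w| ^+ 2)%:E <= e%:E)%E = (E2 P Z X <= e%:E)%E.
  by congr (_ <= _)%E; apply: eq_integral => w _; rewrite real_normK ?num_real.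
split=> -[mX [X_ X_L H]]; split => //; exists X_ => //.
  move=> e e0; have [n0 Hn0] := (Lp_cvgP _ _ _ PP0).1 H e e0; exists n0 => n n0n P PPP.
  by rewrite -E; exact: Hn0.
apply/(Lp_cvgP _ _ _ PP0) => e e0; have [n0 Hn0] := H e e0; exists n0 => n n0n P PPP.
by rewrite E; exact: Hn0.
Qed.

Lemma LG_le p s t X : s <= t -> LG PP p s X -> LG PP p t X.
Proof.
move=> st [mX [X_ X_L cX]]; split => //; exists X_ => // n; exact: Lip_le (X_L n).
Qed.

(** A bounded cylinder function within distance 1 of X for all P gives the common bound. *)
Lemma LG2_bound t X : LG PP 2 t X -> exists2 K, 0 <= K &
  forall P, PP P -> Ex P (fun w => X w ^+ 2) <= K.
Proof.
move=> LX; have [mX [X_ X_L H]] := (LG2P t X).1 LX.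
have [n0 /(_ n0 (leqnn _)) Hn0] := H 1 ltr01.
have [K HK] := Lip_bounded (X_L n0); have mXn := Lip_measurable (X_L n0).
exists (2 + 2 * K ^+ 2) => [|P PPP].
  by rewrite addr_ge0// mulr_ge0// sqr_ge0.
have iX := LG_integ2 PPP LX.
have mD : measurable_fun setT (fun w => (X_ n0 w - X w) ^+ 2).
  by apply: measurable_funX; exact: measurable_funB.
have [i1 E1] := integ_fin mD (fun w => sqr_ge0 _) (Hn0 P PPP).
have i2 : integ P (fun w => 2 * (X_ n0 w - X w) ^+ 2 + 2 * K ^+ 2).
  by apply: integD; [exact: integZ|exact: integ_cst].
apply: (@le_trans _ _ (Ex P (fun w => 2 * (X_ n0 w - X w) ^+ 2 + 2 * K ^+ 2))).
  apply: Ex_le => // w.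
  have : X_ n0 w ^+ 2 <= K ^+ 2.
    rewrite -(real_normK (num_real (X_ n0 w))) lerXn2r ?nnegrE//.
    exact: le_trans (normr_ge0 _) (HK w).
  by have := sqr_ge0 (X w - X_ n0 w - X_ n0 w); nra.
rewrite ExD; [|exact: integZ|exact: integ_cst].
by rewrite Ex_cst ExZ// lerD2r -[leRHS]mulr1 ler_pM2l.
Qed.

(** Common mechanism for products and for convex functions: the error is a factor bounded in L2
    times one that is small in L2, both uniformly in P. *)
Lemma LG1_of_bound t X (X_ : nat -> Omega -> R) (U : Omega -> R) (D_ : nat -> Omega -> R) (c k : R) :
  measurable_fun setT X -> (forall n, Lip t (X_ n)) -> measurable_fun setT U ->
  (forall n, measurable_fun setT (D_ n)) -> 0 <= c -> 0 <= k ->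
  (forall P, PP P -> integ P (fun w => U w ^+ 2) /\ Ex P (fun w => U w ^+ 2) <= c) ->
  (forall e, 0 < e -> exists n0, forall n, (n0 <= n)%N -> forall P, PP P ->
     (\int[P]_w (D_ n w ^+ 2)%:E <= e%:E)%E) ->
  (forall n w, `|X_ n w - X w| <= U w * D_ n w + k * D_ n w ^+ 2) ->
  LG PP 1 t X.
Proof.
move=> mX X_L mU mD c0 k0 HU HD le; split => //; exists X_ => //.
apply/(Lp_cvgP _ _ _ PP0) => e e0.
(* This weight makes the contribution of U at most e/2; D is then taken small against the resulting
   factor [q]. *)
pose la := e / (c + 1); have la0 : 0 < la by rewrite divr_gt0//; lra.
have lac : la * c <= e.
  by rewrite /la mulrAC ler_pdivrMr ?ler_pM2l//; lra.
pose q := (2 * la)^-1 + k; have q0 : 0 < q by rewrite ltr_wpDr// invr_gt0; lra.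
have eq0 : 0 < e / (2 * q) by rewrite divr_gt0//; lra.
have [n0 Hn0] := HD _ eq0; exists n0 => n n0n P PPP.
have [iU EU] := HU P PPP.
have [iD ED] := integ_fin (measurable_funX 2 (mD n)) (fun w => sqr_ge0 _) (Hn0 n n0n P PPP).
have mXn := Lip_measurable (X_L n).
have iF : integ P (fun w => la / 2 * U w ^+ 2 + q * D_ n w ^+ 2).
  by apply: integD; exact: integZ.
apply: (@le_trans _ _ (\int[P]_w (la / 2 * U w ^+ 2 + q * D_ n w ^+ 2)%:E)%E).
  apply: ge0_le_int => //.
  - by apply: measurable_funX; apply: measurableT_comp => //; exact: measurable_funB.
  - exact: integ_measurable iF.
  move=> w _; rewrite expr1 (le_trans (le n w))// /q [leRHS]addrC mulrDl addrAC lerD2r addrC.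
  (* AM-GM with weight la *)
  have h := sqr_ge0 (la * U w - D_ n w).
  have -> : la / 2 * U w ^+ 2 + (2 * la)^-1 * D_ n w ^+ 2 =
    U w * D_ n w + (2 * la)^-1 * (la * U w - D_ n w) ^+ 2 by field; rewrite gt_eqF.
  by rewrite lerDl mulr_ge0// invr_ge0; lra.
rewrite integE// lee_fin ExD; [|exact: integZ|exact: integZ].
rewrite !ExZ// (@le_trans _ _ (e / 2 + q * (e / (2 * q))))//.
  apply: lerD; last by rewrite ler_pM2l.
  apply: (@le_trans _ _ (la / 2 * c)); first by rewrite ler_wpM2l//; lra.
  by rewrite mulrAC; lra.
have -> : q * (e / (2 * q)) = e / 2 by field; rewrite gt_eqF.
lra.
Qed.

Lemma LG1_lim t X : measurable_fun setT X ->
  (forall e, 0 < e -> exists2 Y, LG PP 1 t Y &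
     forall P, PP P -> (\int[P]_w (`|Y w - X w|)%:E <= e%:E)%E) -> LG PP 1 t X.
Proof.
move=> mX H; split => //.
have /choice[Z HZ] : forall n, exists Z, Lip t Z /\ forall P, PP P ->
    (\int[P]_w (`|Z w - X w|)%:E <= (n.+1%:R^-1)%:E)%E.
  move=> n; have e0 : 0 < (n.+1%:R^-1 : R) / 2 by rewrite divr_gt0.
  have [Y LY HY] := H _ e0; have [mY [Y_ Y_L cY]] := LY.
  have [n0 /(_ n0 (leqnn _)) Hn0] := (Lp_cvgP _ _ _ PP0).1 cY _ e0.
  exists (Y_ n0); split => // P PPP; have mYn := Lip_measurable (Y_L n0).
  have m1 : measurable_fun setT (fun w => `|Y w - X w|).
    by apply: measurableT_comp => //; exact: measurable_funB.
  have m2 : measurable_fun setT (fun w => `|Y_ n0 w - Y w|).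
    by apply: measurableT_comp => //; exact: measurable_funB.
  apply: (@le_trans _ _ (\int[P]_w (`|Y_ n0 w - Y w| + `|Y w - X w|)%:E)%E).
    apply: ge0_le_int => //.
    - by apply: measurableT_comp => //; exact: measurable_funB.
    - exact: measurable_funD.
    - by move=> w _; rewrite -[Y_ n0 w - X w](subrKA (Y w)) ler_normD.
  under eq_integral do rewrite EFinD.
  rewrite ge0_integralD//; [|exact/measurable_EFinP|exact/measurable_EFinP].
  by rewrite [_%:E](_ : _ = ((n.+1%:R^-1 : R) / 2)%:E + ((n.+1%:R^-1 : R) / 2)%:E)%E;
    [apply: leeD; [exact: Hn0|exact: HY]|rewrite -EFinD -splitr].
exists Z; first by move=> n; exact: (HZ n).1.
apply/(Lp_cvgP _ _ _ PP0) => e e0; have [n0 Hn0] := div_natS_le 1 e0.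
exists n0 => n n0n P PPP; apply: le_trans ((HZ n).2 P PPP) _.
by rewrite lee_fin -div1r Hn0.
Qed.

Lemma LG1D t X Y : LG PP 1 t X -> LG PP 1 t Y -> LG PP 1 t (fun w => X w + Y w).
Proof.
move=> [mX [X_ X_L cX]] [mY [Y_ Y_L cY]]; split; first exact: measurable_funD.
exists (fun n w => X_ n w + Y_ n w); first by move=> n; exact: Lip_add.
apply/(Lp_cvgP _ _ _ PP0) => e e0; have e20 : 0 < e / 2 by lra.
have [n1 H1] := (Lp_cvgP _ _ _ PP0).1 cX _ e20; have [n2 H2] := (Lp_cvgP _ _ _ PP0).1 cY _ e20.
exists (maxn n1 n2) => n; rewrite geq_max => /andP[n1n n2n] P PPP.
have mXn := Lip_measurable (X_L n); have mYn := Lip_measurable (Y_L n).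
have m1 : measurable_fun setT (fun w => `|X_ n w - X w|).
  by apply: measurableT_comp => //; exact: measurable_funB.
have m2 : measurable_fun setT (fun w => `|Y_ n w - Y w|).
  by apply: measurableT_comp => //; exact: measurable_funB.
apply: (@le_trans _ _ (\int[P]_w (`|X_ n w - X w| + `|Y_ n w - Y w|)%:E)%E).
  apply: ge0_le_int => //.
  - apply: measurable_funX; apply: measurableT_comp => //.
    by apply: measurable_funB; exact: measurable_funD.
  - exact: measurable_funD.
  - by move=> w _; rewrite expr1 opprD addrACA ler_normD.
under eq_integral do rewrite EFinD.
rewrite ge0_integralD//; [|exact/measurable_EFinP|exact/measurable_EFinP].
by rewrite (splitr e) EFinD; apply: leeD; [exact: H1|exact: H2].
Qed.

Lemma LG1_cst t (a : R) : LG PP 1 t (fun=> a).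
Proof.
split; first exact: measurable_cst.
exists (fun _ _ => a) => [n|]; first exact: Lip_cst.
apply/(Lp_cvgP _ _ _ PP0) => e e0; exists 0%N => n _ P _.
by under eq_integral do rewrite subrr normr0 expr1; rewrite integral0 lee_fin ltW.
Qed.

Lemma LG1_scale t (a : R) X : LG PP 1 t X -> LG PP 1 t (fun w => a * X w).
Proof.
move=> [mX [X_ X_L cX]]; split; first exact: measurable_funM.
exists (fun n w => a * X_ n w) => [n|]; first by apply: Lip_mul => //; exact: Lip_cst.
apply/(Lp_cvgP _ _ _ PP0) => e e0.
have a0 : 0 < `|a| + 1 by rewrite ltr_wpDl.
have e'0 : 0 < e / (`|a| + 1) by rewrite divr_gt0.
have [n0 H] := (Lp_cvgP _ _ _ PP0).1 cX _ e'0; exists n0 => n n0n P PPP.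
have mXn := Lip_measurable (X_L n).
under eq_integral do rewrite expr1 -mulrBr normrM EFinM.
rewrite ge0_integralZl_EFin//; last first.
  by apply/measurable_EFinP; apply: measurableT_comp => //; exact: measurable_funB.
apply: (@le_trans _ _ (`|a|%:E * (e / (`|a| + 1))%:E)%E); first by rewrite lee_wpmul2l ?lee_fin// H.
rewrite -EFinM lee_fin mulrCA -[leRHS]mulr1 ler_wpM2l ?(ltW e0)// ler_pdivrMr// mul1r; lra.
Qed.

Lemma LG1_sum t (I : Type) (e : seq I) (X : I -> Omega -> R) :
  (forall i, LG PP 1 t (X i)) -> LG PP 1 t (fun w => \sum_(i <- e) X i w).
Proof.
move=> H; elim: e => [|i e IH].
  by under eq_fun do rewrite big_nil; exact: LG1_cst.
by under eq_fun do rewrite big_cons; exact: LG1D.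
Qed.

Lemma LG2_mul t X Y : LG PP 2 t X -> LG PP 2 t Y -> LG PP 1 t (fun w => X w * Y w).
Proof.
move=> LX LY.
have [K1 K10 HK1] := LG2_bound LX; have [K2 K20 HK2] := LG2_bound LY.
have [mX [X_ X_L HX]] := (LG2P t X).1 LX; have [mY [Y_ Y_L HY]] := (LG2P t Y).1 LY.
have mn (Z : Omega -> R) : measurable_fun setT Z -> measurable_fun setT (fun w => `|Z w|).
  by move=> mZ; exact: measurableT_comp.
have mX_ n := Lip_measurable (X_L n); have mY_ n := Lip_measurable (Y_L n).
have sqD (a b : R) : (a + b) ^+ 2 <= 2 * a ^+ 2 + 2 * b ^+ 2.
  by have := sqr_ge0 (a - b); nra.
apply: (@LG1_of_bound _ _ (fun n w => X_ n w * Y_ n w) (fun w => `|X w| + `|Y w|)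
  (fun n w => `|X_ n w - X w| + `|Y_ n w - Y w|) (2 * K1 + 2 * K2) 1) => //.
- exact: measurable_funM.
- by move=> n; exact: Lip_mul.
- by apply: measurable_funD; exact: mn.
- by move=> n; apply: measurable_funD; apply: mn; exact: measurable_funB.
- by rewrite addr_ge0// mulr_ge0.
- move=> P PPP; have i1 := LG_integ2 PPP LX; have i2 := LG_integ2 PPP LY.
  have i3 := integD (integZ 2 i1) (integZ 2 i2).
  have le w : (`|X w| + `|Y w|) ^+ 2 <= 2 * X w ^+ 2 + 2 * Y w ^+ 2.
    by rewrite (le_trans (sqD _ _))// !real_normK ?num_real.
  have i4 : integ P (fun w => (`|X w| + `|Y w|) ^+ 2).
    apply: (integ_le _ _ i3); first by apply: measurable_funX; apply: measurable_funD; exact: mn.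
    by move=> w; rewrite ger0_norm ?sqr_ge0// (le_trans (le w))// ler_norm.
  split => //; rewrite (le_trans (Ex_le i4 i3 le))// ExD; [|exact: integZ|exact: integZ].
  by rewrite !ExZ// lerD// ler_pM2l// ?HK1 ?HK2.
- move=> e e0; have e40 : 0 < e / 4 by lra.
  have [n1 H1] := HX _ e40; have [n2 H2] := HY _ e40.
  exists (maxn n1 n2) => n; rewrite geq_max => /andP[n1n n2n] P PPP.
  have m1 : measurable_fun setT (fun w => (X_ n w - X w) ^+ 2).
    by apply: measurable_funX; exact: measurable_funB.
  have m2 : measurable_fun setT (fun w => (Y_ n w - Y w) ^+ 2).
    by apply: measurable_funX; exact: measurable_funB.
  have [i1 E1] := integ_fin m1 (fun w => sqr_ge0 _) (H1 n n1n P PPP).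
  have [i2 E2'] := integ_fin m2 (fun w => sqr_ge0 _) (H2 n n2n P PPP).
  have i3 := integD (integZ 2 i1) (integZ 2 i2).
  apply: (@le_trans _ _ (\int[P]_w (2 * (X_ n w - X w) ^+ 2 + 2 * (Y_ n w - Y w) ^+ 2)%:E)%E).
    apply: ge0_le_int => //.
    + by apply: measurable_funX; apply: measurable_funD; apply: mn; exact: measurable_funB.
    + exact: integ_measurable i3.
    + by move=> w _; rewrite (le_trans (sqD _ _))// !real_normK ?num_real.
  rewrite integE// lee_fin ExD; [|exact: integZ|exact: integZ].
  by rewrite !ExZ//; lra.
- move=> n w; rewrite mul1r.
  set x := X w; set y := Y w; set a := X_ n w - X w; set b := Y_ n w - Y w.
  have -> : X_ n w * Y_ n w - x * y = x * b + a * y + a * b by rewrite /x /y /a /b; ring.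
  have h1 := ler_normD (x * b + a * y) (a * b); have h2 := ler_normD (x * b) (a * y).
  rewrite !normrM in h1 h2.
  have := normr_ge0 x; have := normr_ge0 y; have := normr_ge0 a; have := normr_ge0 b.
  by move=> *; nra.
Qed.

Lemma LG2_sub t X Y : LG PP 2 t X -> LG PP 2 t Y -> LG PP 2 t (fun w => X w - Y w).
Proof.
move=> /LG2P[mX [X_ X_L HX]] /LG2P[mY [Y_ Y_L HY]]; apply/LG2P; split; first exact: measurable_funB.
exists (fun n w => X_ n w + - 1 * Y_ n w).
  by move=> n; apply: Lip_add => //; apply: Lip_mul => //; exact: Lip_cst.
move=> e e0; have e40 : 0 < e / 4 by lra.
have [n1 H1] := HX _ e40; have [n2 H2] := HY _ e40.
exists (maxn n1 n2) => n; rewrite geq_max => /andP[n1n n2n] P PPP.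
have mX_ := Lip_measurable (X_L n); have mY_ := Lip_measurable (Y_L n).
have a1 : (E2 P (fun w => X_ n w + - 1 * Y_ n w)%R (fun w => X w - Y_ n w)%R <= (e / 4)%:E)%E.
  apply: le_trans (H1 n n1n P PPP); rewrite le_eqVlt; apply/orP; left; apply/eqP.
  by apply: eq_integral => w _; congr ((_ ^+ _)%:E); ring.
have a2 : (E2 P (fun w => X w - Y_ n w)%R (fun w => X w - Y w)%R <= (e / 4)%:E)%E.
  apply: le_trans (H2 n n2n P PPP); rewrite le_eqVlt; apply/orP; left; apply/eqP.
  by apply: eq_integral => w _; rewrite -sqrrN; congr ((_ ^+ _)%:E); ring.
apply: le_trans (E2_triangle _ _ _ a1 a2) _.
- by apply: measurable_funD => //; apply: measurable_funM.
- exact: measurable_funB.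
- exact: measurable_funB.
by rewrite lee_fin; lra.
Qed.

Lemma LG2_lip_comp t X (h : R -> R) K : (forall x y, `|h x - h y| <= K * `|x - y|) ->
  LG PP 2 t X -> LG PP 2 t (fun w => h (X w)).
Proof.
move=> hl /LG2P[mX [X_ X_L HX]]; apply/LG2P.
have hll := lipschitz_locally hl; have hc := locally_lipschitz_continuous hll.
split; first by apply: measurableT_comp => //; exact: continuous_measurable_fun.
exists (fun n w => h (X_ n w)).
  by move=> n; apply: Lip_comp => //; exact: locally_lipschitz_bounded.
move=> e e0; have k0 : 0 < K ^+ 2 + 1 by rewrite ltr_wpDl ?sqr_ge0.
have e'0 : 0 < e / (K ^+ 2 + 1) by rewrite divr_gt0.
have [n0 Hn0] := HX _ e'0; exists n0 => n n0n P PPP.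
have mX_ := Lip_measurable (X_L n).
have m1 : measurable_fun setT (fun w => (X_ n w - X w) ^+ 2).
  by apply: measurable_funX; exact: measurable_funB.
have [i1 E1] := integ_fin m1 (fun w => sqr_ge0 _) (Hn0 n n0n P PPP).
have i2 := integZ (K ^+ 2) i1.
apply: (@le_trans _ _ (\int[P]_w (K ^+ 2 * (X_ n w - X w) ^+ 2)%:E)%E).
  apply: ge0_le_int => //.
  - apply: measurable_funX; apply: measurable_funB; apply: measurableT_comp => //;
      exact: continuous_measurable_fun.
  - exact: integ_measurable i2.
  - by move=> w _; exact: sqr_ge0.
  - move=> w _; rewrite -real_normK ?num_real// -[X in K ^+ 2 * X]real_normK ?num_real// -exprMn.
    by rewrite lerXn2r ?nnegrE// (le_trans _ (hl _ _)).
rewrite integE// ExZ// lee_fin (@le_trans _ _ (K ^+ 2 * (e / (K ^+ 2 + 1))))//.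
  by rewrite ler_wpM2l ?sqr_ge0.
rewrite mulrCA -[leRHS]mulr1 ler_wpM2l ?(ltW e0)// ler_pdivrMr// mul1r; lra.
Qed.

(** f grows at most quadratically, hence maps L_G^2 into L_G^1: each of f x - f y and f y - f x is
    bounded through the slope g at one of the two points, and both points are at most |y| + |x - y|
    in modulus. *)
Lemma LG1_convex t X (f g : R -> R) C : {homo g : x y / x <= y} ->
  (forall x y, g x * (y - x) <= f y - f x) -> (forall x, `|g x| <= C * (1 + `|x|)) ->
  LG PP 2 t X -> LG PP 1 t (fun w => f (X w)).
Proof.
move=> gnd fg gC LX; have C0 := growth_ge0 gC.
have fl := convex_locally_lipschitz gnd fg; have fc := locally_lipschitz_continuous fl.
have [K K0 HK] := LG2_bound LX; have [mX [X_ X_L HX]] := (LG2P t X).1 LX.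
have mX_ n := Lip_measurable (X_L n).
have mn (Z : Omega -> R) : measurable_fun setT Z -> measurable_fun setT (fun w => `|Z w|).
  by move=> mZ; exact: measurableT_comp.
apply: (@LG1_of_bound _ _ (fun n w => f (X_ n w)) (fun w => C * (1 + `|X w|))
  (fun n w => `|X_ n w - X w|) (C ^+ 2 * (2 + 2 * K)) C) => //.
- by apply: measurableT_comp => //; exact: continuous_measurable_fun.
- by move=> n; apply: Lip_comp => //; exact: locally_lipschitz_bounded.
- by apply: measurable_funM => //; apply: measurable_funD => //; exact: mn.
- by move=> n; apply: mn; exact: measurable_funB.
- by rewrite mulr_ge0 ?sqr_ge0// addr_ge0// mulr_ge0.
- move=> P PPP; have i1 := LG_integ2 PPP LX.
  have i3 := integZ (C ^+ 2) (integD (integ_cst P 2) (integZ 2 i1)).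
  have le w : (C * (1 + `|X w|)) ^+ 2 <= C ^+ 2 * (2 + 2 * X w ^+ 2).
    rewrite exprMn ler_wpM2l ?sqr_ge0// -(real_normK (num_real (X w))).
    by have := sqr_ge0 (1 - `|X w|); nra.
  have i4 : integ P (fun w => (C * (1 + `|X w|)) ^+ 2).
    apply: (integ_le _ _ i3).
      by apply: measurable_funX; apply: measurable_funM => //; apply: measurable_funD => //; exact: mn.
    by move=> w; rewrite ger0_norm ?sqr_ge0// (le_trans (le w))// ler_norm.
  split => //; rewrite (le_trans (Ex_le i4 i3 le))// ExZ; last first.
    by apply: integD; [exact: integ_cst|exact: integZ].
  rewrite ler_wpM2l ?sqr_ge0// ExD; [|exact: integ_cst|exact: integZ].
  by rewrite Ex_cst ExZ// lerD2l ler_pM2l// HK.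
- move=> e e0; have [n0 Hn0] := HX e e0; exists n0 => n n0n P PPP.
  by under eq_integral do rewrite real_normK ?num_real//; exact: Hn0.
- move=> n w; set x := X_ n w; set y := X w.
  (* The alternative lets one inequality serve for (x, y) and (y, x); its second case does not occur
     for them. *)
  have bd u v : `|u| <= `|y| + `|x - y| -> f u - f v <= C * (1 + (`|y| + `|x - y|)) * `|x - y| \/ `|u - v| != `|x - y|.
    move=> ub; have [E|E] := eqVneq `|u - v| `|x - y|; [left|by right].
    have := fg u v; rewrite -opprB mulrN => h.
    have : g u * (u - v) <= C * (1 + (`|y| + `|x - y|)) * `|x - y|.
      rewrite (le_trans (ler_norm _))// normrM E ler_wpM2r// (le_trans (gC u))//.
      by rewrite ler_wpM2l// lerD2l.
    lra.
  have xb : `|x| <= `|y| + `|x - y| by rewrite -[x in leLHS](subrK y) addrC; exact: ler_normD.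
  have yb : `|y| <= `|y| + `|x - y| by rewrite lerDl.
  have h1 : f x - f y <= C * (1 + (`|y| + `|x - y|)) * `|x - y| by case: (bd x y xb) => //; rewrite eqxx.
  have h2 : f y - f x <= C * (1 + (`|y| + `|x - y|)) * `|x - y| by case: (bd y x yb) => //; rewrite distrC eqxx.
  rewrite (_ : C * (1 + `|y|) * _ + _ = C * (1 + (`|y| + `|x - y|)) * `|x - y|); last by ring.
  by rewrite ler_norml; apply/andP; split; lra.
Qed.

End LG_spaces.

Lemma grid_dense (R : realType) (T s dl : R) : 0 < T -> 0 <= s <= T -> 0 < dl ->
  exists n k, (k <= n.+1)%N /\ `|s - grid 0 T n.+1 k| < dl.
Proof.
move=> T0 /andP[s0]; rewrite le_eqVlt => /predU1P[-> dl0|sT dl0].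
  by exists 0%N, 1%N; rewrite gridn// subrr normr0.
have dl20 : 0 < dl / 2 by rewrite divr_gt0.
have [n /(_ n (leqnn n)) Hn] := div_natS_le T dl20.
have sT' : 0 <= s < T by rewrite s0.
have [k /andP[h1]] := grid_cell (ltn0Sn n) sT'.
rewrite gridS subr0 => h2; exists n, k; split; first by rewrite ltnW// ltn_ord.
rewrite ger0_norm ?subr_ge0// ltrBlDl (lt_le_trans h2)// lerD2l (le_trans Hn)//.
by rewrite ler_pdivrMr// ler_peMr ?ltW// ltr1n.
Qed.

(** * From single probabilities back to the whole family *)

Section quasi_sure.
Context {R : realType} {d : nat} {T : R}.
Local Notation Omega := (path_space (R := R) d T).
Context (PP : set (probability Omega R)).

Lemma quasi_surely_ae P (S : set Omega) : PP P -> quasi_surely PP S -> {ae P, forall w, S w}.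
Proof.
move=> PPP [A [mA A0 H]]; apply: (null_ae mA) => //.
apply/eqP; rewrite eq_le measure_ge0 andbT -A0.
by apply: ereal_sup_ubound; exists P.
Qed.

Lemma capacity0 (A : set Omega) : PP !=set0 -> (forall P, PP P -> P A = 0%E) -> capacity PP A = 0%E.
Proof.
move=> [P0 PP0] H; apply/eqP; rewrite eq_le; apply/andP; split.
  by apply: ge_ereal_sup => _ [P PPP <-]; rewrite H.
by rewrite -(H P0 PP0); apply: ereal_sup_ubound; exists P0.
Qed.

Lemma ae_null (P : probability Omega R) (A : set Omega) : measurable A -> {ae P, forall w, ~ A w} -> P A = 0%E.
Proof.
move=> mA [N [mN N0 NA]]; apply/eqP; rewrite eq_le measure_ge0 andbT -N0.
apply: le_measure; rewrite ?inE//; move=> w Aw; apply: NA => /=; exact.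
Qed.

End quasi_sure.

Section step_integrands.
Context {R : realType} {d : nat} {T : R}.
Local Notation Omega := (path_space (R := R) d T).
Context (PP : set (probability Omega R)) (Lam : R) (M : R -> Omega -> R) (Q : Omega -> cumulative R R).
Hypotheses (T0 : 0 < T) (PP0 : PP !=set0)
  (ms : forall P, PP P -> martingale_setting P T Lam (limit_of_Lip P) M Q).
Implicit Types (P : probability Omega R) (t : R) (eta : R -> Omega -> R).

Lemma step_integrand_cells P (e : step_integrand PP 2) : PP P ->
  exists c : seq (cell P T (limit_of_Lip P)),
    eproc c = step_process e /\ forall t, eint M c t = step_integral M e t.
Proof.
move=> PPP.
have tm i j : (i <= j)%N -> (j <= step_size e)%N -> step_time e i <= step_time e j.
  elim: j => [|j IH]; first by rewrite leqn0 => /eqP ->.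
  rewrite leq_eqVlt => /predU1P[-> //|]; rewrite ltnS => ij js.
  by rewrite (le_trans (IH ij (ltnW js)))// step_time_le.
have lo0 (j : 'I_(step_size e)) : 0 <= step_time e j.
  by rewrite (le_trans (step_time0 e))// tm// ltnW.
have lohi (j : 'I_(step_size e)) : step_time e j <= step_time e j.+1 by exact: step_time_le.
have hiT (j : 'I_(step_size e)) : step_time e j.+1 <= T.
  by rewrite (le_trans _ (step_timeN e))// tm.
have A (j : 'I_(step_size e)) : limit_of_Lip P (step_time e j) (step_coef e j).
  by apply: (LG_limit_of_Lip PPP _ (step_coefP (ltn_ord j))).
have i2 (j : 'I_(step_size e)) : integ P (fun w => step_coef e j w ^+ 2).
  exact: LG_integ2 PPP (step_coefP (ltn_ord j)).
exists [seq Cell (lo0 j) (lohi j) (hiT j) (A j) (i2 j) | j <- index_enum 'I_(step_size e)].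
split=> [|t]; first by apply/funext => s; apply/funext => w; rewrite /eproc /simple_process big_map.
by apply/funext => w; rewrite /eint big_map.
Qed.

Lemma step_integral_is_int P (e : step_integrand PP 2) t : PP P -> 0 <= t <= T ->
  is_int P T (limit_of_Lip P) M Q t (step_process e) (step_integral M e t).
Proof.
move=> PPP tT; have [c [<- <-]] := step_integrand_cells e PPP.
exact: (is_int_elementary (ms PPP)).
Qed.

Lemma measurable_process_mproc eta : measurable_process eta -> mproc T eta.
Proof.
move=> me; apply: measurable_funS me.
  by apply: measurableX => //; exact: measurable_itv.
move=> [s w] [/= + _]; rewrite in_itv/= => /andP[s0 sT].
by split => //=; rewrite in_itv/= (ltW s0).
Qed.

Lemma Mbar_cvgP (en : nat -> step_integrand PP 2) eta : Mbar_cvg Q en eta <->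
  forall e, 0 < e -> exists n0, forall n, (n0 <= n)%N -> forall P, PP P ->
    (EQ2 P T Q (step_process (en n)) eta <= e%:E)%E.
Proof.
have E n w : (\int[lebesgue_stieltjes_measure (Q w)]_(t in (`]0%R, T] : set R))
    (`|step_process (en n) t w - eta t w| ^+ 2)%:E =
    IQ T Q (fun s w => (step_process (en n) s w - eta s w) ^+ 2)%R w)%E.
  by apply: eq_integral => s _; rewrite real_normK ?num_real.
rewrite /Mbar_cvg /Mbar_norm_pow.
under eq_cvg do under eq_fun do rewrite E.
rewrite upE_cvg0P//.
by move=> n w; apply: IQ_ge0 => s _; exact: sqr_ge0.
Qed.

Lemma Lp_cvg2P (X_ : nat -> Omega -> R) X : Lp_cvg PP 2 X_ X <->
  forall e, 0 < e -> exists n0, forall n, (n0 <= n)%N -> forall P, PP P -> (E2 P (X_ n) X <= e%:E)%E.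
Proof.
have E e P (Z : Omega -> R) : (\int[P]_w (`|Z w - X w| ^+ 2)%:E <= e%:E)%E = (E2 P Z X <= e%:E)%E.
  by congr (_ <= _)%E; apply: eq_integral => w _; rewrite real_normK ?num_real.
rewrite Lp_cvgP//; split=> H e e0; have [n0 Hn0] := H e e0; exists n0 => n n0n P PPP.
  by rewrite -E; exact: Hn0.
by rewrite E; exact: Hn0.
Qed.

(** Bridge from the notion uniform in P to that of a single P; through it the integral of the sign
    in the definition of the local time becomes usable. *)
Lemma stochastic_integral_is_int eta (I : R -> Omega -> R) P t : PP P -> 0 <= t <= T ->
  stochastic_integral PP M Q eta I -> is_int P T (limit_of_Lip P) M Q t eta (I t).
Proof.
move=> PPP tT [me [en /Mbar_cvgP cE cI] mI _].
apply: (is_int_lim (ms PPP) tT); [exact: measurable_process_mproc|exact: mI|].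
move=> e e0; have [n1 H1] := cE e e0; have [n2 H2] := (Lp_cvg2P _ _).1 (cI t tT) e e0.
exists (step_process (en (maxn n1 n2))), (step_integral M (en (maxn n1 n2)) t); split.
- exact: step_integral_is_int.
- by apply: H1 => //; rewrite leq_maxl.
- by apply: H2 => //; rewrite leq_maxr.
Qed.

End step_integrands.

Section ito_tanaka_formula.
Context {R : realType} {d : nat} {T : R}.
Local Notation Omega := (path_space (R := R) d T).
Context (PP : set (probability Omega R)) (Lam : R) (M : R -> Omega -> R) (Q : Omega -> cumulative R R).
Hypotheses (T0 : 0 < T) (PP0 : PP !=set0)
  (ms : forall P, PP P -> martingale_setting P T Lam (limit_of_Lip P) M Q)
  (cM : continuous_paths M) (M2 : forall t : R, 0 <= t <= T -> LG PP 2 t (M t)).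
Context (L : R -> R -> Omega -> R) (hL : local_time PP M Q L).
Context (f g : R -> R) (C : R) (mu : {measure set (measurableTypeR R) -> \bar R}).
Hypotheses (gnd : {homo g : x y / x <= y}) (gC : forall x, `|g x| <= C * (1 + `|x|))
  (fg : forall x y, g x * (y - x) <= f y - f x) (muE : is_stieltjes_measure g mu).
Implicit Types (P : probability Omega R) (t : R).
Local Notation is_int P := (is_int P T (limit_of_Lip P) M Q).

Let TT : 0 <= T := ltW T0.
Let zT : 0 <= (0 : R) <= T. Proof. by rewrite lexx TT. Qed.
Let cf : continuous f := locally_lipschitz_continuous (convex_locally_lipschitz gnd fg).
Let mM t : 0 <= t <= T -> measurable_fun setT (M t). Proof. by move=> tT; case: (M2 tT). Qed.
Let mL t a : 0 <= t <= T -> measurable_fun setT (L t a). Proof. by case: hL => _ + _ => h /h. Qed.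

Lemma local_time_dist w t a e : 0 <= t <= T -> 0 < e -> exists2 dl, 0 < dl &
  forall s b, 0 <= s <= T -> `|t - s| < dl -> `|a - b| < dl -> `|L t a w - L s b w| < e.
Proof.
move=> tT e0; have [cL _ _] := hL.
have /subspace_continuousP/(_ (t, a)) := cL w.
have h : (`[0, T]%classic `*` setT) (t, a) by split => //=; rewrite in_itv.
move=> /(_ h)/cvgrPdist_lt/(_ e e0); rewrite near_withinE => /nbhs_ballP[dl /= dl0 H].
exists dl => // s b sT ts ab; apply: (H (s, b)); first by split.
by split => //=; rewrite in_itv.
Qed.

Let cL t : 0 <= t <= T -> forall w, continuous (fun a => L t a w).
Proof.
move=> tT w a; apply/cvgrPdist_lt => e e0.
have [dl dl0 H] := local_time_dist w a tT e0.
by apply/nbhs_ballP; exists dl => //= b ab; apply: H => //; rewrite subrr normr0.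
Qed.

Let l_int P t a : PP P -> 0 <= t <= T ->
  is_int P t (fun s w => sgn_left (M s w - a)) (fun w => `|M t w - a| - `|M 0 w - a| - L t a w).
Proof.
move=> PPP tT; have [_ _ /(_ a)[J hJ HJ]] := hL.
have nm (k : Omega -> R) : measurable_fun setT k -> measurable_fun setT (fun w => `|k w - a|).
  by move=> mk; apply: measurableT_comp => //; exact: measurable_funB.
apply: (is_int_ae (ms PPP) tT (stochastic_integral_is_int PP0 ms PPP tT hJ)).
  by apply: measurable_funB; [apply: measurable_funB; apply: nm; exact: mM|exact: mL].
apply: filterS (quasi_surely_ae PPP (HJ t tT)) => w /= ->.
by ring.
Qed.

Definition path_bounded (N : R) (w : Omega) : Prop := forall s, 0 <= s <= T -> `|M s w| <= N.

(** Path continuity reduces the condition to countably many times, which makes it an event. *)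
Lemma path_bounded_grid N w : path_bounded N w <->
  forall n k, (k <= n.+1)%N -> `|M (grid 0 T n.+1 k) w| <= N.
Proof.
split=> [H n k kn|H s sT]; first by apply: H; exact: grid_itv.
rewrite leNgt; apply/negP => h; have e0 : 0 < `|M s w| - N by rewrite subr_gt0.
have cMw : {within `[0, T], continuous (M ^~ w)} by exact: cM.
have [dl dl0 Hd] := within_continuous_dist cMw sT e0.
have [n [k [kn sk]]] := grid_dense T0 sT dl0.
have := Hd _ (grid_itv TT kn (ltn0Sn n)) sk; have := H n k kn => h1.
by rewrite ltNge => /negP; apply; rewrite (le_trans _ (lerB_dist _ _))// lerB.
Qed.

Lemma path_bounded_measurable N : measurable [set w | path_bounded N w].
Proof.
have -> : [set w | path_bounded N w] =
    \bigcap_n \bigcap_k [set w | (k <= n.+1)%N -> `|M (grid 0 T n.+1 k) w| <= N].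
  apply/seteqP; split=> w /= h; first by move=> n _ k _; exact: ((path_bounded_grid N w).1 h).
  by apply/(path_bounded_grid N w) => n k kn; exact: (h n I k I).
apply: bigcapT_measurable => n; apply: bigcapT_measurable => k.
case: (leqP k n.+1) => kn; last first.
  by rewrite (_ : [set w | _] = setT); [exact: measurableT|apply/seteqP; split].
have mn : measurable_fun setT (fun w => `|M (grid 0 T n.+1 k) w|).
  by apply: measurableT_comp => //; apply: mM; exact: grid_itv.
rewrite (_ : [set w | _] = setT `&` (fun w => `|M (grid 0 T n.+1 k) w|) @^-1` `]-oo, N]).
  by apply: mn => //; exact: measurable_itv.
by apply/seteqP; split=> w /=; [rewrite in_itv/=; move=> /(_ isT)|rewrite in_itv/= => -[_ +] _].
Qed.

(* L is nonzero at a level that the path does not reach *)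
Definition bad_set : set Omega :=
  \bigcup_N \bigcup_n \bigcup_k \bigcup_(q : rat)
    [set w | [/\ (k <= n.+1)%N, N%:R < `|ratr q : R|, path_bounded N%:R w &
                 L (grid 0 T n.+1 k) (ratr q) w != 0]].

Lemma bad_set_measurable : measurable bad_set.
Proof.
apply: bigcupT_measurable => N; apply: bigcupT_measurable => n; apply: bigcupT_measurable => k.
apply: bigcupT_measurable_rat => q.
have [kn|kn] := boolP (k <= n.+1)%N; last first.
  by rewrite (_ : [set w | _] = set0)//; apply/seteqP; split => // w /= [].
have [Nq|Nq] := boolP (N%:R < `|ratr q : R|); last first.
  by rewrite (_ : [set w | _] = set0)//; apply/seteqP; split => // w /= [].
rewrite (_ : [set w | _] = [set w | path_bounded N%:R w] `&`
  (setT `&` (L (grid 0 T n.+1 k) (ratr q)) @^-1` (~` [set 0]))).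
  apply: measurableI; first exact: path_bounded_measurable.
  by apply: mL => //; [exact: grid_itv|exact: measurableC].
by apply/seteqP; split=> w /=; [move=> [_ _ h1 /eqP h2]; split|move=> [h1 [_ /eqP h2]]; split].
Qed.

(** Countably many times and rational levels, each settled by [local_time_support] up to a P-null
    set. As [bad_set] does not depend on P, it is null for all P at once. *)
Lemma bad_set_null P : PP P -> P bad_set = 0%E.
Proof.
move=> PPP; apply: ae_null; first exact: bad_set_measurable.
suff H : {ae P, forall w, forall N n k (q : rat), (k <= n.+1)%N -> N%:R < `|ratr q : R| ->
    path_bounded N%:R w -> L (grid 0 T n.+1 k) (ratr q) w = 0}.
  apply: filterS H => w H [N _ [n _ [k _ [q _ /= [kn Nq hb]]]]].
  by rewrite (H N n k q)// eqxx.
apply: ae_foralln => N; apply: ae_foralln => n; apply: ae_foralln => k.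
have H (q : rat) : {ae P, forall w, (k <= n.+1)%N -> N%:R < `|ratr q : R| ->
    path_bounded N%:R w -> L (grid 0 T n.+1 k) (ratr q) w = 0}.
  case: (boolP (k <= n.+1)%N) => kn; last by apply: aeW.
  case: (boolP (N%:R < `|ratr q : R|)) => Nq; last by apply: aeW.
  have gT : 0 <= grid 0 T n.+1 k <= T by exact: grid_itv.
  have := local_time_support (ms PPP) gT (fun a => l_int a PPP gT) (ler0n R N) Nq.
  by apply: filterS => w h _ _; exact: h.
(* [ae_foralln] ranges over the naturals, so the rationals are enumerated through [unpickle]. *)
have : {ae P, forall w, forall m, if unpickle m is Some q then (k <= n.+1)%N -> N%:R < `|ratr (q : rat) : R| ->
    path_bounded N%:R w -> L (grid 0 T n.+1 k) (ratr q) w = 0 else True}.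
  by apply: ae_foralln => m; case: (unpickle m) => [q|]; [exact: H|exact: aeW].
by apply: filterS => w h q; have := h (pickle q); rewrite pickleK.
Qed.

(** By joint continuity a nonzero value persists at a nearby grid time and at a nearby rational
    level still above N, which would put w in [bad_set]. *)
Lemma local_time_compact_support w (N : nat) t a : ~ bad_set w -> path_bounded N%:R w ->
  0 <= t <= T -> N%:R < `|a| -> L t a w = 0.
Proof.
move=> wA hb tT Na; apply: contrapT => /eqP L0; apply: wA.
have e0 : 0 < `|L t a w| by rewrite normr_gt0.
have [dl dl0 Hd] := local_time_dist w a tT e0.
have [n [k [kn tk]]] := grid_dense T0 tT dl0.
pose r := Num.min dl (`|a| - N%:R).
have r0 : 0 < r by rewrite lt_min dl0 subr_gt0.
have ar : a < a + r by rewrite ltrDl.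
have [q] := rat_in_itvoo ar.
rewrite in_itv/= => /andP[aq qa].
have aqr : `|a - ratr q| < r by rewrite ltr0_norm; lra.
have /andP[aq1 aq2] : (`|a - ratr q| < dl) && (`|a - ratr q| < `|a| - N%:R) by rewrite -lt_min.
exists N => //; exists n => //; exists k => //; exists q => //; split => //.
  have := lerB_dist a (a - ratr q); rewrite subKr.
  by move=> h; rewrite -[ratr q](subKr a) (lt_le_trans _ (lerB_dist _ _))// ltrBrDr -ltrBrDl.
apply/eqP => h0; have := Hd _ _ (grid_itv TT kn (ltn0Sn n)) tk aq1.
by rewrite h0 subr0 ltxx.
Qed.

Lemma path_bound w : exists N : nat, path_bounded N%:R w.
Proof.
have cMw : {within `[0, T], continuous (M ^~ w)} by exact: cM.
exact: (continuous_path_bounded TT cMw).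
Qed.

Definition tanaka t w := f (M t w) - f (M 0 w) - 2^-1 * (\int[mu]_a L t a w)%R.

(** Set to 0 on [bad_set], where the local time need not have compact support in a:
    [stochastic_integral] asks for continuous paths at every w. *)
Definition tanaka_integral t w := \1_(~` bad_set) w * tanaka t w.

Let mf t : 0 <= t <= T -> measurable_fun setT (fun w => f (M t w)).
Proof. by move=> tT; apply: measurableT_comp; [exact: continuous_measurable_fun|exact: mM]. Qed.

Let mint t : 0 <= t <= T -> measurable_fun setT (fun w => (\int[mu]_a L t a w)%R).
Proof.
by move=> tT; apply: (measurable_stieltjes muE); [move=> a; exact: mL|exact: cL].
Qed.

Lemma tanaka_integral_measurable t : 0 <= t <= T -> measurable_fun setT (tanaka_integral t).
Proof.
move=> tT; apply: measurable_funM.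
  by apply: measurable_indic; apply: measurableC; exact: bad_set_measurable.
apply: measurable_funB; first by apply: measurable_funB; exact: mf.
by apply: measurable_funM => //; exact: mint.
Qed.

Lemma tanaka_integralE t w : ~ bad_set w -> tanaka_integral t w = tanaka t w.
Proof. by move=> h; rewrite /tanaka_integral indicE mem_set// mul1r. Qed.

Lemma good_ae P : PP P -> {ae P, forall w, ~ bad_set w}.
Proof. by move=> PPP; apply: (null_ae bad_set_measurable (bad_set_null PPP)). Qed.

Lemma is_int_tanaka_integral P t : PP P -> 0 <= t <= T ->
  is_int P t (fun s w => g (M s w)) (tanaka_integral t).
Proof.
move=> PPP tT.
have h := is_int_tanaka (ms PPP) gnd gC fg muE tT (fun a => mL a tT) (cL tT) (fun a => l_int a PPP tT).
apply: (is_int_ae (ms PPP) tT (h _)); last 2 first.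
- exact: tanaka_integral_measurable.
- by apply: filterS (good_ae PPP) => w /tanaka_integralE ->.
apply: filterS (good_ae PPP) => w wA n hb a na.
exact: (local_time_compact_support wA hb tT na).
Qed.

Lemma local_time_integrable w t : ~ bad_set w -> 0 <= t <= T ->
  mu.-integrable setT (fun a => (L t a w)%:E).
Proof.
move=> wA tT; have [N hb] := path_bound w.
apply: (@integrable_compact_support _ g _ muE N.+1%:R (fun a => L t a w)) => //; first exact: cL.
by move=> a Na; apply: (local_time_compact_support wA hb tT); rewrite (lt_le_trans _ Na)// ltr_nat.
Qed.

Lemma tanaka_integral_continuous : continuous_paths tanaka_integral.
Proof.
move=> w; have [wA|wA] := pselect (bad_set w).
  rewrite (_ : (fun t => _) = (fun=> 0)); last first.
    by apply/funext => t; rewrite /tanaka_integral indicE memNset ?mul0r//; exact.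
  by apply: continuous_subspaceT => x; exact: cvg_cst.
rewrite (_ : (fun t => _) = tanaka ^~ w); last by apply/funext => t; exact: tanaka_integralE.
have [N hb] := path_bound w.
(* N + 1, because [local_time_compact_support] asks for the strict inequality N < |a|. *)
have Ns t a : 0 <= t <= T -> N.+1%:R <= `|a| -> L t a w = 0.
  by move=> tT Na; apply: (local_time_compact_support wA hb tT); rewrite (lt_le_trans _ Na)// ltr_nat.
apply/subspace_continuousP => t /=; rewrite in_itv/= => tT.
have cMw : {within `[0, T], continuous (M ^~ w)} by exact: cM.
apply: cvgB.
  apply: cvgB; last exact: cvg_cst.
  have /subspace_continuousP := within_continuous_comp_real cMw cf.
  by apply; rewrite /= in_itv.
apply: cvgMr; apply/cvgrPdist_le => e e0.
pose V := g N.+1%:R - g (- N.+1%:R).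
have V0 : 0 <= V by rewrite subr_ge0; apply: gnd; rewrite ge0_cp.
have e'0 : 0 < e / (V + 1) by rewrite divr_gt0//; lra.
have /compact_near_coveringP nc := @segment_compact R (- N.+1%:R) N.+1%:R.
(* Joint continuity and compactness of the interval of levels make L_s(a) continuous in s uniformly
   in a. *)
have H : \forall s \near within `[0, T] (nbhs t),
    [set` `[- N.+1%:R, N.+1%:R]] `<=` (fun a => `|L t a w - L s a w| <= e / (V + 1)).
  apply: nc => a _; have e'20 : 0 < e / (V + 1) / 2 by rewrite divr_gt0.
  have [dl dl0 Hd] := local_time_dist w a tT e'20.
  near=> b s; have sT : 0 <= s <= T.
    suff : `[0, T]%classic s by rewrite /= in_itv.
    by near: s; exact: withinT.
  have ab : `|a - b| < dl by near: b; exact: nbhsx_ballx.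
  have ts : `|t - s| < dl.
    by near: s; apply: cvg_within; exact: nbhsx_ballx.
  have h1 := Hd s b sT ts ab.
  have h2 : `|L t a w - L t b w| < e / (V + 1) / 2 by apply: Hd => //; rewrite subrr normr0.
  rewrite -[L t b w - _](subrKA (L t a w)) (le_trans (ler_normD _ _))// distrC.
  by rewrite ltW// (splitr (e / (V + 1))) ltrD.
near=> s; have sT : 0 <= s <= T.
  suff : `[0, T]%classic s by rewrite /= in_itv.
  by near: s; exact: withinT.
have Hs : [set` `[- N.+1%:R, N.+1%:R]] `<=` (fun a => `|L t a w - L s a w| <= e / (V + 1)).
  by near: s.
have N0 : 0 <= N.+1%:R :> R by [].
have iL u : 0 <= u <= T -> mu.-integrable `[- N.+1%:R, N.+1%:R[ (EFin \o (fun a => L u a w)).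
  by move=> uT; apply: (integrable_continuous_interval muE) => //; exact: cL.
rewrite (Rintegral_compact_support mu (Ns t ^~ tT)) (Rintegral_compact_support mu (Ns s ^~ sT)).
rewrite -RintegralB//; [|exact: iL|exact: iL].
have iD : mu.-integrable `[- N.+1%:R, N.+1%:R[ (EFin \o (fun a => L t a w - L s a w)).
  apply: (integrable_continuous_interval (phi := fun a => L t a w - L s a w) muE N0) => a.
  by apply: cvgB; exact: cL.
rewrite (le_trans (le_normr_Rintegral _ iD))//.
have ic : mu.-integrable `[- N.+1%:R, N.+1%:R[ (EFin \o (fun=> e / (V + 1))).
  exact: (integrable_continuous_interval muE N0 (@cst_continuous _ _ _)).
apply: (@le_trans _ _ (\int[mu]_(a in (`[- N.+1%:R, N.+1%:R[%classic : set (measurableTypeR R))) (e / (V + 1)))%R).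
  apply: le_Rintegral => //.
  - exact: (integrable_norm iD).
  - move=> a; rewrite /= in_itv/= => /andP[a1 a2]; apply: Hs.
    by rewrite /= in_itv/= a1 ltW.
rewrite Rintegral_cst// (stieltjes_interval muE)//= -/V.
by rewrite mulrAC ler_pdivrMr ?ler_pM2l//; lra.
Unshelve. all: end_near. Qed.

Lemma Ex_increment_bound P : PP P -> Ex P (fun w => `|M T w - M 0 w|) <= 1 + Lam * T.
Proof.
move=> PPP; have hT : 0 <= T <= T by rewrite TT lexx.
have i1 : integ P (fun w => `|M T w - M 0 w|).
  by apply: integ_norm; apply: integB; exact: (integ_M (ms PPP)).
have i2 := integ_increment2 (ms PPP) zT hT.
apply: (@le_trans _ _ (Ex P (fun w => 1 + (M T w - M 0 w) ^+ 2))).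
  apply: Ex_le => //; first by apply: integD => //; exact: integ_cst.
  by move=> w; rewrite -(real_normK (num_real (M T w - M 0 w))); have := sqr_ge0 (1 - `|M T w - M 0 w|);
    have := normr_ge0 (M T w - M 0 w); nra.
rewrite ExD//; last exact: integ_cst.
by rewrite Ex_cst lerD2l -[X in Lam * X](subr0 T); exact: (Ex_increment2 (ms PPP)).
Qed.

(** For all P at once, M_T is close in L2 to one bounded cylinder function. With K at least its
    bound, the excess of M_T over K is at most the distance to it. *)
Lemma uniform_tail e : 0 < e -> exists2 K, 1 <= K &
  forall P, PP P -> Ex P (fun w => excess K (M T w) ^+ 2) <= e.
Proof.
move=> e0; have hT : 0 <= T <= T by rewrite TT lexx.
have [mX [X_ X_L H]] := (LG2P PP0 T (M T)).1 (M2 hT).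
have [n0 /(_ n0 (leqnn _)) Hn0] := H e e0.
have [K HK] := Lip_bounded (X_L n0); have mXn := Lip_measurable (X_L n0).
exists (Num.max 1 K) => [|P PPP]; first by rewrite le_max lexx.
have m1 : measurable_fun setT (fun w => (X_ n0 w - M T w) ^+ 2).
  by apply: measurable_funX; exact: measurable_funB.
have [i1 E1] := integ_fin m1 (fun w => sqr_ge0 _) (Hn0 P PPP).
have ec : continuous (excess (Num.max 1 K)) by apply: (@Lip_continuous_real _ _ 2); exact: excess_lip.
have le w : excess (Num.max 1 K) (M T w) ^+ 2 <= (X_ n0 w - M T w) ^+ 2.
  rewrite -real_normK ?num_real// -[leRHS]real_normK ?num_real//.
  rewrite lerXn2r ?nnegrE// [leRHS]distrC; apply: excess_dist.
  by rewrite le_max HK orbT.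
have i2 : integ P (fun w => excess (Num.max 1 K) (M T w) ^+ 2).
  apply: (integ_le _ _ i1).
    by apply: measurable_funX; apply: measurableT_comp => //; exact: continuous_measurable_fun.
  by move=> w; rewrite !ger0_norm ?sqr_ge0.
exact: le_trans (Ex_le i2 i1 le) E1.
Qed.

(** Closed with [Defined]: its times and coefficients must compute for its step process to be
    recognized as a [grid_process]. *)
Let grid_integrand (N : R) (m k : nat) (N0 : 0 < N) (m0 : (0 < m)%N) : step_integrand PP 2.
Proof.
refine (@StepIntegrand _ _ _ PP 2 k.+1 (grid 0 T k.+1)
  (fun j w => ramp_fun g N m (M (grid 0 T k.+1 j) w)) _ _ _ _).
- by rewrite grid0.
- by move=> j _; exact: grid_le.
- by rewrite gridn.
- move=> j jk; apply: (LG2_lip_comp PP0 (ramp_fun_lip gnd N0 m0)).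
  by apply: M2; apply: grid_itv => //; exact: ltnW.
Defined.

Lemma approximating_integrand e : 0 < e -> exists i : step_integrand PP 2,
  (forall P, PP P -> (EQ2 P T Q (step_process i) (fun s w => g (M s w)) <= e%:E)%E) /\
  (forall t, 0 <= t <= T -> LG PP 1 t (step_integral M i t)).
Proof.
move=> e0; have C0 := growth_ge0 gC.
have Lam0 : 0 <= Lam by have [P PPP] := PP0; exact: (ms_Lam (ms PPP)).
(* 22 = 2 (2 (2 + 2) + 2) + 2: four errors through three triangle inequalities. *)
pose dl := e / 22; have dl0 : 0 < dl by rewrite divr_gt0.
pose c1 := (6 * C) ^+ 2 * (Lam * T).
have c10 : 0 <= c1 by rewrite mulr_ge0 ?sqr_ge0// mulr_ge0.
have dl10 : 0 < dl / (c1 + 1) by rewrite divr_gt0//; lra.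
(* The order of the choices matters: the truncation, then the mesh of the levels, then the mesh in
   time, which must beat the Lipschitz constant of the ramps, inversely proportional to the mesh of
   the levels. *)
have [K K1 HK] := uniform_tail dl10.
pose N := 2 * K; have N0 : 0 < N by rewrite /N; lra.
pose B := 1 + Lam * T.
pose V := g N - g (- N).
have [m /(_ m (leqnn m)) Hm] := div_natS_le (V ^+ 2 * (4 * (2 * N) * B)) dl0.
pose lip := V * (mesh N m.+1)^-1.
have [k /(_ k (leqnn k)) Hk] := div_natS_le (lip ^+ 2 * Lam ^+ 2 * T ^+ 2) dl0.
have rl := ramp_fun_lip gnd N0 (ltn0Sn m).
exists (grid_integrand k N0 (ltn0Sn m)); split=> [P PPP|t tT].
  have msP := ms PPP.
  have mr : measurable_fun setT (ramp_fun g N m.+1).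
    by apply: continuous_measurable_fun; exact: (Lip_continuous_real rl).
  have mst : measurable_fun setT (step_fun g N m.+1).
    apply: nondecreasing_measurable => // x y xy; rewrite /step_fun lerD2l.
    apply: ler_sum => i _; rewrite ler_wpM2l ?jump_ge0//.
    by case: (ltP (node N m.+1 i) x) => h //=; rewrite (lt_le_trans h xy).
  have mg : measurable_fun setT g by exact: nondecreasing_measurable.
  have mgc : measurable_fun setT (fun x => g (clamp N x)).
    by apply: nondecreasing_measurable => // x y xy; apply/gnd/clamp_nd.
  have pr := mproc_comp msP mr; have pst := mproc_comp msP mst.
  have pg := mproc_comp msP mg; have pgc := mproc_comp msP mgc.
  have [pgr _ _] := step_integral_is_int ms (grid_integrand k N0 (ltn0Sn m)) PPP zT.
  have cw : V ^+ 2 * (4 * mesh N m.+1 * Ex P (fun w => `|M T w - M 0 w|)) <= dl.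
    apply: le_trans Hm.
    rewrite [leRHS](_ : _ = V ^+ 2 * (4 * mesh N m.+1 * B)); last by rewrite /mesh; ring.
    rewrite ler_wpM2l ?sqr_ge0// ler_wpM2l ?Ex_increment_bound//.
    by rewrite mulr_ge0// ltW// mesh_gt0.
  have h1 : (EQ2 P T Q (step_process (grid_integrand k N0 (ltn0Sn m))) (fun s w => ramp_fun g N m.+1 (M s w)) <= dl%:E)%E.
    apply: le_trans (grid_process_error msP (ltn0Sn k) rl) _.
    by rewrite lee_fin.
  have h2 : (EQ2 P T Q (fun s w => ramp_fun g N m.+1 (M s w)) (fun s w => step_fun g N m.+1 (M s w)) <= dl%:E)%E.
    apply: le_trans (EQ2_cell_weight msP gnd N0 (ltn0Sn m) mr mst (ramp_fun_step gnd N0 (ltn0Sn m))) _.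
    by rewrite lee_fin.
  have h3 : (EQ2 P T Q (fun s w => step_fun g N m.+1 (M s w)) (fun s w => g (clamp N (M s w))) <= dl%:E)%E.
    apply: le_trans (EQ2_cell_weight msP gnd N0 (ltn0Sn m) mst mgc (step_fun_clamp gnd N0 (ltn0Sn m))) _.
    by rewrite lee_fin.
  have h4 : (EQ2 P T Q (fun s w => g (clamp N (M s w))) (fun s w => g (M s w)) <= dl%:E)%E.
    apply: le_trans (EQ2_clamp_growth msP gnd gC K1) _.
    rewrite lee_fin mulrA -/c1 (@le_trans _ _ (c1 * (dl / (c1 + 1))))//.
      by rewrite ler_wpM2l// HK.
    by rewrite mulrCA -[leRHS]mulr1 ler_wpM2l ?(ltW dl0)// ler_pdivrMr ?mul1r; lra.
  have h12 := EQ2_triangle msP pgr pr pst h1 h2.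
  have h13 := EQ2_triangle msP pgr pst pgc h12 h3.
  apply: le_trans (EQ2_triangle msP pgr pgc pg h13 h4) _.
  by rewrite lee_fin /dl; lra.
apply: (LG1_sum PP0 (X := fun j w => ramp_fun g N m.+1 (M (grid 0 T k.+1 j) w) *
  (M (Num.min (grid 0 T k.+1 j.+1) t) w - M (Num.min (grid 0 T k.+1 j) t) w)) (index_enum 'I_k.+1)) => j.
have /andP[t0 tT'] := tT.
have gI i : (i <= k.+1)%N -> 0 <= grid 0 T k.+1 i <= T by move=> h; exact: grid_itv.
have j0 := gI j (ltnW (ltn_ord j)); have j1 := gI j.+1 (ltn_ord j).
(* A cell after t contributes 0. Otherwise its coefficient and both values of M belong to times up
   to t, and a product of two elements of L_G^2 is in L_G^1. *)
have [jt|tj] := leP (grid 0 T k.+1 j) t; last first.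
  rewrite min_r; last by rewrite (le_trans (ltW tj))// grid_le.
  by under eq_fun do rewrite subrr mulr0; exact: LG1_cst.
apply: (LG2_mul PP0).
  by apply: (LG2_lip_comp PP0 rl); apply: (LG_le jt); exact: M2.
apply: (LG2_sub PP0); last by apply: (LG_le jt); exact: M2.
apply: (@LG_le _ _ _ _ _ (Num.min (grid 0 T k.+1 j.+1) t)); first by rewrite ge_min lexx orbT.
by apply: M2; move: j1 => /andP[j2 j3]; rewrite le_min j2 t0 ge_min j3.
Qed.

(** The integrands are chosen for the norm of integrands alone; the isometry, with its constant
    common to all P, carries the convergence to the integrals at every t, the limit being known in
    advance. *)
Lemma tanaka_stochastic_integral :
  stochastic_integral PP M Q (fun s w => g (M s w)) tanaka_integral.
Proof.
have /choice[en Hen] : forall n, exists i : step_integrand PP 2,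
    forall P, PP P -> (EQ2 P T Q (step_process i) (fun s w => g (M s w)) <= (n.+1%:R^-1)%:E)%E.
  by move=> n; have [|i [Hi _]] := approximating_integrand (e := n.+1%:R^-1); [|exists i].
split.
- have mg : measurable_fun setT g by exact: nondecreasing_measurable.
  exact: (measurableT_comp mg (continuous_paths_measurable T0 mM cM)).
- exists en.
    apply/(Mbar_cvgP Q PP0) => e e0; have [n0 Hn0] := div_natS_le 1 e0.
    exists n0 => n n0n P PPP; apply: le_trans (Hen n P PPP) _.
    by rewrite lee_fin -div1r Hn0.
  move=> t tT; apply/(Lp_cvg2P PP0) => e e0; have [n0 Hn0] := div_natS_le 16 e0.
  exists n0 => n n0n P PPP.
  apply: le_trans (is_int_isometry (ms PPP) tT (step_integral_is_int ms (en n) PPP tT)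
    (is_int_tanaka_integral PPP tT) (Hen n P PPP)) _.
  by rewrite lee_fin Hn0.
- exact: tanaka_integral_measurable.
- exact: tanaka_integral_continuous.
Qed.

(** Uniqueness of the integral under each P. The exceptional set is [bad_set] together with the
    event that I_t differs from the candidate: both are measurable and defined without P. *)
Lemma tanaka_formula (I : R -> Omega -> R) t :
  stochastic_integral PP M Q (fun s w => g (M s w)) I -> 0 <= t <= T ->
  quasi_surely PP [set w | (f (M t w) - f (M 0 w))%:E =
    ((I t w)%:E + (2^-1)%:E * \int[mu]_a (L t a w)%:E)%E].
Proof.
move=> hI tT; have [_ _ mI _] := hI.
pose B := setT `&` (fun w => I t w - tanaka_integral t w) @^-1` (~` [set 0]).
have mB : measurable B.
  have mD : measurable_fun setT (fun w => I t w - tanaka_integral t w).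
    by apply: measurable_funB; [exact: mI|exact: tanaka_integral_measurable].
  by apply: mD => //; exact: measurableC.
exists (bad_set `|` B); split.
- by apply: measurableU => //; exact: bad_set_measurable.
- apply: capacity0 => // P PPP; apply: ae_null.
    by apply: measurableU => //; exact: bad_set_measurable.
  have := is_int_unique (ms PPP) tT (stochastic_integral_is_int PP0 ms PPP tT hI) (is_int_tanaka_integral PPP tT).
  by apply: filterS2 (good_ae PPP) => w wA E [//|[_ /=]]; rewrite E subrr.
- move=> w /not_orP[wA wB] /=.
  have -> : I t w = tanaka t w.
    rewrite -tanaka_integralE//; apply: contrapT => h; apply: wB; split => //= /eqP.
    by rewrite subr_eq0 => /eqP.
  (* Off [bad_set] the local time is continuous in a with compact support, so the extended integral
     is finite. *)
  have -> : (\int[mu]_a (L t a w)%:E)%E = ((\int[mu]_a L t a w)%R)%:E.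
    by rewrite /Rintegral fineK// integrable_fin_num//; exact: local_time_integrable.
  by rewrite -EFinM -EFinD /tanaka subrK.
Qed.

(** The formula is solved for the local time term. With an elementary integral in place of the
    stochastic one, the expression lies in L_G^1, and the isometry brings it close uniformly in
    P. *)
Lemma local_time_integral_LG t : 0 <= t <= T -> LG PP 1 t (fun w => (\int[mu]_a L t a w)%R).
Proof.
move=> tT; have /andP[t0 _] := tT.
have Lf : LG PP 1 t (fun w => f (M t w) + - 1 * f (M 0 w)).
  apply: (LG1D PP0); first by apply: (LG1_convex PP0 gnd fg gC); exact: M2.
  apply: (LG1_scale PP0); apply: (LG_le t0).
  by apply: (LG1_convex PP0 gnd fg gC); exact: M2.
apply: (LG1_lim PP0); first exact: mint.
move=> e e0; have e20 : 0 < e / 2 by lra.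
(* The isometry multiplies by 16 and leaves (e/2)^2; this bounds the L1 distance by e/2, and the
   factor 2 from solving the formula gives e. *)
have e'0 : 0 < (e / 2) ^+ 2 / 16 by rewrite divr_gt0// exprn_gt0.
have [i [Hi Li]] := approximating_integrand e'0.
exists (fun w => 2 * ((f (M t w) + - 1 * f (M 0 w)) + - 1 * step_integral M i t w)).
  apply: (LG1_scale PP0); apply: (LG1D PP0) => //.
  by apply: (LG1_scale PP0); exact: Li.
move=> P PPP; have hint := step_integral_is_int ms i PPP tT; have [_ mS _] := hint.
have mW := tanaka_integral_measurable tT.
have mD : measurable_fun setT (fun w => step_integral M i t w - tanaka_integral t w) by exact: measurable_funB.
have h1 : (\int[P]_w (`|step_integral M i t w - tanaka_integral t w|)%:E <= (e / 2)%:E)%E.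
  apply: L1_cvg_of_L2 => //.
  under eq_integral do rewrite real_normK ?num_real//.
  apply: le_trans (is_int_isometry (ms PPP) tT hint (is_int_tanaka_integral PPP tT) (Hi P PPP)) _.
  by rewrite lee_fin mulrC divfK.
have [i1 E1] := integ_fin (measurableT_comp (@normr_measurable _ setT) mD) (fun w => normr_ge0 _) h1.
have mm : measurable_fun setT (fun w => 2 * ((f (M t w) + - 1 * f (M 0 w)) + - 1 * step_integral M i t w) - (\int[mu]_a L t a w)%R).
  apply: measurable_funB; last exact: mint.
  apply: measurable_funM => //; apply: measurable_funD; last exact: measurable_funM.
  by apply: measurable_funD; [exact: mf|apply: measurable_funM => //; exact: mf].
apply: (@le_trans _ _ (\int[P]_w (2 * `|step_integral M i t w - tanaka_integral t w|)%:E)%E); last first.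
  rewrite integE; last exact: (integZ 2 i1).
  by rewrite (ExZ 2 i1) lee_fin; move: E1 => /=; lra.
rewrite le_eqVlt; apply/orP; left; apply/eqP; apply: ae_eq_integral => //.
- by apply/measurable_EFinP; apply: measurableT_comp.
- apply/measurable_EFinP; apply: measurable_funM => //.
  exact: measurableT_comp.
- apply: filterS (good_ae PPP) => w wA _; congr EFin.
  rewrite tanaka_integralE// /tanaka; set l := (\int[mu]_a _)%R.
  rewrite (_ : 2 * _ - l = - 2 * (step_integral M i t w - (f (M t w) - f (M 0 w) - 2^-1 * l))); last by field.
  by rewrite normrM [X in X * _]normrN [X in X * _]ger0_norm.
Qed.

End ito_tanaka_formula.

Theorem theorem3p11 (R : realType) (d : nat) (T : R)
    (hd : (0 < d)%N) (hT : 0 < T)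
    (G : 'M[R]_d -> R) (hG : monotone_sublinear G)
    (PP : set (probability (path_space d T) R))
    (hPPc : weakly_compact PP) (hPP : represents_G_expectation G PP)
    (M : R -> path_space d T -> R) (hM : symmetric_G_martingale PP M)
    (hM2 : forall t : R, 0 <= t <= T -> LG PP 2 t (M t))
    (Lambda : R) (hLambda : 0 < Lambda)
    (hMvar : cond_variance_bound PP M Lambda)
    (Q : path_space d T -> cumulative R R) (hQ : quadratic_variation PP M Q)
    (L : R -> R -> path_space d T -> R) (hL : local_time PP M Q L)
    (f : R -> R) (hf : convex_function (E := R^o) setT f)
    (C : R) (hC : forall x, `|left_derivative f x| <= C * (1 + `|x|))
    (mu : {measure set (measurableTypeR R) -> \bar R})
    (hmu : is_stieltjes_measure (left_derivative f) mu) :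
  (exists I, stochastic_integral PP M Q
               (fun s w => left_derivative f (M s w)) I) /\
  (forall I, stochastic_integral PP M Q
               (fun s w => left_derivative f (M s w)) I ->
    forall t : R, 0 <= t <= T ->
      quasi_surely PP [set w |
        (f (M t w) - f (M 0 w))%:E =
          ((I t w)%:E + (2^-1)%:E * \int[mu]_a (L t a w)%:E)%E]) /\
  (forall t : R, 0 <= t <= T ->
    LG PP 1 t (fun w => (\int[mu]_a L t a w)%R)).
Proof.
have PP0 := PP_nonempty hPP (ltW hT).
have ms P (PPP : PP P) := G_martingale_setting hT hPP hM hM2 hLambda hMvar hQ PPP.
have [_ _ cM] := hM.
have gnd := left_derivative_nondecreasing hf.
have fg := left_derivative_subgradient hf.
split; [|split=> [I hI t tT|t tT]].
- by eexists; exact: (tanaka_stochastic_integral hT PP0 ms cM hM2 hL gnd hC fg hmu).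
- exact: (tanaka_formula hT PP0 ms cM hM2 hL gnd hC fg hmu hI tT).
- exact: (local_time_integral_LG hT PP0 ms cM hM2 hL gnd hC fg hmu tT).
Qed.
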